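(* Let $n>m\ge 1$ be integers. There exist constants $N=N(n,m)$, $c=c(n,m)$ and $\kappa=\kappa(n,m)$, depending only on $n$ and $m$, such that for every real $E>0$ there exists a constant $C_0=C_0(n,E)$ with the following property. Let $X\subset\mathbb{A}^n_{\mathbb{Q}}$ be an irreducible $m$-dimensional variety of degree $d>0$, and let $B>2$ be real. If $$C_0\le(\log B)^N<d<B^E,$$ then there exist no more than $c(\log B)^{\kappa}$ hypersurfaces $h_i\subset\mathbb{A}^n_{\mathbb{Q}}$ of degree $\le d-1$ which jointly contain $X(\mathbb{Z},B)$ (i.e. $X(\mathbb{Z},B)\subset\bigcup_i h_i$) and such that $X\not\subset h_i$ for each $i$.
   Context: A variety in $\mathbb{A}^n_{\mathbb{Q}}$ is a reduced (closed) subscheme of $\mathbb{A}^n_{\mathbb{Q}}$; irreducibility is over $\mathbb{Q}$ (not necessarily geometric). The degree of an affine variety is the degree of its closure in $\mathbb{P}^n$. $X(\mathbb{Z},B)$ denotes the set of points $(x_1,\dots,x_n)\in\mathbb{Z}^n$ lying on $X$ with $|x_i|\le B$ for all $i$. *)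

(* Defs.v *)
From HB Require Import structures.
From mathcomp Require Import all_boot all_order all_algebra ring_quotient.
From mathcomp Require Import mpoly.

Set Implicit Arguments.
Unset Strict Implicit.
Unset Printing Implicit Defensive.

Import GRing.Theory.

Local Open Scope ring_scope.

Section AffineVarieties.

Variable n : nat.

Implicit Types X Y : {pred {mpoly rat[n]}}.

(* A (nonempty) reduced closed subscheme X of affine n-space over Q is given  *)
(* by its ideal, i.e., by a proper radical ideal of Q[x_1, ..., x_n]; recall  *)
(* that idealr_closed includes properness.                                    *)
Definition variety X : Prop :=
  idealr_closed X /\ forall (f : {mpoly rat[n]}) (k : nat), f ^+ k \in X -> f \in X.

(* Passing to ideals reverses inclusions. *)
Definition subvariety X Y : Prop := {subset Y <= X}.

(* The ideal of the union of X1 and X2 is the intersection of their ideals.   *)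
Definition is_union X X1 X2 : Prop :=
  forall f, (f \in X) = (f \in X1) && (f \in X2).

Definition irreducible_variety X : Prop :=
  variety X /\
  forall X1 X2, variety X1 -> variety X2 -> is_union X X1 X2 ->
    X1 =i X \/ X2 =i X.

(* Z_0 < Z_1 < ... < Z_r inside X, all of them closed and irreducible         *)
Definition irreducible_chain X (r : nat) (Z : nat -> {pred {mpoly rat[n]}}) :
    Prop :=
  (forall i, (i <= r)%N -> irreducible_variety (Z i) /\ subvariety (Z i) X) /\
  (forall i, (i < r)%N -> subvariety (Z i) (Z i.+1) /\ ~ Z i =i Z i.+1).

(* Krull dimension *)
Definition has_dimension X (m : nat) : Prop :=
  (exists Z, irreducible_chain X m Z) /\
  (forall r Z, irreducible_chain X r Z -> (r <= m)%N).

(* F(x_0, x_1, ..., x_n) |-> F(1, x_1, ..., x_n) *)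
Definition dehomogenize (F : {mpoly rat[n.+1]}) : {mpoly rat[n]} :=
  F \mPo [tuple if unlift ord0 i is Some j then 'X_j else 1 | i < n.+1].

(* U is the degree k part of the homogeneous ideal of the closure of X in P^n *)
(* for the embedding (x_1, ..., x_n) |-> (1 : x_1 : ... : x_n): a form        *)
(* vanishes on the closure iff it vanishes on X.                              *)
Definition closure_ideal_part X (k : nat) (U : {vspace dhomog n.+1 rat k}) :
    Prop :=
  forall F : dhomog n.+1 rat k, (F \in U) = (dehomogenize F \in X).

Definition closure_hilbert_polynomial X (P : {poly rat}) : Prop :=
  exists k0 : nat, forall k : nat, (k0 <= k)%N ->
    exists2 U : {vspace dhomog n.+1 rat k}, closure_ideal_part X U &
      P.[k%:R] = (\dim {: dhomog n.+1 rat k} - \dim U)%:R.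

(* The degree of a projective variety of dimension r is r! times the leading  *)
(* coefficient of its Hilbert polynomial, whose degree is r.                  *)
Definition has_degree X (d : nat) : Prop :=
  exists2 P : {poly rat}, closure_hilbert_polynomial X P &
    d%:R = ((size P).-1)`!%:R * lead_coef P.

Definition point_on X (x : 'I_n -> int) : Prop :=
  forall f, f \in X -> f.@[fun i => (x i)%:~R] = 0.

(* A hypersurface is given by a nonconstant polynomial; msize is the total    *)
(* degree plus one.                                                           *)
Definition hypersurface (h : {mpoly rat[n]}) : Prop := (1 < msize h)%N.

Definition hypersurface_degree (h : {mpoly rat[n]}) : nat := (msize h).-1.

Definition point_on_hypersurface (h : {mpoly rat[n]}) (x : 'I_n -> int) : Prop :=
  h.@[fun i => (x i)%:~R] = 0.

Definition in_hypersurface X (h : {mpoly rat[n]}) : Prop := h \in X.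

End AffineVarieties.

(* Main.v *)
(** Noether normalization together with the Hilbert polynomial of [X] gives a linear
    projection of [X] to affine space of dimension [k = m + 1], with coefficients that are
    integers polynomially bounded in [d], such that no nonzero polynomial of degree [< d]
    vanishes on the image of [X] but some [f] of degree [<= d] does.  It thus suffices to cover
    the integer zeros of [f] in a box of side [2 ^ L], with [L] about [(log B) ^ 2], by
    hypersurfaces of degree [< d]: their pull-backs cannot contain [X].

    Let [s] be the number of monomials of degree [< d].  For a prime [p] and a residue class
    [P] modulo [p], consider the dimension over the field with [p] elements of polynomials
    modulo [f] and the [2j]-th power of the maximal ideal of [P].  If it is at most [s / 2], the
    pigeonhole principle (Siegel's lemma) yields one polynomial of degree [< d] that vanishes at
    all zeros of [f] in the box that are congruent to [P]: its values there are divisible by a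
    power of [p] exceeding their absolute value.  The other classes modulo [p] are few, since by
    Hermite interpolation their local conditions are independent, while polynomials modulo [f]
    grow only like a hypersurface.  The points lying in such a class for every [p <= Q] are then
    killed by a single polynomial of degree [< d], by Siegel's lemma for all [p <= Q] at once;
    Chebyshev's lower bound for the number of primes shows that [Q] can be taken to be
    polynomial in [log B]. *)
Require Import Defs.
From HB Require Import structures.
From mathcomp Require Import all_boot all_order all_algebra all_field ring_quotient.
From mathcomp Require Import polyrcf mpoly.
From mathcomp Require Import boolp reals sequences exp ring lra zify.

Set Implicit Arguments.
Unset Strict Implicit.
Unset Printing Implicit Defensive.

Import Order.TTheory GRing.Theory Num.Theory.

(** * A lower bound for the number of primes *)

(** The exponents balance as follows. Let [k] be the number of coordinates after projection. The
    logarithm of the values to be beaten is about [L d], so a low class needs vanishing order about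
    [L d], and interpolation takes place in degree about [p L d]. Polynomials modulo [f] of that
    degree number about [d (p L d) ^ (k - 1)], against [s] of order [d ^ k]: hence at most about
    [(p L) ^ (k - 1)] classes are high, a bound free of [d]. At that many points for each prime
    [p <= Q], a polynomial of degree [< d] can be controlled to order about
    [d / (L Q ^ ((k - 1) / k))], and it must vanish once this order times the number of primes
    exceeds a multiple of [L d]. As [(k - 1) / k < 1], a [Q] polynomial in [L] suffices, even after
    the loss of a logarithm in counting primes. The lower bound on [d] makes the order at least 1.

    The counts use all [s] monomials because degree [< d] is exactly the range in which no relation
    holds on the image of [X]; this is why the projection must preserve the degree and not merely
    the dimension. *)

Definition primes_upto N := [seq p <- iota 0 N.+1 | prime p].

(** By Legendre's formula the exponent of [p] is the sum over [k] of [2n %/ p ^ k - 2 (n %/ p ^ k)];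
    each term is at most 1, and it is 0 once [p ^ k > 2n]. *)
Lemma logn_central_bin p n : prime p -> (0 < n)%N -> (p ^ logn p 'C(2 * n, n) <= 2 * n)%N.
Proof.
move=> p_pr n0; have n2 : (0 < 2 * n)%N by rewrite muln_gt0.
set t := trunc_log p (2 * n).
apply: (@leq_trans (p ^ t)); last by apply: trunc_logP; rewrite ?prime_gt1.
rewrite leq_exp2l ?prime_gt1 //.
have le_n : (n <= 2 * n)%N by rewrite leq_pmull.
have binE : ('C(2 * n, n) * (n`! * n`!) = (2 * n)`!)%N.
  by rewrite -(bin_fact le_n); congr (_ * (_ * _`!))%N; lia.
have /(congr1 (logn p)) := binE.
rewrite !lognM ?fact_gt0 ?bin_gt0 ?muln_gt0 ?fact_gt0 // !logn_fact //.
have -> : (\sum_(1 <= k < n.+1) n %/ p ^ k = \sum_(1 <= k < (2 * n).+1) n %/ p ^ k)%N.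
  rewrite [RHS](@big_cat_nat _ _ _ n.+1) //= [X in (_ + X)%N](_ : _ = 0%N) ?addn0 //.
  rewrite big_nat_cond big1 // => k.
  rewrite andbT => /andP[nk _]; rewrite divn_small //.
  by apply: ltn_trans (ltn_expl k (prime_gt1 p_pr)).
have : (\sum_(1 <= k < (2 * n).+1) (2 * n) %/ p ^ k <=
    \sum_(1 <= k < (2 * n).+1) (n %/ p ^ k + n %/ p ^ k) + t)%N.
  have -> : t = (\sum_(1 <= k < (2 * n).+1) (k <= t))%N.
    have tn : (t < (2 * n).+1)%N.
      by rewrite ltnS; apply: leq_trans (trunc_logP (prime_gt1 p_pr) n2); apply/ltnW/ltn_expl/prime_gt1.
    rewrite (@big_cat_nat _ _ _ t.+1) //= [X in (_ + X)%N](_ : _ = 0%N) ?addn0.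
      rewrite big_nat_cond (eq_bigr (fun=> 1%N)) => [|k].
        by rewrite -big_nat_cond sum_nat_const_nat muln1 subn1.
      by rewrite andbT => /andP[_]; rewrite ltnS => ->.
    rewrite big_nat_cond big1 // => k.
    by rewrite andbT => /andP[tk _]; rewrite leqNgt tk.
  rewrite -big_split /=; apply: leq_sum => k _.
  have pk0 : (0 < p ^ k)%N by rewrite expn_gt0 prime_gt0.
  have [kt|tk] := leqP k t.
    by rewrite -ltnS ltn_divLR // addn1; have := divn_eq n (p ^ k); have := ltn_pmod n pk0; nia.
  by rewrite divn_small //; apply: leq_trans (trunc_log_ltn _ (prime_gt1 p_pr)) _; rewrite leq_exp2l ?prime_gt1.
by rewrite big_split /=; lia.
Qed.

(** The coefficient is a product of quotients [(2n - i) / (n - i)], each at least 2. *)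
Lemma central_bin_lower n : (2 ^ n <= 'C(2 * n, n))%N.
Proof.
rewrite -(@leq_pmul2r n`!) ?fact_gt0 // bin_ffact -ffactnn !ffact_prod.
rewrite -[X in (2 ^ X)%N]card_ord -prod_nat_const -big_split; apply: leq_prod => i _ /=.
by have := ltn_ord i; lia.
Qed.

(** With [2n = 2 ^ a], the central binomial coefficient is at least [2 ^ n] and is a product, over
    primes up to [2 ^ a], of prime powers at most [2 ^ a]. A power of two keeps the logarithm an
    integer. *)
Lemma chebyshev_lower a : (0 < a)%N -> (2 ^ a <= 2 * a * size (primes_upto (2 ^ a)))%N.
Proof.
case: a => // a _; set n := (2 ^ a)%N; have nE : (2 ^ a.+1 = 2 * n)%N by rewrite expnS.
have n0 : (0 < n)%N by rewrite expn_gt0.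
have C0 : (0 < 'C(2 * n, n))%N by rewrite bin_gt0 leq_pmull.
suff : (2 ^ n <= 2 ^ (a.+1 * size (primes_upto (2 ^ a.+1))))%N.
  by rewrite leq_exp2l // nE -mulnA leq_pmul2l.
apply: leq_trans (central_bin_lower n) _.
rewrite [X in (X <= _)%N](prod_prime_decomp C0) prime_decompE big_map /= big_seq.
apply: (@leq_trans (\prod_(p <- primes 'C(2 * n, n) | p \in primes 'C(2 * n, n)) (2 * n))).
  apply: leq_prod => p; rewrite mem_primes => /andP[p_pr _].
  exact: logn_central_bin.
rewrite -big_seq big_const_seq count_predT iter_muln_1 -nE -expnM leq_exp2l // leq_mul2l.
apply/orP; right; apply: uniq_leq_size; first exact: primes_uniq.
move=> p; rewrite mem_primes mem_filter mem_iota => /and3P[p_pr _ pC].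
rewrite p_pr /= add0n ltnS nE.
have le_n : (n <= 2 ^ a.+1)%N by rewrite nE leq_pmull.
have : (p %| (2 * n)`!)%N by rewrite -nE -(bin_fact le_n) dvdn_mulr.
rewrite fact_prod big_nat; elim/big_ind: _ => [|u v|i /andP[i0 i2]].
- by rewrite dvdn1 => /eqP pE; rewrite pE in p_pr.
- by move=> IHu IHv; rewrite Euclid_dvdM // => /orP[].
by move/(dvdn_leq i0) => pi; apply: leq_trans pi _.
Qed.

Local Open Scope ring_scope.

(** * Linear algebra *)

Lemma exists_left_kernel (F : fieldType) (I J : finType) (C : I -> J -> F) :
  (#|J| < #|I|)%N ->
  exists2 c : I -> F, (exists i, c i != 0) & forall j, \sum_i c i * C i j = 0.
Proof.
move=> lt_JI; pose A := \matrix_(i < #|I|, j < #|J|) C (enum_val i) (enum_val j).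
have: kermx A != 0.
  by rewrite kermx_eq0 /row_free neq_ltn (leq_ltn_trans (rank_leq_col _)).
case/rowV0Pn=> u /sub_kermxP uA0 u_neq0.
have [i ui] : exists i, u 0 i != 0.
  apply/existsP; apply: contraNT u_neq0 => /existsPn u0.
  by apply/eqP/rowP=> i; rewrite mxE; apply/eqP/negPn/u0.
exists (fun i => u 0 (enum_rank i)).
  by exists (enum_val i); rewrite enum_valK.
move=> j; have := congr1 (fun v : 'rV_#|J| => v 0 (enum_rank j)) uA0.
rewrite !mxE (reindex (@enum_rank I)) /=; last exact/onW_bij/enum_rank_bij.
by move=> uA_j; rewrite -[RHS]uA_j; apply: eq_bigr => k _; rewrite !mxE !enum_rankK.
Qed.

(** Linear independence through an embedding, so that a function field need not carry a vector space
    structure over the rationals. *)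
Definition free_over (F E : pzRingType) (iota : F -> E) (I : finType) (v : I -> E) :=
  forall c : I -> F, \sum_i iota (c i) * v i = 0 -> forall i, c i = 0.

Lemma free_over_leq (F E : fieldType) (iota : {rmorphism F -> E}) (I J : finType)
    (v : I -> E) (w : J -> E) (C : I -> J -> F) :
  free_over iota v -> (forall i, v i = \sum_j iota (C i j) * w j) -> (#|I| <= #|J|)%N.
Proof.
move=> free_v vE; rewrite leqNgt; apply/negP=> /(exists_left_kernel C)[c [i ci] cC].
suff /free_v/(_ i) ci0 : \sum_i iota (c i) * v i = 0 by rewrite ci0 eqxx in ci.
under eq_bigr => k _ do rewrite vE mulr_sumr.
rewrite exchange_big big1 // => j _.
under eq_bigr => k _ do rewrite mulrA -rmorphM.
by rewrite -mulr_suml -rmorph_sum cC rmorph0 mul0r.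
Qed.

(** * Bases modulo a subspace *)

Section Greedy.

Variables (F : fieldType) (V : lmodType F) (S Z : V -> Prop).
Hypothesis Z_lin : forall a u v, Z u -> Z v -> Z (a *: u + v).

Definition free_mod N (b : 'I_N -> V) :=
  forall c : 'I_N -> F, Z (\sum_i c i *: b i) -> forall i, c i = 0.

Definition spans_mod N (e : 'I_N -> V) :=
  forall g, S g -> exists c : 'I_N -> F, Z (g - \sum_i c i *: e i).

(** This dichotomy stands in for the dimension of the span of [S] modulo [Z], which may be infinite.
    It later separates low residue classes from high ones. *)
Lemma greedy_basis N :
  (exists2 h, (h <= N)%N & exists e : 'I_h -> V,
     [/\ forall i, S (e i), free_mod e & spans_mod e]) \/
  (exists b : 'I_N.+1 -> V, (forall i, S (b i)) /\ free_mod b).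
Proof.
have extend h (e : 'I_h -> V) : (forall i, S (e i)) -> free_mod e -> ~ spans_mod e ->
    exists b : 'I_h.+1 -> V, (forall i, S (b i)) /\ free_mod b.
  move=> Se free_e /existsNP[g /not_implyP[Sg /forallNP gP]].
  exists (fun i => if unlift ord_max i is Some j then e j else g); split.
    by move=> i; case: unliftP => [j|] _.
  move=> c; rewrite big_ord_recr /= unlift_none.
  under eq_bigr => i _.
    have -> : widen_ord (leqnSn h) i = lift ord_max i by apply/val_inj; rewrite /= /bump leqNgt ltn_ord.
    rewrite liftK; over.
  move=> Zc; have cm0 : c ord_max = 0.
    apply/eqP; apply: contra_notT (gP (fun i => - (c ord_max)^-1 * c (lift ord_max i))).
    move=> cN0; rewrite -[X in Z X]addr0; have Z0 : Z 0.
      by have := Z_lin (-1) Zc Zc; rewrite scaleN1r addNr.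
    have := Z_lin (c ord_max)^-1 Zc Z0; rewrite scalerDr scalerA mulVf // scale1r addrC addrA.
    rewrite !addr0 add0r addrC; congr (Z (_ + _)).
    by rewrite scaler_sumr -sumrN; apply: eq_bigr => i _; rewrite scalerA -scaleNr mulNr opprK.
  move: Zc; rewrite cm0 scale0r addr0 => /free_e ce i.
  by case: (unliftP ord_max i) => [j ->|->].
elim: N => [|N [[h le_hN hP]|[b [Sb free_b]]]].
- have [sp|nsp] := pselect (spans_mod (fun i : 'I_0 => 0 : V)).
    left; exists 0%N => //; exists (fun i => 0); split=> // [|c _] [] //.
  right; apply: (extend _ _ _ _ nsp); [by case|by move=> c _ []].
- by left; exists h => //; apply: leqW.
- have [sp|nsp] := pselect (spans_mod b); last by right; apply: (extend _ b).
  by left; exists N.+1 => //; exists b.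
Qed.

End Greedy.

(** * Multivariate polynomials *)

Lemma mpoly_rmorph_ext (R : comNzRingType) (S : comNzRingType) n
    (f g : {rmorphism {mpoly R[n]} -> S}) :
  (forall c, f c%:MP = g c%:MP) -> (forall i, f 'X_i = g 'X_i) -> f =1 g.
Proof.
move=> fgC fgX p; rewrite [p]mpolyE !rmorph_sum /=; apply: eq_bigr => m _.
rewrite -mul_mpolyC !rmorphM /= fgC; congr (_ * _).
by rewrite mpolyXE_id !rmorph_prod; apply: eq_bigr => i _; rewrite !rmorphXn fgX.
Qed.

Lemma card_bmnm k D : #|{: 'X_{1..k < D.+1}}| = 'C(k + D, k).
Proof.
rewrite -card_partial_ord_partitions.
pose f (m : 'X_{1..k < D.+1}) : k.-tuple 'I_D.+1 := [tuple inord (m i) | i < k].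
have mi_lt (m : 'X_{1..k < D.+1}) i : (m i < D.+1)%N.
  by apply: leq_ltn_trans (bmdeg m); rewrite mdegE (bigD1 i) //= leq_addr.
have sum_f (m : 'X_{1..k < D.+1}) : (\sum_(i <- f m) i = mdeg m)%N.
  rewrite big_tuple mdegE; apply: eq_bigr => i _.
  by rewrite tnth_mktuple inordK.
rewrite -(card_imset (f := f)); last first.
  move=> m1 m2 /(congr1 (fun t => tnth t)) eq_f; apply/val_inj/mnmP => i /=.
  have := congr1 (fun g => val (g i)) eq_f; rewrite /= !tnth_mktuple.
  by rewrite !inordK.
apply: eq_card => t; rewrite inE; apply/imsetP/idP => [[m _ ->]|].
  by rewrite sum_f -ltnS bmdeg.
move=> le_t; have mdeg_t : (mdeg [multinom (tnth t i : nat) | i < k] < D.+1)%N.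
  by rewrite mdegE ltnS; apply: leq_trans le_t; rewrite big_tuple; under eq_bigr do rewrite mnmE.
exists (BMultinom mdeg_t) => //; apply: eq_from_tnth => i.
by rewrite /f tnth_mktuple /= mnmE inord_val.
Qed.

Section MsizeBounds.

Variable R : idomainType.

Lemma msizeM_leq n (p q : {mpoly R[n]}) a b :
  (msize p <= a.+1)%N -> (msize q <= b.+1)%N -> (msize (p * q) <= (a + b).+1)%N.
Proof.
have [->|p0] := eqVneq p 0; first by rewrite mul0r msize0.
have [->|q0] := eqVneq q 0; first by rewrite mulr0 msize0.
rewrite msizeM // => pa qb.
by have := leq_add pa qb; rewrite addSn addnS; case: (_ + _)%N.
Qed.

Lemma msize_prod_leq n (I : Type) (r : seq I) (F : I -> {mpoly R[n]}) (a : I -> nat) :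
  (forall i, msize (F i) <= (a i).+1)%N ->
  (msize (\prod_(i <- r) F i) <= (\sum_(i <- r) a i).+1)%N.
Proof.
move=> Fa; elim: r => [|i r IH]; first by rewrite !big_nil msize1.
by rewrite !big_cons; apply: msizeM_leq.
Qed.

Lemma msizeX_leq n (p : {mpoly R[n]}) a k :
  (msize p <= a.+1)%N -> (msize (p ^+ k) <= (k * a).+1)%N.
Proof.
move=> pa; elim: k => [|k IH]; first by rewrite expr0 msize1.
by rewrite exprS mulSn; apply: msizeM_leq.
Qed.

Lemma msize_sum_leq n (I : Type) (r : seq I) (P : pred I) (F : I -> {mpoly R[n]}) d :
  (forall i, P i -> msize (F i) <= d)%N -> (msize (\sum_(i <- r | P i) F i) <= d)%N.
Proof.
move=> Fd; elim/big_rec: _ => [|i p Pi IH]; first by rewrite msize0.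
by apply: leq_trans (msizeD_le _ _) _; rewrite geq_max Fd.
Qed.

Lemma msize_comp_linear n k (p : {mpoly R[n]}) (lq : n.-tuple {mpoly R[k]}) :
  (forall i, msize (tnth lq i) <= 2)%N -> (msize (p \mPo lq) <= msize p)%N.
Proof.
move=> lq2; have [->|p0] := eqVneq p 0; first by rewrite comp_mpoly0 !msize0.
rewrite comp_mpolyE; rewrite big_seq; apply: msize_sum_leq => m mp.
apply: leq_trans (msizeZ_le _ _) _; apply: leq_trans (msize_mdeg_lt mp).
rewrite mdegE; apply: msize_prod_leq => i.
by rewrite -[X in (_ <= X.+1)%N]muln1; apply: msizeX_leq.
Qed.

End MsizeBounds.

Lemma mmap_comp (R : comNzRingType) (S : comNzRingType) n k (h : 'I_k -> S)
    (f : {rmorphism R -> S}) (p : {mpoly R[n]}) (lq : n.-tuple {mpoly R[k]}) :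
  mmap f h (p \mPo lq) = mmap f (fun i => mmap f h (tnth lq i)) p.
Proof.
pose F : {rmorphism {mpoly R[n]} -> S} := mmap f h \o comp_mpoly lq.
pose G : {rmorphism {mpoly R[n]} -> S} := mmap f (fun i => mmap f h (tnth lq i)).
apply: (@mpoly_rmorph_ext _ _ _ F G) => [c|i]; rewrite /F /G /=.
  by rewrite comp_mpolyC !mmapC.
by rewrite comp_mpolyXU -tnth_nth mmapX mmap1U.
Qed.

Lemma mmapXU (R : nzRingType) (S : nzRingType) n (h : 'I_n -> S) (f : {rmorphism R -> S}) i :
  mmap f h 'X_i = h i.
Proof. by rewrite mmapX mmap1U. Qed.

(** [muni] turns the last variable into the variable of a univariate polynomial. *)
Section Muni.

Variables (R : comNzRingType) (n : nat).
Notation widen := (widen_ord (leqnSn n)).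

Lemma muniX_widen (i : 'I_n) : muni ('X_(widen i) : {mpoly R[n.+1]}) = ('X_i)%:P.
Proof.
rewrite muniE msuppX big_seq1 mcoeffX eqxx scale1r mnm1E -val_eqE /=.
rewrite (ltn_eqF (ltn_ord i)) expr0 alg_polyC; congr ('X_[_])%:P.
by apply/mnmP => j; rewrite mnmE !mnm1E.
Qed.

Lemma muniX_max : muni ('X_ord_max : {mpoly R[n.+1]}) = 'X.
Proof.
rewrite muniE msuppX big_seq1 mcoeffX eqxx scale1r mnm1E eqxx expr1.
rewrite (_ : [multinom _ | _ < _] = 0%MM) ?mpolyX0 ?scale1r //.
by apply/mnmP => j; rewrite mnmE mnm1E mnm0E -val_eqE /= gtn_eqF.
Qed.

Definition unmuni (p : {poly {mpoly R[n]}}) : {mpoly R[n.+1]} :=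
  (map_poly (@mwiden n R) p).['X_ord_max].

Fact unmuni_is_zmod : zmod_morphism unmuni.
Proof. by move=> p q; rewrite /unmuni rmorphB /= hornerD hornerN. Qed.

Fact unmuni_is_monoid : monoid_morphism unmuni.
Proof.
by split=> [|p q]; rewrite /unmuni ?rmorph1 ?hornerC // rmorphM hornerM.
Qed.

HB.instance Definition _ :=
  GRing.isZmodMorphism.Build {poly {mpoly R[n]}} {mpoly R[n.+1]} unmuni unmuni_is_zmod.
HB.instance Definition _ :=
  GRing.isMonoidMorphism.Build {poly {mpoly R[n]}} {mpoly R[n.+1]} unmuni unmuni_is_monoid.

Lemma ord_max_or_widen (i : 'I_n.+1) : i = ord_max \/ exists j, i = widen j.
Proof.
case: (unliftP ord_max i) => [j ->|->]; [right; exists j|by left].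
by apply/val_inj; rewrite /= /bump leqNgt ltn_ord.
Qed.

Lemma mwidenXU (i : 'I_n) : mwiden ('X_i : {mpoly R[n]}) = 'X_(widen i).
Proof. by rewrite mwidenX mnmwiden1. Qed.

Lemma muniK : cancel (@muni n R) unmuni.
Proof.
pose F : {rmorphism {mpoly R[n.+1]} -> {mpoly R[n.+1]}} := unmuni \o @muni n R.
pose G : {rmorphism {mpoly R[n.+1]} -> {mpoly R[n.+1]}} := idfun.
apply: (@mpoly_rmorph_ext _ _ _ F G) => [c|i]; rewrite /F /G /= /unmuni.
  by rewrite muniC map_polyC hornerC /= mwidenC.
case: (ord_max_or_widen i) => [->|[j ->]].
  by rewrite muniX_max map_polyX hornerX.
by rewrite muniX_widen map_polyC hornerC /= mwidenXU.
Qed.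

Lemma unmuniK : cancel unmuni (@muni n R).
Proof.
have mw : forall c, muni (mwiden c) = (c : {mpoly R[n]})%:P.
  pose F : {rmorphism {mpoly R[n]} -> {poly {mpoly R[n]}}} := @muni n R \o @mwiden n R.
  pose G : {rmorphism {mpoly R[n]} -> {poly {mpoly R[n]}}} := @polyC _.
  apply: (@mpoly_rmorph_ext _ _ _ F G) => [c|i]; rewrite /F /G /=.
    by rewrite mwidenC muniC.
  by rewrite mwidenXU muniX_widen.
elim/poly_ind => [|p c IH]; first by rewrite !rmorph0.
rewrite rmorphD rmorphM /= muniD muniM IH /unmuni map_polyX hornerX muniX_max.
by rewrite map_polyC hornerC /= mw.
Qed.

Lemma mmap_muni (S : comNzRingType) (f : {rmorphism R -> S}) (h : 'I_n.+1 -> S) g :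
  mmap f h g = (map_poly (mmap f (h \o widen)) (muni g)).[h ord_max].
Proof.
pose F : {rmorphism {mpoly R[n.+1]} -> S} := mmap f h.
pose G : {rmorphism {mpoly R[n.+1]} -> S} :=
  horner_eval (h ord_max) \o map_poly (mmap f (h \o widen)) \o @muni n R.
apply: (@mpoly_rmorph_ext _ _ _ F G) => [c|i]; rewrite /F /G /= /horner_eval.
  by rewrite muniC map_polyC hornerC /= !mmapC.
case: (ord_max_or_widen i) => [->|[j ->]].
  by rewrite muniX_max map_polyX hornerX mmapXU.
by rewrite muniX_widen map_polyC hornerC /= !mmapXU.
Qed.

End Muni.

Lemma size_muni (R : idomainType) n (g : {mpoly R[n.+1]}) :
  (size (muni g) <= msize g)%N.
Proof.
rewrite muniE big_seq; elim/big_ind: _ => [|p q sp sq|m mg].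
- by rewrite size_poly0.
- by apply: leq_trans (size_polyD _ _) _; rewrite geq_max sp.
apply: leq_trans (size_scale_leq _ _) _; rewrite size_polyXn.
apply: leq_trans (msize_mdeg_lt mg); rewrite ltnS mdegE.
by rewrite (bigD1 ord_max) //= leq_addr.
Qed.

Lemma muni_eq0 (R : comNzRingType) n (g : {mpoly R[n.+1]}) : (muni g == 0) = (g == 0).
Proof. by rewrite -(inj_eq (can_inj (@muniK R n))) muni0. Qed.

(** Induction on the number of variables: a point where the leading coefficient in the last variable
    survives, then one of [size q] integers avoiding the roots of [q]. *)
Lemma mpoly_nonroot (F : numFieldType) n (g : {mpoly F[n]}) :
  g != 0 -> exists a : 'I_n -> F, g.@[a] != 0.
Proof.
elim: n g => [|n IH] g g0.
  exists (fun=> 0); apply: contra g0 => /eqP ga; rewrite [g]nvar0_mpolyC in ga *.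
  by rewrite mevalC in ga; rewrite ga mpolyC0.
have: lead_coef (muni g) != 0 by rewrite lead_coef_eq0 muni_eq0.
case/IH => a lc_a.
pose q := map_poly (mmap idfun a) (muni g).
have q0 : q != 0.
  apply: contra lc_a => /eqP/(congr1 (fun p : {poly F} => p`_(size (muni g)).-1)).
  by rewrite coef_map coef0 /= => /eqP.
have [t qt] : exists t, ~~ root q t.
  pose ts := [seq k%:R | k <- iota 0 (size q)] : seq F.
  have /allPn[t _ qt] : ~~ all (root q) ts.
    apply: contraL (leqnn (size q)) => all_ts; rewrite -ltnNge.
    have := max_poly_roots q0 all_ts; rewrite size_map size_iota; apply.
    by rewrite map_inj_uniq ?iota_uniq //; apply: (can_inj (@natrK _)) || move=> i j /eqP; rewrite eqr_nat => /eqP.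
  by exists t.
exists (fun i => if unlift ord_max i is Some j then a j else t).
rewrite /meval mmap_muni unlift_none; apply: contra qt; rewrite rootE => /eqP gt.
apply/eqP; apply: etrans gt; congr horner; apply: eq_map_poly => c /=.
rewrite /mmap; apply: eq_bigr => m _; congr (_ * _); apply: mmap1_eq => i /=.
have -> : widen_ord (leqnSn n) i = lift ord_max i.
  by apply/val_inj; rewrite /= /bump leqNgt ltn_ord.
by rewrite liftK.
Qed.

(** * Prime factorization *)

Definition divides (R : comNzRingType) (p a : R) := exists c, a = c * p.

Definition prime_elt (R : idomainType) (p : R) :=
  [/\ p != 0, p \isn't a GRing.unit &
      forall a b, divides p (a * b) -> divides p a \/ divides p b].

(** Unique factorization in existential form: with prime rather than irreducible factors, uniqueness
    is automatic. It is what makes the algebraic relations between [m + 1] functions a principal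
    ideal. *)
Definition factorial (R : idomainType) :=
  forall a : R, a != 0 -> exists u (ps : seq R),
    [/\ u \is a GRing.unit, forall p, p \in ps -> prime_elt p & a = u * \prod_(p <- ps) p].

Lemma prime_divides_prod (R : idomainType) (p u : R) (ps : seq R) :
  prime_elt p -> u \is a GRing.unit -> divides p (u * \prod_(q <- ps) q) ->
  exists2 q, q \in ps & divides p q.
Proof.
case=> p0 pu p_mul uu; elim: ps => [|q ps IH] in u uu *.
  rewrite big_nil mulr1 => -[c uE]; move: uu; rewrite uE unitrM (negPf pu) andbF.
  by [].
rewrite big_cons mulrCA => /p_mul[pq|/IH[//|r rps pr]].
  by exists q => //; rewrite inE eqxx.
by exists r => //; rewrite inE rps orbT.
Qed.

(** * Gauss's lemma *)

Section Gauss.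

Variable R : idomainType.
Implicit Types (c p : R) (f g q : {poly R}).

Lemma divides_polyC_lead p f : divides p%:P f -> divides p (lead_coef f).
Proof. by case=> g ->; exists (lead_coef g); rewrite lead_coefM lead_coefC. Qed.

(** Induction on the total size: [p] divides the leading coefficient of one factor, whose leading
    term can be removed without affecting divisibility of the product. *)
Lemma prime_polyC p : prime_elt p -> prime_elt p%:P.
Proof.
case=> p0 pu p_mul; split; first by rewrite polyC_eq0.
  by rewrite poly_unitE coefC eqxx (negPf pu) andbF.
move=> f q; move: {2}(size f + size q)%N (leqnn (size f + size q)) => N.
elim: N f q => [|N IH] f q.
  rewrite leqn0 addn_eq0 size_poly_eq0 => /andP[/eqP-> _] _; left.
  by exists 0; rewrite mul0r.
have [->|f0] := eqVneq f 0; first by left; exists 0; rewrite mul0r.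
have [->|q0] := eqVneq q 0; first by right; exists 0; rewrite mul0r.
move=> sz pfq; have := divides_polyC_lead pfq; rewrite lead_coefM.
wlog [c lcf] : f q f0 q0 sz pfq / divides p (lead_coef f).
  move=> IHw /[dup] h /p_mul[pf|pq]; first exact: (IHw f q).
  by rewrite addnC in sz; rewrite mulrC in pfq; rewrite mulrC in h; case: (IHw q f q0 f0 sz pfq pq h); [right|left].
move=> _; pose t := c *: 'X^((size f).-1) * p%:P; pose f1 := f - t.
have tE : t = lead_coef f *: 'X^((size f).-1).
  by rewrite /t lcf mulrC mul_polyC scalerA mulrC.
have sz1 : (size f1 + size q <= N)%N.
  rewrite -ltnS; apply: leq_trans sz; rewrite ltn_add2r.
  have le1 : (size f1 <= size f)%N.
    apply: leq_trans (size_polyD _ _) _; rewrite size_polyN geq_max leqnn tE.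
    by apply: leq_trans (size_scale_leq _ _) _; rewrite size_polyXn prednK // size_poly_gt0.
  rewrite ltn_neqAle le1 andbT; apply/eqP => eq1.
  have : lead_coef f1 = 0.
    by rewrite lead_coefE eq1 coefB tE coefZ coefXn eqxx mulr1 -lead_coefE subrr.
  move/eqP; rewrite lead_coef_eq0 -size_poly_eq0 eq1 size_poly_eq0.
  by rewrite (negPf f0).
have : divides p%:P (f1 * q).
  case: pfq => g gE; exists (g - c *: 'X^((size f).-1) * q).
  by rewrite /f1 mulrBl gE mulrBl /t; congr (_ - _); rewrite mulrAC.
case/(IH _ _ sz1) => [[g gE]|]; last by right.
left; exists (g + c *: 'X^((size f).-1)).
by rewrite mulrDl -gE /f1 subrK.
Qed.

Hypothesis fR : factorial R.

Definition primitive f := forall p, prime_elt p -> ~ divides p%:P f.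

(** The primes of [c] are stripped one at a time: each divides [f * q], hence [q], because [f] is
    primitive. *)
Lemma primitive_cancel c f q g : primitive f -> c != 0 -> c *: g = f * q ->
  exists q', g = f * q'.
Proof.
move=> prim_f /fR[u [ps [uu]]].
elim: ps => [|p ps IH] in c q u uu * => ps_prime ->.
  rewrite big_nil mulr1 => gE; exists (u^-1 *: q).
  by rewrite -scalerAr -gE scalerA mulVr // scale1r.
have pp : prime_elt p by apply: ps_prime; rewrite inE eqxx.
rewrite big_cons mulrCA => gE.
have : divides p%:P (f * q).
  exists ((u * \prod_(j <- ps) j) *: g).
  by rewrite -gE [RHS]mulrC mul_polyC scalerA.
case: (prime_polyC pp) => pP0 _ pP_mul /pP_mul[/(prim_f _ pp)//|[q1 qE]].
apply: (IH _ q1 u uu _ erefl) => [r rps|].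
  by apply: ps_prime; rewrite inE rps orbT.
apply: (mulIf pP0); rewrite mulrC mul_polyC scalerA gE qE.
by rewrite mulrA.
Qed.

(** Descends a factorization over the field of fractions to [R]: each prime of [c] divides one of
    the two factors and is cancelled there, which keeps the degrees. *)
Lemma split_const c f q g : c != 0 -> q != 0 -> g != 0 -> c *: f = q * g ->
  exists q' g', [/\ f = q' * g', size q' = size q & size g' = size g].
Proof.
move=> /fR[u [ps [uu]]].
elim: ps => [|p ps IH] in c q g u uu * => ps_prime -> q0 g0.
  rewrite big_nil mulr1 => fE; exists (u^-1 *: q), g.
  have u0 : u^-1 != 0 by apply: contraTneq uu => u0; rewrite -unitrV u0 unitr0.
  by rewrite -scalerAl -fE scalerA mulVr // scale1r size_scale.
have pp : prime_elt p by apply: ps_prime; rewrite inE eqxx.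
have p0 : p != 0 by case: pp.
rewrite big_cons mulrCA => fE.
have pdiv : divides p%:P (q * g).
  exists ((u * \prod_(j <- ps) j) *: f).
  by rewrite -fE [RHS]mulrC mul_polyC scalerA.
have ps_prime' : forall r, r \in ps -> prime_elt r.
  by move=> r rps; apply: ps_prime; rewrite inE rps orbT.
case: (prime_polyC pp) => pP0 _ pP_mul.
have sizeP (r : {poly R}) : size (r * p%:P) = size r.
  by rewrite mulrC mul_polyC size_scale.
case/pP_mul: pdiv => [[q1 qE]|[g1 gE]].
  have q10 : q1 != 0 by apply: contraNneq q0 => q10; rewrite qE q10 mul0r.
  have [|q' [g' [fE' sq sg]]] := IH _ q1 g u uu ps_prime' erefl q10 g0.
    apply: (mulIf pP0); rewrite mulrC mul_polyC scalerA fE qE.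
    by rewrite mulrAC.
  by exists q', g'; rewrite qE sizeP sq sg.
have g10 : g1 != 0 by apply: contraNneq g0 => g10; rewrite gE g10 mul0r.
have [|q' [g' [fE' sq sg]]] := IH _ q g1 u uu ps_prime' erefl q0 g10.
  apply: (mulIf pP0); rewrite mulrC mul_polyC scalerA fE gE.
  by rewrite mulrA.
by exists q', g'; rewrite gE sizeP sq sg.
Qed.

(** Induction on the number of prime factors of the leading coefficient: every constant prime
    dividing [f] takes one of them away. *)
Lemma content_exists f : f != 0 -> exists c f', [/\ c != 0, f = c *: f' & primitive f'].
Proof.
move=> f0; have /fR[u [ps [uu]]] : lead_coef f != 0 by rewrite lead_coef_eq0.
move: {2}(size ps) (erefl (size ps)) => N.
elim: N => [|N IH] in ps u uu f f0 * => sz ps_prime lcE.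
  exists 1, f; split; rewrite ?oner_eq0 ?scale1r // => p pp /divides_polyC_lead.
  by rewrite lcE => /(prime_divides_prod pp uu)[q]; rewrite (size0nil sz).
have [prim|/existsNP[p /not_implyP[pp /contrapT pf]]] := pselect (primitive f).
  by exists 1, f; split; rewrite ?oner_eq0 ?scale1r.
have p0 : p != 0 by case: pp.
case: (pf) => f1 fE; have f10 : f1 != 0 by apply: contraNneq f0 => f10; rewrite fE f10 mul0r.
have := divides_polyC_lead pf; rewrite lcE => /(prime_divides_prod pp uu)[r rps [v rE]].
have [r0 ru r_mul] := ps_prime _ rps.
(* [r] and [p] are associated, so dividing by [p] removes exactly [r] from the factorization. *)
have uv : v \is a GRing.unit.
  have : divides r (v * p) by exists 1; rewrite mul1r.
  case/r_mul=> [[w wE]|[w wE]].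
    case: pp => _ /negP[]; apply/unitrPr; exists w; apply: (mulIf r0).
    by rewrite mul1r {2}rE wE [RHS]mulrC mulrA.
  apply/unitrPr; exists w; apply: (mulIf p0).
  by rewrite mul1r {2}wE rE mulrA [v * w]mulrC.
have perm_ps := perm_to_rem rps.
have uuv : u * v \is a GRing.unit by rewrite unitrM uu.
have szr : size (rem r ps) = N by rewrite size_rem // sz.
have rem_prime (q : R) : q \in rem r ps -> prime_elt q by move/mem_rem; apply: ps_prime.
have lc1 : lead_coef f1 = u * v * \prod_(q <- rem r ps) q.
  apply: (mulIf p0); have <- : lead_coef f = lead_coef f1 * p by rewrite fE lead_coefM lead_coefC.
  rewrite lcE (perm_big _ perm_ps) big_cons /=; set Q := \prod_(q <- _) q.
  by rewrite {1}rE -!mulrA [Q * _]mulrC.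
have [c [f' [c0 f1E prim]]] := IH _ _ uuv _ f10 szr rem_prime lc1.
exists (p * c), f'; split; rewrite ?mulf_neq0 //.
by rewrite fE f1E mulrC mul_polyC scalerA.
Qed.

End Gauss.

Section GaussTheorem.

Variable R : idomainType.

Lemma factorial_mul (u : R) a b :
  (exists v (ps : seq R), [/\ v \is a GRing.unit, forall p, p \in ps -> prime_elt p &
     a = v * \prod_(p <- ps) p]) ->
  (exists v (ps : seq R), [/\ v \is a GRing.unit, forall p, p \in ps -> prime_elt p &
     b = v * \prod_(p <- ps) p]) ->
  exists v (ps : seq R), [/\ v \is a GRing.unit, forall p, p \in ps -> prime_elt p &
     a * b = v * \prod_(p <- ps) p].
Proof.
move=> [v [ps [uv pps ->]]] [w [qs [uw pqs ->]]]; exists (v * w), (ps ++ qs); split.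
- by rewrite unitrM uv.
- by move=> p; rewrite mem_cat => /orP[/pps|/pqs].
- by rewrite big_cat /= mulrACA.
Qed.

End GaussTheorem.

(** Euclid's argument over the field of fractions with denominators cleared. The gcd of [f] and [a]
    is either constant, and Bezout's identity makes [f] divide a multiple of [b], or of the degree
    of [f], and [f] divides a multiple of [a]; [primitive_cancel] removes the multipliers. *)
Lemma irreducible_prime (R : idomainType) (f : {poly R}) :
  factorial R -> primitive f -> (1 < size f)%N ->
  (forall g h, f = g * h -> (size g < size f)%N -> (size h < size f)%N -> False) ->
  prime_elt f.
Proof.
move=> fR prim sf irr; have f0 : f != 0 by rewrite -size_poly_gt0 ltnW.
split=> //; first by rewrite poly_unitE gtn_eqF.
move=> a b [c abE]; pose g := gcdp f a.
have g0 : g != 0 by rewrite gcdp_eq0 negb_and f0.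
have /Pdiv.Idomain.dvdpP[[d0 q] /= d00 fE] : g %| f by apply: dvdp_gcdl.
have /Pdiv.Idomain.dvdpP[[d1 r] /= d10 aE] : g %| a by apply: dvdp_gcdr.
have q0 : q != 0.
  apply: contraNneq f0 => q0; move/eqP: fE.
  by rewrite q0 mul0r -mul_polyC mulf_eq0 polyC_eq0 (negPf d00).
have := congr1 (fun p : {poly R} => size p) fE.
rewrite size_scale // size_mul // => sfE.
have [sg|sg] := leqP (size g) 1; last first.
  have [sq|sq] := leqP (size q) 1; last first.
    have [q' [g' [fE' sq' sg']]] := split_const fR d00 q0 g0 fE.
    have sq0 : (0 < size q)%N by rewrite size_poly_gt0.
    have sg0 : (0 < size g)%N by rewrite size_poly_gt0.
    exfalso; apply: (irr _ _ fE'); rewrite ?sq' ?sg' sfE.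
      by case: (size g) sg => [//|[//|k]] _; rewrite addnS addnS /= ltnS leq_addr.
    by case: (size q) sq => [//|[//|k]] _; rewrite addSn addSn /= ltnS leq_addl.
  have [q1 qE] : exists q1, q = q1%:P by exists (q`_0); apply: size1_polyC.
  left; have [||a' ->] := @primitive_cancel _ fR (q1 * d1) f (d0 *: r) a prim.
  - by rewrite mulf_neq0 //; apply: contraNneq q0 => q10; rewrite qE q10.
  - by rewrite -scalerA aE -[LHS]mul_polyC mulrCA -qE -fE -!scalerAr mulrC.
  by exists a'; rewrite mulrC.
have sg1 : size g = 1 by apply/eqP; rewrite eqn_leq sg size_poly_gt0.
have [[u v] /= /Pdiv.Idomain.eqpP[[c1 c2] /= /andP[c10 c20] uvE]] := Bezoutp f a.
have [g1 gE] : exists g1, g = g1%:P by exists (g`_0); apply: size1_polyC.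
right; have [||b' ->] := @primitive_cancel _ fR (c2 * g1) f (c1 *: (u * b + v * c)) b prim.
- by rewrite mulf_neq0 //; apply: contraNneq g0 => g10; rewrite gE g10.
- rewrite -scalerA -[g1 *: b]mul_polyC -gE scalerAl -uvE -scalerAl -scalerAr.
  congr (_ *: _); rewrite mulrDl mulrDr -!mulrA abE; congr (_ + _); first exact: mulrCA.
  by rewrite mulrA mulrC.
by exists b'; rewrite mulrC.
Qed.

Theorem factorial_poly (R : idomainType) : factorial R -> factorial {poly R}.
Proof.
move=> fR f; move: {2}(size f) (leqnn (size f)) => N.
elim: N f => [|N IH] f; first by rewrite leqn0 size_poly_eq0 => ->.
move=> sf f0; have [c [f1 [c0 fE prim]]] := content_exists fR f0.
have f10 : f1 != 0 by apply: contraNneq f0 => f10; rewrite fE f10 scaler0.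
have sf1 : size f = size f1 by rewrite fE size_scale.
rewrite fE -mul_polyC; apply: factorial_mul => //.
  have [u [ps [uu pps ->]]] := fR c c0.
  exists u%:P, [seq p%:P | p <- ps]; split.
  - exact: (rmorph_unit (@polyC R)).
  - by move=> _ /mapP[p /pps pp ->]; apply: prime_polyC.
  - by rewrite rmorphM rmorph_prod big_map.
have [sf1_1|sf1_1] := leqP (size f1) 1.
  have f1E : f1 = (f1`_0)%:P by apply: size1_polyC.
  have a0 : f1`_0 != 0 by rewrite -polyC_eq0 -f1E.
  have [u [[|p ps] [uu pps aE]]] := fR _ a0.
    exists f1, [::]; split; rewrite ?big_nil ?mulr1 //.
    by rewrite f1E aE big_nil mulr1; apply: (rmorph_unit (@polyC R)).
  case: (prim p); first by apply: pps; rewrite inE eqxx.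
  exists (u * \prod_(q <- ps) q)%:P.
  by rewrite f1E aE big_cons -rmorphM /= mulrAC mulrA.
have [[g [h [f1E [sg sh]]]]|irr] := pselect (exists g h, f1 = g * h /\
    (size g < size f1)%N /\ (size h < size f1)%N).
  rewrite f1E; apply: factorial_mul => //.
    apply: IH; first by rewrite -ltnS (leq_trans sg) // -sf1.
    by apply: contraNneq f10 => g0; rewrite f1E g0 mul0r.
  apply: IH; first by rewrite -ltnS (leq_trans sh) // -sf1.
  by apply: contraNneq f10 => h0; rewrite f1E h0 mulr0.
exists 1, [:: f1]; split; rewrite ?unitr1 ?big_seq1 ?mul1r // => p.
rewrite inE => /eqP ->; apply: irreducible_prime => // g h f1E sg sh.
by apply: irr; exists g, h.
Qed.

Section Isomorphism.

Variables (R S : idomainType) (f : {rmorphism R -> S}) (g : {rmorphism S -> R}).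
Hypotheses (fK : cancel f g) (gK : cancel g f).

Lemma prime_elt_iso p : prime_elt p -> prime_elt (f p).
Proof.
case=> p0 pu p_mul; split.
- by apply: contraNneq p0 => fp0; rewrite -[p]fK fp0 rmorph0.
- by apply: contra pu => /(rmorph_unit g); rewrite fK.
- move=> b c [d /(congr1 g)]; rewrite !rmorphM fK => bcE.
  have [|[e eE]|[e eE]] := p_mul (g b) (g c); first by exists (g d).
    by left; exists (f e); rewrite -[b]gK eE rmorphM.
  by right; exists (f e); rewrite -[c]gK eE rmorphM.
Qed.

Lemma factorial_iso : factorial R -> factorial S.
Proof.
move=> fR a a0; have ga0 : g a != 0.
  by apply: contraNneq a0 => ga0; rewrite -[a]gK ga0 rmorph0.
have [u [ps [uu pps aE]]] := fR _ ga0.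
exists (f u), [seq f p | p <- ps]; split; first exact: rmorph_unit.
  by move=> _ /mapP[p /pps pp ->]; apply: prime_elt_iso.
by rewrite -[a]gK aE rmorphM rmorph_prod big_map.
Qed.

End Isomorphism.

Lemma factorial_mpoly (F : fieldType) n : factorial {mpoly F[n]}.
Proof.
elim: n => [|n IH].
  move=> a a0; exists a, [::]; split; rewrite ?big_nil ?mulr1 //.
  rewrite [a]nvar0_mpolyC in a0 *; apply: rmorph_unit; rewrite unitfE.
  by apply: contraNneq a0 => ->; rewrite mpolyC0.
exact: (factorial_iso (@unmuniK F n) (@muniK F n) (factorial_poly IH)).
Qed.

Lemma prime_comaximal_or_divides (R : idomainType) (F G : {poly R}) :
  prime_elt F -> (1 < size F)%N -> G != 0 ->
  (exists u v c, c != 0 /\ u * F + v * G = c%:P) \/ divides F G.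
Proof.
move=> [F0 _ F_mul] sF G0; pose h := gcdp F G.
have size_F (c : R) : c != 0 -> ~ divides F c%:P.
  move=> c0 [w wE]; have w0 : w != 0.
    by apply: contraNneq c0 => w0; rewrite -polyC_eq0 wE w0 mul0r.
  have := congr1 (fun p : {poly R} => size p) wE; rewrite size_polyC c0 size_mul //=.
  have sw : (0 < size w)%N by rewrite size_poly_gt0.
  by move: sw sF; move: (size w) (size F) => a b; lia.
have h0 : h != 0 by rewrite gcdp_eq0 negb_and F0.
have [sh|sh] := leqP (size h) 1.
  left; have [[u v] /= /Pdiv.Idomain.eqpP[[c1 c2] /= /andP[c10 c20] uvE]] := Bezoutp F G.
  have hC : h = (h`_0)%:P by apply: size1_polyC.
  exists (c1 *: u), (c1 *: v), (c2 * h`_0); split.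
    by rewrite mulf_neq0 // -polyC_eq0 -hC.
  by rewrite polyCM -hC mul_polyC -uvE scalerDr !scalerAl.
right; have /Pdiv.Idomain.dvdpP[[d0 q] /= d00 FE] : h %| F by apply: dvdp_gcdl.
have /Pdiv.Idomain.dvdpP[[d1 t] /= d10 GE] : h %| G by apply: dvdp_gcdr.
have q0 : q != 0.
  apply: contraNneq F0 => q0; move/eqP: FE.
  by rewrite q0 mul0r -mul_polyC mulf_eq0 polyC_eq0 (negPf d00).
have : divides F (q * h) by exists d0%:P; rewrite -FE mul_polyC.
case/F_mul=> [[w wE]|[w wE]].
  have w0 : w != 0 by apply: contraNneq q0 => w0; rewrite wE w0 mul0r.
  have := congr1 (fun p : {poly R} => size p) FE.
  rewrite wE size_scale // size_mul ?mulf_neq0 // size_mul //.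
  have sw : (0 < size w)%N by rewrite size_poly_gt0.
  by move: sw sF sh; move: (size w) (size F) (size h) => a b e; lia.
have : divides F (d1%:P * G).
  by exists (t * w); rewrite -mulrA -wE -GE mul_polyC.
by case/F_mul=> [/(size_F _ d10)|].
Qed.

(** If [f] did not divide [g], some combination of the two would be a nonzero constant killed by
    [ev]. So any prime in the kernel generates it. *)
Lemma prime_kernel (R : idomainType) (E : fieldType) (ev : {rmorphism {poly R} -> E})
    (f g : {poly R}) :
  (forall c, ev c%:P = 0 -> c = 0) -> prime_elt f -> ev f = 0 -> ev g = 0 -> divides f g.
Proof.
move=> no_const pf fa ga; have f0 : f != 0 by case: pf.
have [->|g0] := eqVneq g 0; first by exists 0; rewrite mul0r.
have sf : (1 < size f)%N.
  rewrite ltnNge; apply/negP => /size1_polyC fC; case/eqP: f0.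
  by rewrite fC (no_const f`_0) ?polyC0 // -fC.
have [[u [v [c [c0 uvE]]]]|//] := prime_comaximal_or_divides pf sf g0.
case/eqP: c0; apply: no_const.
by rewrite -uvE rmorphD !rmorphM fa ga !mulr0 addr0.
Qed.

(** * Fraction fields *)

Notation "x %:F" := (FracField.tofrac x).

Lemma fraction_numden (R : idomainType) (k : {fraction R}) :
  exists n d : R, d != 0 /\ k = n%:F / d%:F.
Proof.
elim/quotW: k => x; exists \n_x, \d_x; have d0 := denom_ratioP x.
split=> //; have dF0 : (\d_x)%:F != 0 by rewrite tofrac_eq0.
apply: (mulIf dF0); rewrite mulfVK //; unlock FracField.tofrac.
rewrite -[LHS]FracField.pi_mul; apply/eqmodP; rewrite /= FracField.equivfE.
by rewrite /FracField.mulf !numden_Ratio ?oner_neq0 ?mulr1 // mulrC.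
Qed.

Section LiftFraction.

Variables (R : idomainType) (E : fieldType) (f : {rmorphism R -> E}).
Hypothesis f_inj : forall a, f a = 0 -> a = 0.

Let num k := sval (cid (fraction_numden (R := R) k)).
Let den k := sval (cid (svalP (cid (fraction_numden (R := R) k)))).
Let numdenP k : den k != 0 /\ k = (num k)%:F / (den k)%:F.
Proof. exact: (svalP (cid (svalP (cid (fraction_numden k))))). Qed.

Let lift (k : {fraction R}) : E := f (num k) / f (den k).

Let f_neq0 a : a != 0 -> f a != 0.
Proof. by apply: contraNneq => /f_inj ->. Qed.

Let liftE n d : d != 0 -> lift (n%:F / d%:F) = f n / f d.
Proof.
move=> d0; have [d'0] := numdenP (n%:F / d%:F).
rewrite /lift; move: (num _) (den _) d'0 => n' d' d'0 /eqP.
rewrite eqr_div ?tofrac_eq0 // -!rmorphM tofrac_eq => /eqP ndE.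
by apply/eqP; rewrite eqr_div ?f_neq0 // -!rmorphM ndE.
Qed.

Let lift_is_zmod : zmod_morphism lift.
Proof.
move=> x y; have [nx [dx [dx0 ->]]] := fraction_numden x; have [ny [dy [dy0 ->]]] := fraction_numden y.
rewrite -mulNr -rmorphN addf_div ?tofrac_eq0 // -!rmorphM -rmorphD.
rewrite !liftE ?mulf_neq0 //; rewrite -mulNr -rmorphN addf_div ?f_neq0 //.
by rewrite !(rmorphD, rmorphM).
Qed.

Let lift_is_monoid : monoid_morphism lift.
Proof.
split=> [|x y].
  have := @liftE 1 1 (oner_neq0 _); by rewrite !rmorph1 divr1 divff ?oner_neq0.
have [nx [dx [dx0 ->]]] := fraction_numden x; have [ny [dy [dy0 ->]]] := fraction_numden y.
rewrite mulf_div -!rmorphM !liftE ?mulf_neq0 // mulf_div.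
by rewrite !rmorphM.
Qed.

HB.instance Definition _ :=
  GRing.isZmodMorphism.Build {fraction R} E lift lift_is_zmod.
HB.instance Definition _ :=
  GRing.isMonoidMorphism.Build {fraction R} E lift lift_is_monoid.

Lemma fraction_lift : exists phi : {rmorphism {fraction R} -> E}, forall a, phi a%:F = f a.
Proof.
by exists lift => a; have := liftE a (oner_neq0 R); rewrite tofrac1 rmorph1 !divr1.
Qed.

End LiftFraction.

(** The two proofs are carried as arguments so that an arbitrary predicate can receive the structure
    of a prime ideal. *)
Definition ideal_pred (R : nzRingType) (I : {pred R}) (cI : idealr_closed I)
  (pI : prime_idealr_closed I) : R -> bool := fun x => x \in I.

HB.instance Definition _ R I cI pI := isIdealr.Build R (@ideal_pred R I cI pI) cI.
HB.instance Definition _ R I cI pI := isPrimeIdealrClosed.Build R (@ideal_pred R I cI pI) pI.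

(* Units of the quotient are chosen classically, only to obtain an
   [idomainType] whose field of fractions can be formed. *)
Section PrimeQuotient.

Variables (R : comNzRingType) (I : {pred R}).
Hypotheses (cI : idealr_closed I) (pI : prime_idealr_closed I).

Let J : prime_idealr R := ideal_pred cI pI.
Let Q := {ideal_quot J}.

Let Qunit : pred Q := fun x => `[< exists y, y * x = 1 >].
Let Qinv (x : Q) : Q :=
  if pselect (exists y, y * x = 1) is left ex then sval (cid ex) else x.

Let QmulVx : {in Qunit, left_inverse 1 Qinv *%R}.
Proof.
by move=> x /asboolP xu; rewrite /Qinv; case: pselect => // ex; case: cid.
Qed.

Let Qunit_intro (x y : Q) : y * x = 1 -> Qunit x.
Proof. by move=> yx; apply/asboolP; exists y. Qed.

Let Qinv_out : {in [predC Qunit], Qinv =1 id}.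
Proof.
move=> x /= xNu; rewrite /Qinv; case: pselect => // ex.
by case/negP: xNu; apply/asboolP.
Qed.

HB.instance Definition _ := GRing.ComNzRing.on Q.
HB.instance Definition _ :=
  GRing.ComNzRing_hasMulInverse.Build Q QmulVx Qunit_intro Qinv_out.
HB.instance Definition _ :=
  GRing.ComUnitRing_isIntegral.Build Q (@Quotient.rquot_IdomainAxiom _ J).

(** [E] is the field of fractions of the quotient. For the ideal of a variety, the images of the
    variables form a generic point, at which a polynomial vanishes exactly when it lies in the
    ideal. *)
Lemma prime_ideal_field : exists (E : fieldType) (f : {rmorphism R -> E}),
  forall g, (f g == 0) = (g \in I).
Proof.
pose f1 : {rmorphism R -> Q} := (\pi_Q)%qT.
pose f2 : {rmorphism Q -> {fraction Q}} := @FracField.tofrac Q.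
exists {fraction Q}, (f2 \o f1 : {rmorphism R -> {fraction Q}}) => g.
rewrite /= tofrac_eq0 -(rmorph0 f1) /f1 -Quotient.idealrBE subr0.
by [].
Qed.

End PrimeQuotient.

(** * Noether normalization *)

Lemma mnm_ind n (P : 'X_{1..n} -> Prop) :
  P 0%MM -> (forall i m, P m -> P (U_(i) + m)%MM) -> forall m, P m.
Proof.
move=> P0 PU m; move: {2}(mdeg m) (erefl (mdeg m)) => D.
elim: D m => [|D IH] m => [/eqP|Dm]; first by rewrite mdeg_eq0 => /eqP ->.
have [i mi] : exists i, m i != 0%N.
  apply/existsP; apply: contra_eqT Dm => /existsPn m0.
  by rewrite mdegE big1 // => i _; apply/eqP/negPn/m0.
rewrite -lep1mP in mi; rewrite -(submK mi) addmC; apply: PU; apply: IH.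
by have := congr1 (@mdeg n) (submK mi); rewrite mdegD mdeg1 Dm addn1 => -[].
Qed.

Lemma mmap_eq (R S : nzRingType) n (f : R -> S) (h1 h2 : 'I_n -> S) g :
  h1 =1 h2 -> mmap f h1 g = mmap f h2 g.
Proof. by move=> eq_h; apply: eq_bigr => m _; rewrite (mmap1_eq _ eq_h). Qed.

Section Evaluation.

Variables (E : fieldType) (iota : {rmorphism rat -> E}).

Notation ev y g := (mmap iota y g).

Definition alg_indep k (y : 'I_k -> E) :=
  forall g : {mpoly rat[k]}, ev y g = 0 -> g = 0.

(** The degree filtration of the algebra generated by [x]; it carries the Hilbert function. *)
Definition poly_values n (x : 'I_n -> E) D v :=
  exists2 g : {mpoly rat[n]}, (msize g <= D.+1)%N & v = ev x g.

Definition lin_comb n (x : 'I_n -> E) v :=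
  exists l : 'I_n -> rat, v = \sum_j iota (l j) * x j.

Lemma lin_comb_trans n k (x : 'I_n -> E) (y : 'I_k -> E) v :
  (forall i, lin_comb x (y i)) -> lin_comb y v -> lin_comb x v.
Proof.
move=> /choice[L yE] [l ->]; exists (fun j => \sum_i l i * L i j).
under eq_bigr => i _ do rewrite yE mulr_sumr.
rewrite exchange_big /=; apply: eq_bigr => j _.
by rewrite rmorph_sum mulr_suml; apply: eq_bigr => i _; rewrite rmorphM mulrA.
Qed.

Lemma lin_comb_var n (x : 'I_n -> E) i : lin_comb x (x i).
Proof.
exists (fun j => (j == i)%:R); rewrite (bigD1 i) //= eqxx rmorph1 mul1r.
by rewrite big1 ?addr0 // => j /negPf ->; rewrite rmorph0 mul0r.
Qed.

Lemma lin_combD n (x : 'I_n -> E) a b u v :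
  lin_comb x u -> lin_comb x v -> lin_comb x (iota a * u + iota b * v).
Proof.
move=> [l ->] [k ->]; exists (fun j => a * l j + b * k j).
by rewrite !mulr_sumr -big_split; apply: eq_bigr => j _; rewrite !rmorphD !rmorphM mulrDl !mulrA.
Qed.

Section Values.

Variables (n : nat) (x : 'I_n -> E).
Notation A := (poly_values x).

Lemma values_lin D a b u v : A D u -> A D v -> A D (iota a * u + iota b * v).
Proof.
move=> [g gD ->] [h hD ->]; exists (a *: g + b *: h); last by rewrite mmapD !mmapZ.
apply: leq_trans (msizeD_le _ _) _.
by rewrite geq_max !(leq_trans (msizeZ_le _ _)).
Qed.

Lemma valuesM D1 D2 u v : A D1 u -> A D2 v -> A (D1 + D2) (u * v).
Proof.
by move=> [g gD ->] [h hD ->]; exists (g * h); [exact: msizeM_leq|rewrite rmorphM].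
Qed.

Lemma values_le D1 D2 u : (D1 <= D2)%N -> A D1 u -> A D2 u.
Proof. by move=> le12 [g gD ->]; exists g => //; apply: leq_trans gD _. Qed.

Lemma values_const D c : A D (iota c).
Proof. by exists c%:MP; rewrite ?mmapC // msizeC; case: (c != 0). Qed.

Lemma values_linear D v : lin_comb x v -> A D.+1 v.
Proof.
move=> [l ->]; exists (\sum_j l j *: 'X_j).
  by apply: msize_sum_leq => j _; rewrite (leq_trans (msizeZ_le _ _)) // msizeX mdeg1.
by rewrite raddf_sum /=; apply: eq_bigr => j _; rewrite mmapZ mmapXU.
Qed.

End Values.

Lemma values_trans n k (x : 'I_n -> E) (y : 'I_k -> E) D v :
  (forall i, lin_comb x (y i)) -> poly_values y D v -> poly_values x D v.
Proof.
move=> /choice[L yE] [g gD ->].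
exists (g \mPo [tuple \sum_j L i j *: 'X_j | i < k]).
  apply: (leq_trans _ gD); apply: msize_comp_linear => i; rewrite tnth_mktuple.
  by apply: msize_sum_leq => j _; rewrite (leq_trans (msizeZ_le _ _)) // msizeX mdeg1.
rewrite mmap_comp; apply: mmap_eq => i.
rewrite tnth_mktuple yE raddf_sum /=; apply: eq_bigr => j _.
by rewrite mmapZ mmapXU.
Qed.

(** * Reduction by a relation monic in one variable *)

Section MonicReduction.

Variables (n : nat) (xt : 'I_n -> E) (z : E).
Notation A := (poly_values xt).

(** The condition [l <= D] is explicit because [D - l] is truncated: otherwise powers of [z] beyond
    the degree bound could slip in. *)
Definition term_ok D l v := (l <= D)%N /\ A (D - l) v \/ v = 0.

Definition Zs b D v :=
  exists2 q : nat -> E, (forall l, (l < b)%N -> term_ok D l (q l)) &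
    v = \sum_(l < b) z ^+ l * q l.

Lemma term_ok_lin D l a b u v : term_ok D l u -> term_ok D l v ->
  term_ok D l (iota a * u + iota b * v).
Proof.
have A0 e : A e 0 by rewrite -(rmorph0 iota); apply: values_const.
move=> [[lD Au]|->] [[lD' Av]|->]; rewrite ?mulr0.
- by left; split=> //; apply: values_lin.
- by left; split=> //; rewrite -[0](mulr0 (iota 0)); apply: values_lin.
- by left; split=> //; rewrite -[X in X + _](mulr0 (iota 0)); apply: values_lin.
- by right; rewrite addr0.
Qed.

Lemma term_okM D l e u v : A e u -> term_ok D l v -> term_ok (D + e) l (u * v).
Proof.
move=> Au [[lD Av]|->]; last by right; rewrite mulr0.
left; split; first exact: leq_trans (leq_addr _ _).
by rewrite addnC -addnBA //; apply: valuesM.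
Qed.

Lemma Zs_lin b D c d u v : Zs b D u -> Zs b D v -> Zs b D (iota c * u + iota d * v).
Proof.
move=> [p pP ->] [q qP ->]; exists (fun l => iota c * p l + iota d * q l).
  by move=> l lb; apply: term_ok_lin; [exact: pP|exact: qP].
rewrite !mulr_sumr -big_split; apply: eq_bigr => l _.
by rewrite mulrDr mulrCA [z ^+ l * (iota d * _)]mulrCA.
Qed.

Lemma ZsD b D u v : Zs b D u -> Zs b D v -> Zs b D (u + v).
Proof. by move=> Zu Zv; have := Zs_lin 1 1 Zu Zv; rewrite rmorph1 !mul1r. Qed.

Lemma Zs0 b D : Zs b D 0.
Proof.
by exists (fun=> 0) => [l _|]; [right|rewrite big1 // => l _; rewrite mulr0].
Qed.

Lemma ZsZ b D c u : Zs b D u -> Zs b D (iota c * u).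
Proof. by move=> Zu; rewrite -[_ * _]addr0 -[0](mulr0 (iota 0)); apply: Zs_lin Zu (Zs0 _ _). Qed.

Lemma Zs_sum b D (I : Type) (r : seq I) (P : pred I) (F : I -> E) :
  (forall i, P i -> Zs b D (F i)) -> Zs b D (\sum_(i <- r | P i) F i).
Proof.
by move=> FP; apply: (big_ind (Zs b D)); [exact: Zs0|exact: ZsD|exact: FP].
Qed.

Lemma Zs_le b b' D u : (b <= b')%N -> Zs b D u -> Zs b' D u.
Proof.
move=> le_b [q qP ->]; exists (fun l => if (l < b)%N then q l else 0).
  by move=> l _; case: ifP => [/qP//|_]; right.
rewrite (big_ord_widen _ (fun l => z ^+ l * q l) le_b) big_mkcond /=.
by apply: eq_bigr => l _; case: ifP; rewrite ?mulr0.
Qed.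

Lemma ZsM b D e u v : A e u -> Zs b D v -> Zs b (D + e) (u * v).
Proof.
move=> Au [q qP ->]; exists (fun l => u * q l).
  by move=> l lb; apply: term_okM => //; apply: qP.
by rewrite mulr_sumr; apply: eq_bigr => l _; rewrite mulrCA.
Qed.

Lemma ZsM1 b D u v : A 1 u -> Zs b D v -> Zs b D.+1 (u * v).
Proof. by rewrite -[D.+1]addn1; apply: ZsM. Qed.

Lemma Zs_leD b D D' u : (D <= D')%N -> Zs b D u -> Zs b D' u.
Proof.
move=> /subnKC <- Zu; rewrite -[u]mul1r -(rmorph1 iota).
by apply: ZsM => //; apply: values_const.
Qed.

Lemma Zs_shift b D v : Zs b D v -> Zs b.+1 D.+1 (z * v).
Proof.
move=> [q qP ->]; exists (fun l => if l is l'.+1 then q l' else 0).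
  case=> [_|l /qP [[lD Aq]|->]]; [by right| |by right].
  by left; rewrite subSS.
rewrite big_ord_recl /= mulr0 add0r mulr_sumr; apply: eq_bigr => l _.
by rewrite exprS mulrA.
Qed.

Lemma Zs_exp b D l c : (l < b)%N -> (l <= D)%N -> Zs b D (iota c * z ^+ l).
Proof.
move=> lb lD; exists (fun i => if i == l then iota c else 0).
  move=> i _; case: eqP => [->|_]; [left|by right].
  by split=> //; apply: values_const.
rewrite (bigD1 (Ordinal lb)) //= eqxx mulrC big1 ?addr0 // => i.
by rewrite -val_eqE /= => /negPf ->; rewrite mulr0.
Qed.

Variables (k : nat) (x : 'I_k -> E) (a : 'I_k -> rat).
Hypothesis xE : forall j, A 1 (x j - iota (a j) * z).

(** Each [x j] is [iota (a j) * z] plus a term of degree at most 1 in [xt], so expanding leaves only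
    lower powers of [z] besides the leading one. *)
Lemma monomial_leading m :
  Zs (mdeg m) (mdeg m) (mmap1 x m - iota (mmap1 a m) * z ^+ mdeg m).
Proof.
elim/mnm_ind: m => [|j m IH].
  by rewrite mdeg0 !mmap11 rmorph1 mulr1 subrr; apply: Zs0.
have mM (R : comNzRingType) (h : 'I_k -> R) : mmap1 h (U_(j) + m)%MM = h j * mmap1 h m.
  by rewrite commr_mmap1_M ?mmap1U // => i y; apply: mulrC.
rewrite mdegD mdeg1 add1n !mM rmorphM exprS.
set r := _ - iota (mmap1 a m) * _ in IH.
set w := x j - iota (a j) * z.
have -> : x j * mmap1 x m - iota (a j) * iota (mmap1 a m) * (z * z ^+ mdeg m) =
    (w * (iota (mmap1 a m) * z ^+ mdeg m) + w * r) + iota (a j) * (z * r).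
  by rewrite /w /r; ring.
apply: ZsD; last by apply: ZsZ; apply: Zs_shift.
have Aw : A 1 w by apply: xE.
apply: ZsD; last by apply: ZsM1 => //; apply: Zs_le IH.
by apply: ZsM1 => //; apply: Zs_exp.
Qed.

Variables (F : {mpoly rat[k]}) (N : nat).
Hypotheses (FN : msize F = N.+1) (F0 : ev x F = 0).
Hypothesis FaN0 : \sum_(m <- msupp F | mdeg m == N) F@_m * mmap1 a m != 0.

(** After the substitution, the coefficient of [z ^+ N] in the relation [F] is the top form of [F]
    at [a]. It is nonzero, so the relation can be solved for [z ^+ N] without raising the degree. *)
Lemma top_power : Zs N N (z ^+ N).
Proof.
pose c := \sum_(m <- msupp F | mdeg m == N) F@_m * mmap1 a m.
have c0 : c != 0 by [].
suff ZF : Zs N N (ev x F - iota c * z ^+ N).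
  have := ZsZ (- c^-1) ZF; rewrite F0 sub0r mulrN rmorphN mulNr opprK mulrA -rmorphM.
  by rewrite mulVf // rmorph1 mul1r.
have -> : ev x F - iota c * z ^+ N = \sum_(m <- msupp F)
   iota F@_m * (mmap1 x m - (if mdeg m == N then iota (mmap1 a m) * z ^+ N else 0)).
  rewrite /mmap /c [X in iota X]big_mkcond raddf_sum /= mulr_suml -sumrB; apply: eq_bigr => m _.
  rewrite mulrBr; congr (_ - _); case: ifP => _; last by rewrite rmorph0 mul0r mulr0.
  by rewrite rmorphM mulrA.
rewrite big_seq; apply: Zs_sum => m mF; apply: ZsZ.
have := msize_mdeg_lt mF; rewrite FN ltnS leq_eqVlt => /orP[/eqP <-|mN].
  by rewrite eqxx; apply: monomial_leading.
rewrite (ltn_eqF mN) subr0 -[mmap1 x m](subrK (iota (mmap1 a m) * z ^+ mdeg m)).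
apply: ZsD; last by apply: Zs_exp => //; apply: ltnW.
by apply: Zs_le (ltnW mN) _; apply: Zs_leD (ltnW mN) _; apply: monomial_leading.
Qed.

Lemma Zs_mulz D v : (0 < N)%N -> Zs N D v -> Zs N D.+1 (z * v).
Proof.
move=> N0 /Zs_shift[q qP ->]; rewrite big_ord_recr /=; apply: ZsD.
  by exists q => // l lN; apply: qP; apply: leqW.
have [[ND Aq]|->] := qP N (leqnn _); last by rewrite mulr0; apply: Zs0.
by rewrite mulrC -(subnKC ND); apply: ZsM => //; apply: top_power.
Qed.

Lemma values_reduce D v : (0 < N)%N -> poly_values x D v -> Zs N D v.
Proof.
move=> N0 [g gD ->]; rewrite /mmap big_seq; apply: Zs_sum => m mg; apply: ZsZ.
have : (mdeg m <= D)%N by rewrite -ltnS; apply: leq_trans (msize_mdeg_lt mg) gD.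
move=> mD; apply: Zs_leD mD _; elim/mnm_ind: m {mg} => [|j m IH].
  by rewrite mdeg0 mmap11 -[1]mulr1 -{1}(rmorph1 iota) -(expr0 z); apply: Zs_exp.
rewrite mdegD mdeg1 add1n commr_mmap1_M ?mmap1U; last by move=> i y; apply: mulrC.
rewrite -[x j](subrK (iota (a j) * z)) mulrDl; apply: ZsD.
  exact: ZsM1.
by rewrite -mulrA; apply: ZsZ; apply: Zs_mulz.
Qed.

End MonicReduction.

(** The top form is multiplied by the last variable before a nonroot is taken: [a ord_max != 0] lets
    [z] be a multiple of the last coordinate, which leaves only [n] coordinates [xt] for the
    induction. *)
Lemma top_form_nonroot n (F : {mpoly rat[n.+1]}) N : msize F = N.+1 ->
  exists2 a : 'I_n.+1 -> rat, a ord_max != 0 &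
    \sum_(m <- msupp F | mdeg m == N) F@_m * mmap1 a m != 0.
Proof.
move=> FN; pose G := \sum_(m <- msupp F | mdeg m == N) F@_m *: 'X_[m].
have F0 : F != 0 by rewrite -msize_poly_eq0 FN.
have leadN : mdeg (mlead F) = N by apply: succn_inj; rewrite mlead_deg.
have G0 : G != 0.
  apply/eqP => /(congr1 (mcoeff (mlead F))); rewrite mcoeff0 raddf_sum /=.
  rewrite big_mkcond (bigD1_seq (mlead F)) ?msupp_uniq ?mlead_supp //= leadN eqxx.
  rewrite big1 => [|m /negPf mN]; last by rewrite mcoeffZ mcoeffX mN mulr0 if_same.
  by rewrite addr0 mcoeffZ mcoeffX eqxx mulr1 => /eqP; rewrite mleadc_eq0 (negPf F0).
have X0 : 'X_ord_max != 0 :> {mpoly rat[n.+1]}.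
  by rewrite -msize_poly_eq0 msizeX.
have [a] := mpoly_nonroot (mulf_neq0 G0 X0).
rewrite mevalM mevalXU mulf_eq0 negb_or => /andP[Ga a0]; exists a => //.
congr (_ != 0) : Ga; rewrite /G rmorph_sum /=; apply: eq_bigr => m _.
by rewrite mevalZ mevalX.
Qed.

(** Finiteness comes with control of degrees: a value of degree at most [D] has coefficients of
    degree at most [D] on fixed module generators. This is what bounds the Hilbert function from
    above. *)
Theorem noether_normalization n (x : 'I_n -> E) :
  exists m, (m <= n)%N /\ exists (y : 'I_m -> E) (J : finType) (w : J -> E),
    [/\ alg_indep y, forall i, lin_comb x (y i),
        forall j, exists D, poly_values x D (w j) &
        forall D v, poly_values x D v -> exists p : J -> {mpoly rat[m]},
          (forall j, msize (p j) <= D.+1)%N /\ v = \sum_j w j * ev y (p j)].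
Proof.
elim: n x => [|n IH] x.
  exists 0%N; split=> //; exists x, unit, (fun=> 1); split.
  - move=> g; rewrite [g]nvar0_mpolyC mmapC => /eqP; rewrite fmorph_eq0 => /eqP ->.
    by rewrite mpolyC0.
  - by case.
  - by exists 0%N; rewrite -(rmorph1 iota); apply: values_const.
  - by move=> D v [g gD ->]; exists (fun=> g); split=> //; rewrite big_const cardT enumT unlock /= mul1r addr0.
have [ind|/existsNP[F /not_implyP[Fx F0]]] := pselect (alg_indep x).
  exists n.+1; split=> //; exists x, unit, (fun=> 1); split=> //.
  - exact: lin_comb_var.
  - by exists 0%N; rewrite -(rmorph1 iota); apply: values_const.
  - by move=> D v [g gD ->]; exists (fun=> g); split=> //; rewrite big_const cardT enumT unlock /= mul1r addr0.
have [N FN] : exists N, msize F = N.+1.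
  by exists (msize F).-1; rewrite prednK // lt0n msize_poly_eq0; apply/eqP.
have N0 : (0 < N)%N.
  rewrite lt0n; apply/eqP => N0; rewrite N0 in FN; apply: F0.
  have := Fx; rewrite [F]msize1_polyC ?FN // mmapC => /eqP.
  by rewrite fmorph_eq0 => /eqP ->; rewrite mpolyC0.
have [a a0 Fa] := top_form_nonroot FN.
have ia0 : iota (a ord_max) != 0 by rewrite fmorph_eq0.
pose z := iota (a ord_max)^-1 * x ord_max.
pose xt (i : 'I_n) := x (widen_ord (leqnSn n) i) - iota (a (widen_ord (leqnSn n) i)) * z.
have z_lin : lin_comb x z.
  have := lin_combD (a ord_max)^-1 0 (lin_comb_var x ord_max) (lin_comb_var x ord_max).
  by rewrite rmorph0 mul0r addr0.
have xt_lin i : lin_comb x (xt i).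
  have := lin_combD 1 (- a (widen_ord (leqnSn n) i)) (lin_comb_var x (widen_ord (leqnSn n) i)) z_lin.
  by rewrite rmorph1 mul1r rmorphN mulNr.
have xE j : poly_values xt 1 (x j - iota (a j) * z).
  case: (ord_max_or_widen j) => [->|[i ->]]; last exact/values_linear/lin_comb_var.
  rewrite /z mulrA -rmorphM divff // rmorph1 mul1r subrr -(rmorph0 iota).
  exact: values_const.
have [m [mn [y [J [w [ind y_lin w_val span]]]]]] := IH xt.
exists m; split; first exact: leqW.
exists y, ('I_N * J)%type, (fun lj : 'I_N * J => z ^+ (lj.1 : 'I_N) * w lj.2); split=> //.
- by move=> i; apply: lin_comb_trans (y_lin i).
- move=> [l j] /=; have [D wD] := w_val j; exists (l * 1 + D)%N.
  apply: valuesM; last exact: values_trans wD.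
  have [g g1 ->] := values_linear 0 z_lin.
  by exists (g ^+ l); [apply: msizeX_leq|rewrite rmorphXn].
move=> D v /(values_reduce xE FN Fx Fa N0)[q qP ->].
have /choice[p pP] (l : 'I_N) : exists p : J -> {mpoly rat[m]},
    (forall j, msize (p j) <= D.+1)%N /\ q l = \sum_j w j * ev y (p j).
  have [[lD Aq]|->] := qP l (ltn_ord l).
    by apply: span; apply: values_le Aq; apply: leq_subr.
  by exists (fun=> 0); split=> [j|]; rewrite ?msize0 // big1 // => j _; rewrite rmorph0 mulr0.
exists (fun lj => p lj.1 lj.2); split=> [[l j]|] /=; first by case: (pP l).
rewrite -(pair_bigA _ (fun l j => z ^+ (l : 'I_N) * w j * ev y (p l j))) /=.
apply: eq_bigr => l _; rewrite (pP l).2 mulr_sumr.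
by apply: eq_bigr => j _; rewrite mulrA.
Qed.

End Evaluation.

(** * Algebraic independence *)

Definition ycat (E : Type) m (y : 'I_m -> E) (a : E) (i : 'I_m.+1) : E :=
  if unlift ord_max i is Some j then y j else a.

Lemma ycat_max E m (y : 'I_m -> E) a : ycat y a ord_max = a.
Proof. by rewrite /ycat unlift_none. Qed.

Lemma widen_lift_max m (j : 'I_m) : widen_ord (leqnSn m) j = lift ord_max j.
Proof. by apply/val_inj; rewrite /= /bump leqNgt ltn_ord. Qed.

Lemma ycat_widen E m (y : 'I_m -> E) a j : ycat y a (widen_ord (leqnSn m) j) = y j.
Proof. by rewrite /ycat widen_lift_max liftK. Qed.

Lemma common_denominator (R : idomainType) (I : finType) (k : I -> {fraction R}) :
  exists c (a : I -> R), c != 0 /\ forall i, c%:F * k i = (a i)%:F.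
Proof.
have /choice[nd ndP] (i : I) : exists nd : R * R, nd.2 != 0 /\ k i = nd.1%:F / nd.2%:F.
  by have [n [d [d0 ->]]] := fraction_numden (k i); exists (n, d).
exists (\prod_i (nd i).2), (fun i => (\prod_(j | j != i) (nd j).2) * (nd i).1); split.
  by apply/prodf_neq0 => i _; case: (ndP i).
move=> i; have [d0 ->] := ndP i; rewrite (bigD1 i) //= !rmorphM /=.
have dF0 : (nd i).2%:F != 0 by rewrite tofrac_eq0.
by field.
Qed.

Section AlgIndep.

Variables (E : fieldType) (iota : {rmorphism rat -> E}).
Notation ev y g := (mmap iota y g).
Notation alg_indep := (alg_indep iota).

Lemma alg_indep_inj m k (y : 'I_m -> E) (s : 'I_k -> 'I_m) :
  injective s -> alg_indep y -> alg_indep (y \o s).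
Proof.
move=> s_inj ind g gy0; pose t i : {mpoly rat[k]} :=
  if [pick j | s j == i] is Some j then 'X_j else 0.
have : g \mPo [tuple 'X_(s i) | i < k] = 0 :> {mpoly rat[m]}.
  apply: ind; rewrite mmap_comp -[RHS]gy0; apply: mmap_eq => i.
  by rewrite tnth_mktuple mmapXU.
move/(congr1 (mmap (@mpolyC k rat) t)); rewrite mmap0 mmap_comp => <-.
pose F : {rmorphism {mpoly rat[k]} -> {mpoly rat[k]}} := idfun.
pose G : {rmorphism {mpoly rat[k]} -> {mpoly rat[k]}} := mmap (@mpolyC k rat)
  (fun i => mmap (@mpolyC k rat) t (tnth [tuple 'X_(s i) | i < k] i)).
apply: (@mpoly_rmorph_ext _ _ _ F G) => [c|i]; rewrite /F /G /=; first by rewrite mmapC.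
rewrite mmapXU tnth_mktuple mmapXU /t; case: pickP => [j /eqP/s_inj ->//|/(_ i)].
by rewrite eqxx.
Qed.

Section OverFractions.

Variables (m : nat) (y : 'I_m -> E).
Hypothesis ind : alg_indep y.

Let K := {fraction {mpoly rat[m]}}.
Variable phi : {rmorphism K -> E}.
Hypothesis phiE : forall a, phi a%:F = ev y a.

Lemma pchar_fraction0 : [pchar K] =i pred0.
Proof.
move=> p; apply/negP => /andP[p_pr /eqP/(congr1 phi)]; rewrite rmorph_nat rmorph0.
rewrite -(rmorph_nat iota) => /eqP; rewrite fmorph_eq0 pnatr_eq0 => /eqP p0.
by rewrite p0 in p_pr.
Qed.

Lemma root_of_relation (g : {mpoly rat[m.+1]}) a :
  (map_poly phi (map_poly (fun c => c%:F) (muni g))).[a] = ev (ycat y a) g.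
Proof.
rewrite mmap_muni ycat_max; congr horner; rewrite -map_poly_comp.
apply: eq_map_poly => c /=; rewrite phiE; apply: mmap_eq => i.
by rewrite /= ycat_widen.
Qed.

Lemma map_tofrac_eq0 (P : {poly {mpoly rat[m]}}) :
  (map_poly (fun c => c%:F) P == 0) = (P == 0).
Proof.
rewrite -!size_poly_eq0 size_map_inj_poly ?tofrac0 //.
by move=> u v /eqP; rewrite tofrac_eq => /eqP.
Qed.

Lemma size_map_tofrac (P : {poly {mpoly rat[m]}}) :
  size (map_poly (fun c => c%:F) P) = size P.
Proof.
by rewrite size_map_inj_poly ?tofrac0 // => u v /eqP; rewrite tofrac_eq => /eqP.
Qed.

Lemma clear_denominators (p : {poly K}) : p != 0 ->
  exists2 P : {poly {mpoly rat[m]}}, P != 0 &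
    exists2 c : K, c != 0 & map_poly (fun c => c%:F) P = c *: p.
Proof.
move=> p0; have [c [a [c0 cE]]] := common_denominator (fun i : 'I_(size p) => p`_i).
exists (\poly_(i < size p) (if insub i is Some j then a j else 0)); last first.
  exists c%:F; first by rewrite tofrac_eq0.
  apply/polyP => i; rewrite coef_map_id0 ?tofrac0 // coef_poly coefZ.
  case: ltnP => ip; last by rewrite tofrac0 nth_default ?mulr0.
  by rewrite insubT -cE.
apply: contraNneq p0 => P0; apply/eqP/polyP => i; rewrite coef0.
have [ip|ip] := ltnP i (size p); last by rewrite nth_default.
have := congr1 (fun q : {poly {mpoly rat[m]}} => q`_i) P0.
rewrite coef_poly ip insubT coef0 => a0; have := cE (Ordinal ip).
by rewrite a0 tofrac0 => /eqP; rewrite mulf_eq0 tofrac_eq0 (negPf c0) => /eqP.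
Qed.

Lemma algebraic_relation a : algebraicOver phi a <-> ~ alg_indep (ycat y a).
Proof.
split=> [[p p0 pa]|/existsNP[g /not_implyP[ga g0]]]; last first.
  exists (map_poly (fun c => c%:F) (muni g)).
    by rewrite map_tofrac_eq0 muni_eq0; apply/eqP.
  by rewrite rootE root_of_relation ga.
have [P P0 [c c0 PE]] := clear_denominators p0.
move=> ind'; case/eqP: P0; rewrite -[P]unmuniK (ind' (unmuni P)) ?muni0 //.
rewrite -root_of_relation unmuniK PE map_polyZ hornerZ.
by move: pa; rewrite rootE => /eqP ->; rewrite mulr0.
Qed.

Notation inK a b := (exists q : {poly K}, (map_poly phi q).[a] = b).

(** In characteristic zero the primitive element of two generators can be taken as [b *+ k - x j],
    an integer combination, so it remains a linear form in [x]. *)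
Lemma primitive_element n (x : 'I_n -> E) : (forall j, algebraicOver phi (x j)) ->
  exists2 a, lin_comb iota x a & algebraicOver phi a /\ forall j, inK a (x j).
Proof.
move=> x_alg; suff fin (s : seq 'I_n) : exists a,
    [/\ lin_comb iota x a, algebraicOver phi a & forall j, j \in s -> inK a (x j)].
  have [a [a_lin a_alg aK]] := fin (enum 'I_n).
  by exists a => //; split=> // j; apply: aK; rewrite mem_enum.
elim: s => [|j s [b [b_lin b_alg bK]]].
  exists 0; split=> //; last exact: algebraic0.
  by exists (fun=> 0); rewrite big1 // => i _; rewrite rmorph0 mul0r.
have [p p0 pj] := x_alg j; have [q q0 qb] := b_alg.
have [k [[u uE] [v vE]]] := pchar0_PET p0 pj q0 qb pchar_fraction0.
exists (b *+ k - x j); split.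
- have := lin_combD k%:R (-1) b_lin (lin_comb_var iota x j).
  by rewrite rmorph_nat rmorphN rmorph1 mulN1r mulr_natl.
- apply: algebraic_sub => //; rewrite -mulr_natl; apply: algebraic_mul => //.
  by rewrite -(rmorph_nat phi); apply: algebraic_id.
- move=> i; rewrite inE => /orP[/eqP->|/bK[w <-]]; first by exists u.
  by exists (w \Po v); rewrite map_comp_poly horner_comp vE.
Qed.

End OverFractions.

(** [r] is the degree of [a] over the field generated by [y]. A nonzero relation of smaller total
    degree would contradict minimality, and [c] is a common denominator for the generators of
    Noether normalization written in powers of [a]. *)
Theorem generic_projection n (x : 'I_n -> E) :
  exists m r, (m <= n)%N /\ exists (y : 'I_m -> E) (a : E),
    [/\ alg_indep y, forall i, lin_comb iota x (y i), lin_comb iota x a,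
      forall g : {mpoly rat[m.+1]}, (msize g <= r)%N -> ev (ycat y a) g = 0 -> g = 0 &
      exists2 c : E, c != 0 & exists e, forall D v, poly_values iota x D v ->
        exists2 p : 'I_r -> {mpoly rat[m]}, forall l, (msize (p l) <= (D + e).+1)%N &
          c * v = \sum_(l < r) a ^+ l * ev y (p l)].
Proof.
have [m [mn [y [J [w [ind y_lin w_val span]]]]]] := noether_normalization iota x.
have [phi phiE] := fraction_lift ind.
have x_alg j : algebraicOver phi (x j).
  (* The [#|J| + 1] powers of [x j] lie in a module with [#|J|] generators, hence are linearly
     dependent over the fraction field. *)
  have /choice[p pP] (i : 'I_#|J|.+1) : exists p : J -> {mpoly rat[m]},
      x j ^+ i = \sum_t w t * ev y (p t).
    have [|p [_ ->]] := span i (x j ^+ i); last by exists p.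
    exists ('X_j ^+ i); last by rewrite rmorphXn /= mmapXU.
    by rewrite -[X in (_ <= X.+1)%N]muln1; apply: msizeX_leq; rewrite msizeX mdeg1.
  have [|c [i ci] cP] := exists_left_kernel (fun (i : 'I_#|J|.+1) t => (p i t)%:F).
    by rewrite card_ord.
  exists (\poly_(i < #|J|.+1) c (inord i)).
    apply: contraNneq ci => /(congr1 (fun q : {poly _} => q`_i)).
    by rewrite coef_poly ltn_ord inord_val coef0 => ->.
  rewrite rootE; apply/eqP; rewrite (@horner_coef_wide _ #|J|.+1); last first.
    by rewrite size_map_poly; apply: size_poly.
  under eq_bigr => i' _ do rewrite coef_map coef_poly ltn_ord inord_val pP mulr_sumr.
  rewrite exchange_big big1 //= => t _.
  transitivity (w t * phi (\sum_i c i * (p i t)%:F)); last by rewrite cP rmorph0 mulr0.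
  rewrite rmorph_sum mulr_sumr; apply: eq_bigr => i' _.
  by rewrite rmorphM /= phiE mulrCA.
have [a a_lin [[p0 p00 p0a] aK]] := primitive_element x_alg.
pose root_size k := `[< exists p : {poly {fraction {mpoly rat[m]}}},
   [/\ p != 0, root (map_poly phi p) a & size p = k] >].
have ex_size : exists k, root_size k by exists (size p0); apply/asboolP; exists p0.
have [R' /asboolP[p [p_neq0 pa <-]] min_p] := ex_minnP ex_size.
have sp : (1 < size p)%N.
  rewrite ltnNge; apply/negP => /size1_polyC pC; rewrite pC map_polyC rootC fmorph_eq0 in pa.
  by case/negP: p_neq0; rewrite pC (eqP pa).
have p_min q : root (map_poly phi q) a -> (size q < size p)%N -> q = 0.
  move=> qa sq; apply/eqP; apply: contraTT sq => q0; rewrite -leqNgt.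
  by apply: min_p; apply/asboolP; exists q.
exists m, (size p).-1; split=> //; exists y, a; split=> //.
  move=> g sg ga; apply/eqP; rewrite -muni_eq0 -map_tofrac_eq0; apply/eqP.
  apply: p_min; first by rewrite rootE (root_of_relation phiE) ga.
  rewrite size_map_tofrac (leq_ltn_trans (size_muni g)) // (leq_ltn_trans sg) //.
  by rewrite prednK // ltnW.
have val_poly v D : poly_values iota x D v ->
    exists q : {poly {fraction {mpoly rat[m]}}}, (map_poly phi q).[a] = v.
  move=> [g _ ->]; have /choice[h hP] := aK.
  pose F : {rmorphism {mpoly rat[n]} -> E} := mmap iota x.
  pose C : {rmorphism rat -> {poly {fraction {mpoly rat[m]}}}} :=
    @polyC _ \o @FracField.tofrac _ \o @mpolyC m rat.
  pose G : {rmorphism {mpoly rat[n]} -> E} :=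
    horner_eval a \o map_poly phi \o mmap C h.
  exists (mmap C h g); apply/esym.
  apply: (@mpoly_rmorph_ext _ _ _ F G) => [c|i]; rewrite /F /G /= /horner_eval.
    by rewrite !mmapC /= map_polyC hornerC /= phiE /= mmapC.
  by rewrite !mmapXU hP.
have /choice[q qP] (j : J) : exists q : {poly {fraction {mpoly rat[m]}}}, (size q < size p)%N /\ (map_poly phi q).[a] = w j.
  have [D /val_poly[q <-]] := w_val j; exists (q %% p); split; first by rewrite ltn_modp.
  rewrite {2}(divp_eq q p) rmorphD rmorphM hornerD hornerM.
  by move: pa; rewrite rootE => /eqP ->; rewrite mulr0 add0r.
have [c [b [c0 bE]]] := common_denominator (fun jl : J * 'I_(size p).-1 => (q jl.1)`_jl.2).
have cy0 : ev y c != 0 by rewrite -phiE fmorph_eq0 tofrac_eq0.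
exists (ev y c) => //; exists (\max_jl msize (b jl))%N => D v /span[t [tD ->]].
exists (fun l => \sum_j b (j, l) * t j).
  move=> l; apply: msize_sum_leq => j _; rewrite addnC; apply: msizeM_leq => //.
  by apply: leqW; apply: (leq_bigmax (F := fun jl => msize (b jl))).
rewrite mulr_sumr; under [RHS]eq_bigr => l _ do rewrite raddf_sum mulr_sumr.
rewrite exchange_big /=; apply: eq_bigr => j _.
have [sq <-] := qP j; rewrite (@horner_coef_wide _ (size p).-1); last first.
  by rewrite size_map_poly -ltnS prednK // ltnW.
have distr (s1 s2 : E) N (F : 'I_N -> E) : s1 * ((\sum_i F i) * s2) = \sum_i s1 * (F i * s2).
  by rewrite mulr_suml mulr_sumr.
rewrite distr; apply: eq_bigr => l _.
have := congr1 phi (bE (j, l)); rewrite rmorphM !phiE /= rmorphM /= => <-.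
by rewrite coef_map /=; ring.
Qed.

End AlgIndep.

(** * Hilbert polynomial and degree *)

Lemma lead_coef_le_infty (p q : {poly rat}) k0 :
  (forall k, (k0 <= k)%N -> p.[k%:R] <= q.[k%:R]) -> 0 <= lead_coef (q - p).
Proof.
move=> pq; rewrite leNgt; apply/negP => lc_neg.
have lc_pos : 0 < lead_coef (p - q) by rewrite -opprB lead_coefN oppr_gt0.
have [z zP] := poly_pinfty_gt_lc lc_pos.
pose k := maxn k0 (Num.bound `|z|).
have zk : z <= k%:R.
  apply: le_trans (ler_norm z) _; apply: le_trans (ltW (archi_boundP (normr_ge0 z))) _.
  by rewrite ler_nat leq_maxr.
have := lt_le_trans lc_pos (zP _ zk).
by rewrite hornerD hornerN subr_gt0 ltNge pq // leq_maxl.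
Qed.

Lemma size_le_infty (p q : {poly rat}) k0 : 0 < lead_coef p ->
  (forall k, (k0 <= k)%N -> p.[k%:R] <= q.[k%:R]) ->
  (size p <= size q)%N /\ (size p = size q -> lead_coef p <= lead_coef q).
Proof.
move=> lcp /lead_coef_le_infty lcqp; split.
  rewrite leqNgt; apply/negP => sqp; move: lcqp.
  by rewrite lead_coefDr ?size_polyN // lead_coefN oppr_ge0 leNgt lcp.
move=> spq; rewrite leNgt; apply/negP => lc_lt; move: lcqp.
have cE : (q - p)`_(size q).-1 = lead_coef q - lead_coef p.
  by rewrite coefB -lead_coefE -spq -lead_coefE.
have sE : size (q - p) = size q.
  apply/eqP; rewrite eqn_leq; apply/andP; split.
    by apply: leq_trans (size_polyD _ _) _; rewrite size_polyN spq maxnn.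
  rewrite leqNgt; apply/negP => s_lt.
  have q0 : (0 < size q)%N by apply: leq_ltn_trans s_lt.
  have : (q - p)`_(size q).-1 = 0 by rewrite nth_default // -ltnS prednK.
  by rewrite cE => /eqP; rewrite subr_eq0 lt_eqF.
by rewrite lead_coefE sE cE subr_ge0 leNgt lc_lt.
Qed.

(** The Hilbert polynomial of affine [m]-space shifted by [c], scaled by [m!] to be monic. *)
Definition binom_poly m c : {poly rat} := \prod_(i < m) ('X + (c + m - i)%:R%:P).

Lemma binom_poly_eval m c D : (binom_poly m c).[D%:R] = (m`! * 'C(m + (D + c), m))%:R.
Proof.
rewrite mulnC bin_ffact ffact_prod horner_prod natr_prod; apply: eq_bigr => i _.
rewrite hornerD hornerX hornerC -natrD; congr _%:R.
by have := ltn_ord i; lia.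
Qed.

Lemma binom_poly_monic m c : binom_poly m c \is monic.
Proof.
by apply: monic_prod => i _; rewrite -[_%:P]opprK -polyCN monicXsubC.
Qed.

Lemma size_binom_poly m c : size (binom_poly m c) = m.+1.
Proof.
rewrite /binom_poly; under eq_bigr => i _ do rewrite -[_%:P]opprK -polyCN.
by rewrite -(big_enum _ _ _ _) /= size_prod_XsubC -cardE card_ord.
Qed.

Lemma bin_shift_geq m D e :
  ('C(m.+1 + D, m.+1) + e * 'C(m + D, m) <= 'C(m.+1 + (D + e), m.+1))%N.
Proof.
elim: e => [|e IH]; first by rewrite mul0n !addn0.
have -> : (m.+1 + (D + e.+1) = (m.+1 + (D + e)).+1)%N by lia.
rewrite binS mulSnr addnA; apply: leq_add => //.
by apply: leq_bin2l; lia.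
Qed.

Section HilbertFunction.

Variables (E : fieldType) (iota : {rmorphism rat -> E}) (n : nat) (x : 'I_n -> E).
Variables (P : {poly rat}) (d k0 : nat).

Notation ev y g := (mmap iota y g).

Hypothesis hilbert : forall k, (k0 <= k)%N -> exists h (b : 'I_h -> E),
  [/\ P.[k%:R] = h%:R, free_over iota b, forall i, poly_values iota x k (b i) &
      forall v, poly_values iota x k v -> exists c : 'I_h -> rat, v = \sum_i iota (c i) * b i].
Hypothesis degreeP : d%:R = ((size P).-1)`!%:R * lead_coef P.
Hypothesis d_gt0 : (0 < d)%N.

Lemma hilbert_lead_coef_gt0 : 0 < lead_coef P.
Proof.
have : 0 < d%:R :> rat by rewrite ltr0n.
by rewrite degreeP pmulr_rgt0 // ltr0n fact_gt0.
Qed.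

Lemma free_values_leq k h (I : finType) (v : I -> E) (b : 'I_h -> E) :
  (forall v, poly_values iota x k v -> exists c : 'I_h -> rat, v = \sum_i iota (c i) * b i) ->
  free_over iota v -> (forall i, poly_values iota x k (v i)) -> (#|I| <= h)%N.
Proof.
move=> span free_v vk; have /choice[C CP] i := span _ (vk i).
by rewrite -[h]card_ord; apply: free_over_leq free_v CP.
Qed.

Lemma monomials_free m (y : 'I_m -> E) D : alg_indep iota y ->
  free_over iota (fun b : 'X_{1..m < D.+1} => mmap1 y b).
Proof.
move=> ind c c0 b.
have sz : (msize (\sum_(b : 'X_{1..m < D.+1}) c b *: 'X_[b]) <= D.+1)%N.
  by apply: msize_sum_leq => i _; rewrite (leq_trans (msizeZ_le _ _)) // msizeX bmdeg.
have /ind/(congr1 (mcoeff b)) : ev y (\sum_(b : 'X_{1..m < D.+1}) c b *: 'X_[b]) = 0.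
  rewrite raddf_sum -[RHS]c0; apply: eq_bigr => i _ /=.
  by rewrite mmapZ mmapX.
rewrite mcoeff0 raddf_sum (bigD1 b) //= mcoeffZ mcoeffX eqxx mulr1 big1 ?addr0 // => i.
by rewrite mcoeffZ mcoeffX -val_eqE /= => /negPf ->; rewrite mulr0.
Qed.

Lemma monomial_values m (y : 'I_m -> E) D (b : 'X_{1..m < D.+1}) :
  (forall i, lin_comb iota x (y i)) -> poly_values iota x D (mmap1 y b).
Proof.
move=> y_lin; apply: values_trans y_lin _; exists 'X_[b]; last by rewrite mmapX.
by rewrite msizeX bmdeg.
Qed.

Lemma hilbert_lower m (y : 'I_m -> E) k : alg_indep iota y ->
  (forall i, lin_comb iota x (y i)) -> (k0 <= k)%N -> ('C(m + k, m))%:R <= P.[k%:R].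
Proof.
move=> ind y_lin /hilbert[h [b [-> _ _ span]]]; rewrite ler_nat -card_bmnm.
by apply: (free_values_leq span (monomials_free ind)) => i; apply: monomial_values.
Qed.

Lemma size_hilbert_lower m (y : 'I_m -> E) : alg_indep iota y ->
  (forall i, lin_comb iota x (y i)) -> (m < size P)%N.
Proof.
move=> ind y_lin.
have ub k : (k0 <= k)%N -> (binom_poly m 0).[k%:R] <= (m`!%:R *: P).[k%:R].
  move=> /(hilbert_lower ind y_lin) kP; rewrite binom_poly_eval hornerZ addn0 natrM.
  by rewrite ler_pM2l // ltr0n fact_gt0.
have [|sz _] := size_le_infty _ ub; first by rewrite (monicP (binom_poly_monic _ _)).
rewrite -(size_binom_poly m 0); apply: leq_trans sz _; apply: size_scale_leq.
Qed.

(** The Hilbert polynomial lies between the number ['C(m + k, m)] of monomials in [y] and the number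
    [r * 'C(m + k + e, m)] of products that span after multiplication by [c]. Comparing growth gives
    its degree, and then leading coefficients give [d <= r]. *)
Lemma degree_projection m r (y : 'I_m -> E) (a : E) :
  alg_indep iota y -> (forall i, lin_comb iota x (y i)) ->
  (exists2 c : E, c != 0 & exists e, forall D v, poly_values iota x D v ->
        exists2 p : 'I_r -> {mpoly rat[m]}, forall l, (msize (p l) <= (D + e).+1)%N &
          c * v = \sum_(l < r) a ^+ l * ev y (p l)) ->
  size P = m.+1 /\ (d <= r)%N.
Proof.
move=> ind y_lin [c c0 [e span]].
have ub k : (k0 <= k)%N -> (m`!%:R *: P).[k%:R] <= (r%:R *: binom_poly m e).[k%:R].
  move=> /hilbert[h [b [PE free_b bk _]]]; rewrite !hornerZ PE binom_poly_eval.
  rewrite mulrC -!natrM ler_nat mulnCA mulnC leq_mul2l; apply/orP; right.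
  have /choice[p pP] (i : 'I_h) : exists p : 'I_r -> {mpoly rat[m]},
      (forall l, (msize (p l) <= (k + e).+1)%N) /\ c * b i = \sum_(l < r) a ^+ l * ev y (p l).
    by have [p ? ?] := span k (b i) (bk i); exists p.
  rewrite -card_bmnm -{1}[h]card_ord -[r]card_ord -card_prod.
  have free_cb : free_over iota (fun i => c * b i).
    move=> t tb; apply: free_b; apply: (mulfI c0); rewrite mulr0 mulr_sumr -[RHS]tb.
    by apply: eq_bigr => i _; rewrite mulrCA.
  apply: (free_over_leq free_cb
    (w := fun lb : 'I_r * 'X_{1..m < (k + e).+1} => a ^+ lb.1 * mmap1 y lb.2)
    (C := fun i lb => (p i lb.1)@_lb.2)) => i.
  rewrite (pP i).2 -(pair_bigA _ (fun l (b : 'X_{1..m < (k + e).+1}) =>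
    iota (p i l)@_b * (a ^+ (l : 'I_r) * mmap1 y b))) /=; apply: eq_bigr => l _.
  rewrite (mmapE (k + e).+1 ((pP i).1 l)) mulr_sumr; apply: eq_bigr => β _.
  by rewrite mulrCA.
have fm0 : m`!%:R != 0 :> rat by rewrite pnatr_eq0 -lt0n fact_gt0.
have lc_fP : 0 < lead_coef (m`!%:R *: P).
  by rewrite lead_coefZ mulr_gt0 ?hilbert_lead_coef_gt0 // ltr0n fact_gt0.
have [sz lc] := size_le_infty lc_fP ub; rewrite size_scale // in sz lc.
have sP : size P = m.+1.
  apply/eqP; rewrite eqn_leq (size_hilbert_lower ind y_lin) andbT.
  by apply: leq_trans sz _; rewrite -(size_binom_poly m e); apply: size_scale_leq.
split=> //; have := degreeP; rewrite sP /= -lead_coefZ => dE.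
have r0 : (0 < r)%N.
  rewrite lt0n; apply/eqP => r0; move: sz; rewrite r0 scale0r size_poly0 sP.
  by [].
have := lc _; rewrite sP size_scale ?pnatr_eq0 -?lt0n // size_binom_poly => /(_ erefl).
by rewrite -dE lead_coefZ (monicP (binom_poly_monic _ _)) mulr1 ler_nat.
Qed.

(** Some prime factor of a relation is itself a relation; since no nonzero polynomial in [y] alone
    vanishes, [prime_kernel] makes it a generator. *)
Lemma prime_relation m (y : 'I_m -> E) (a : E) : alg_indep iota y ->
  ~ alg_indep iota (ycat y a) -> exists f : {mpoly rat[m.+1]},
    [/\ f != 0, ev (ycat y a) f = 0 &
        forall g, ev (ycat y a) g = 0 -> exists u, g = f * u].
Proof.
move=> ind /existsNP[g0 /not_implyP[g0a /eqP g00]].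
have fact : factorial {mpoly rat[m.+1]} by apply: factorial_mpoly.
have evM := rmorphM (mmap iota (ycat y a)).
have [f pf fa] : exists2 f, prime_elt f & ev (ycat y a) f = 0.
  have [u [ps [uu]]] := fact _ g00.
  elim: ps g0 g0a {g00} => [|p ps IH] g0 g0a ps_prime g0E.
    rewrite big_nil mulr1 in g0E; move: uu; rewrite -g0E => /(rmorph_unit (mmap iota (ycat y a))).
    by rewrite /= g0a unitr0.
  move/eqP: g0a; rewrite g0E big_cons mulrCA /= evM mulf_eq0 => /orP[/eqP pa|/eqP ra].
    by exists p => //; apply: ps_prime; rewrite inE eqxx.
  apply: (IH _ ra) => // q qps; apply: ps_prime; by rewrite inE qps orbT.
have [f0 fu f_mul] := pf; exists f; split=> // g ga.
have no_const (c : {mpoly rat[m]}) : ev (ycat y a) (unmuni c%:P) = 0 -> c = 0.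
  move=> ca; apply: ind; rewrite -[RHS]ca mmap_muni unmuniK map_polyC hornerC.
  by apply: mmap_eq => i; rewrite /= ycat_widen.
have pF : prime_elt (muni f) by apply: (prime_elt_iso (@muniK rat m) (@unmuniK rat m)).
pose F : {rmorphism {poly {mpoly rat[m]}} -> E} := mmap iota (ycat y a) \o @unmuni rat m.
have [z zE] : divides (muni f) (muni g).
  by apply: (prime_kernel (ev := F) _ pF); rewrite /F /= ?muniK.
by exists (unmuni z); rewrite -[g]muniK zE (rmorphM (@unmuni rat m)) /= muniK mulrC.
Qed.

(** Let [e] be the degree of a generator [f] of the relations. Polynomials of degree at most [k + e]
    in [m + 1] variables have at least [e * 'C(m + k, m)] independent values, so comparing leading
    coefficients with the Hilbert polynomial gives [e <= d]. *)
Lemma hilbert_relation m (y : 'I_m -> E) (a : E) : alg_indep iota y ->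
  (forall i, lin_comb iota x (y i)) -> lin_comb iota x a -> size P = m.+1 ->
  exists f : {mpoly rat[m.+1]}, [/\ f != 0, (msize f <= d.+1)%N & ev (ycat y a) f = 0].
Proof.
move=> ind y_lin a_lin sP.
have ya_lin i : lin_comb iota x (ycat y a i).
  by rewrite /ycat; case: unlift => [j|].
have dep : ~ alg_indep iota (ycat y a).
  by move=> /size_hilbert_lower/(_ ya_lin); rewrite sP ltnn.
have [f [f0 fa f_dvd]] := prime_relation ind dep.
exists f; split=> //; set e := (msize f).-1.
have fe : msize f = e.+1 by rewrite /e prednK // lt0n msize_poly_eq0.
have deg_f : mdeg (mlead f) = e by apply: succn_inj; rewrite mlead_deg.
have key k : (k0 <= k + e)%N -> (e * 'C(m + k, m))%:R <= P.[(k + e)%:R].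
  move=> /hilbert[h [b [-> _ _ span]]]; rewrite ler_nat.
  have bd := bin_shift_geq m k e; suff : ('C(m.+1 + (k + e), m.+1) <= h + 'C(m.+1 + k, m.+1))%N by lia.
  rewrite leqNgt; apply/negP => lt_card.
  have /choice[C CP] (i : 'X_{1..m.+1 < (k + e).+1}) :
      exists c, mmap1 (ycat y a) i = \sum_j iota (c j) * b j.
    by apply: span; apply: monomial_values.
  (* The extra conditions kill the coefficients at multiples of the leading monomial of [f]. A
     relation [f * u] meeting them must be 0, since its own leading monomial is such a multiple. *)
  pose C' (i : 'X_{1..m.+1 < (k + e).+1}) (j : 'I_h + 'X_{1..m.+1 < k.+1}) : rat :=
    match j with inl j => C i j | inr g => ((i : 'X_{1..m.+1}) == mlead f + g)%MM%:R end.
  have [|c [i ci] cC] := exists_left_kernel C'.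
    by rewrite card_sum card_ord !card_bmnm.
  pose g := \sum_(i : 'X_{1..m.+1 < (k + e).+1}) c i *: 'X_[i].
  have g_coef (i' : 'X_{1..m.+1 < (k + e).+1}) : g@_i' = c i'.
    rewrite raddf_sum (bigD1 i') //= mcoeffZ mcoeffX eqxx mulr1 big1 ?addr0 // => t.
    by rewrite mcoeffZ mcoeffX -val_eqE /= => /negPf ->; rewrite mulr0.
  have g0 : g != 0.
    by apply: contraNneq ci => g0; rewrite -g_coef g0 mcoeff0.
  have ga : ev (ycat y a) g = 0.
    rewrite raddf_sum; transitivity (\sum_j iota (\sum_i c i * C i j) * b j); last first.
      by rewrite big1 // => j _; have := cC (inl j) => /= ->; rewrite rmorph0 mul0r.
    under eq_bigr => t _ do rewrite /= mmapZ mmapX CP mulr_sumr.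
    rewrite exchange_big /=; apply: eq_bigr => j _; rewrite rmorph_sum mulr_suml.
    by apply: eq_bigr => t _; rewrite rmorphM mulrA.
  have gk : (msize g <= (k + e).+1)%N.
    by apply: msize_sum_leq => t _; rewrite (leq_trans (msizeZ_le _ _)) // msizeX bmdeg.
  have [u uE] := f_dvd g ga.
  have u0 : u != 0 by apply: contraNneq g0 => u0; rewrite uE u0 mulr0.
  have uk : (mdeg (mlead u) < k.+1)%N.
    by rewrite mlead_deg //; move: gk; rewrite uE msizeM // fe; move: (msize u) => su; lia.
  have := cC (inr (BMultinom uk)) => /=.
  have lg : (mdeg (mlead f + mlead u) < (k + e).+1)%N by rewrite mdegD deg_f; lia.
  rewrite (bigD1 (BMultinom lg)) //= eqxx mulr1 big1 ?addr0 => [c0|t tN]; last first.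
    have /negPf -> : (t : 'X_{1..m.+1}) != (mlead f + mlead u)%MM by move: tN; rewrite -val_eqE.
    by rewrite mulr0.
  move: (g_coef (BMultinom lg)); rewrite c0 /= uE -mleadM // => /eqP.
  by rewrite mleadc_eq0 mulf_eq0 (negPf f0) (negPf u0).
rewrite fe ltnS.
have [->|e0] := eqVneq e 0%N; first by [].
have ub k : (k0 <= k)%N ->
    (e%:R *: binom_poly m 0).[k%:R] <= (m`!%:R *: (P \Po ('X + e%:R%:P))).[k%:R].
  move=> kk; rewrite !hornerZ binom_poly_eval addn0 horner_comp hornerD hornerX hornerC.
  rewrite natrM mulrCA ler_pM2l ?ltr0n ?fact_gt0 // -natrM -natrD.
  by apply: key; apply: leq_trans kk (leq_addr _ _).
have lc_e : lead_coef (e%:R *: binom_poly m 0) = e%:R.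
  by rewrite lead_coefZ (monicP (binom_poly_monic _ _)) mulr1.
have [|_ lc] := size_le_infty _ ub; first by rewrite lc_e ltr0n lt0n.
have sXe : size ('X + e%:R%:P : {poly rat}) = 2%N by rewrite size_XaddC.
have lcXe : lead_coef ('X + e%:R%:P : {poly rat}) = 1 by rewrite lead_coefXaddC.
have fm0 : m`!%:R != 0 :> rat by rewrite pnatr_eq0 -lt0n fact_gt0.
have eq0 : e%:R != 0 :> rat by rewrite pnatr_eq0.
have := lc _; rewrite !size_scale // size_comp_poly2 // size_binom_poly sP => /(_ erefl).
rewrite lc_e lead_coefZ lead_coef_comp ?sXe // lcXe expr1n mulr1.
by have := degreeP; rewrite sP /= => <-; rewrite ler_nat.
Qed.

End HilbertFunction.

(** * Projections with small integer coefficients *)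

Section SmallProjection.

Variables (E : fieldType) (iota : {rmorphism rat -> E}).

Notation ev y g := (mmap iota y g).

Lemma finite_basis (I : finType) (v : I -> E) : exists h (b : 'I_h -> E),
  free_over iota b /\ forall i, exists c : 'I_h -> rat, v i = \sum_j iota (c j) * b j.
Proof.
pose val (c : 'rV[rat]_#|I|) := \sum_i iota (c 0 (enum_rank i)) * v i.
have val_sum h (c : 'I_h -> rat) (e : 'I_h -> 'rV_#|I|) :
    val (\sum_j c j *: e j) = \sum_j iota (c j) * val (e j).
  rewrite /val; under [RHS]eq_bigr => j _ do rewrite mulr_sumr.
  rewrite exchange_big; apply: eq_bigr => i _ /=; rewrite summxE rmorph_sum mulr_suml.
  by apply: eq_bigr => j _; rewrite mxE rmorphM mulrA.
have valB c1 c2 : val (c1 - c2) = val c1 - val c2.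
  by rewrite /val -sumrB; apply: eq_bigr => i _; rewrite !mxE rmorphB mulrBl.
have Z_lin a u w : val u = 0 -> val w = 0 -> val (a *: u + w) = 0.
  move=> u0 w0; have := val_sum 1%N (fun=> a) (fun=> u).
  rewrite !big_ord1 u0 mulr0 => au; have := valB (a *: u) (- w); rewrite opprK au => ->.
  have := valB 0 w; rewrite w0 sub0r => ->.
  by rewrite subr0 sub0r /val big1 ?oppr0 // => i _; rewrite mxE rmorph0 mul0r.
case: (greedy_basis (fun=> True) Z_lin #|I|) => [[h _ [e [_ free_e span_e]]]|[b [_ free_b]]].
  exists h, (fun j => val (e j)); split.
    by move=> c; rewrite -val_sum => /free_e.
  move=> i; have [c] := span_e (delta_mx 0 (enum_rank i)) Logic.I.
  rewrite valB val_sum => /eqP; rewrite subr_eq0 => /eqP cE.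
  exists c; rewrite -cE /val (bigD1 i) //= mxE !eqxx rmorph1 mul1r big1 ?addr0 // => j ji.
  by rewrite mxE eqxx (inj_eq enum_rank_inj) (negPf ji) rmorph0 mul0r.
have [|c [i ci] cP] := exists_left_kernel (fun (i : 'I_#|I|.+1) (j : 'I_#|I|) => b i 0 j).
  by rewrite !card_ord.
move: ci; rewrite (free_b c) ?eqxx //.
have -> : \sum_i c i *: b i = 0.
  apply/rowP => j; rewrite summxE mxE -[RHS](cP j); apply: eq_bigr => t _.
  by rewrite mxE.
by rewrite /val big1 // => j _; rewrite mxE rmorph0 mul0r.
Qed.

Lemma no_relation_free k (y : 'I_k -> E) d :
  (forall g : {mpoly rat[k]}, (msize g <= d)%N -> ev y g = 0 -> g = 0) <->
  free_over iota (fun b : 'X_{1..k < d} => mmap1 y b).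
Proof.
split=> [norel c c0 b|free_y g gd].
  pose g := \sum_(b : 'X_{1..k < d}) c b *: 'X_[b].
  have gE : g = 0.
    apply: norel; last first.
      by rewrite raddf_sum -[RHS]c0; apply: eq_bigr => i _ /=; rewrite mmapZ mmapX.
    by apply: msize_sum_leq => i _; rewrite (leq_trans (msizeZ_le _ _)) // msizeX bmdeg.
  have := congr1 (mcoeff b) gE.
  rewrite mcoeff0 raddf_sum (bigD1 b) //= mcoeffZ mcoeffX eqxx mulr1 big1 ?addr0 // => i.
  by rewrite mcoeffZ mcoeffX -val_eqE /= => /negPf ->; rewrite mulr0.
rewrite (mmapE d gd) => /free_y g0; apply/mpolyP => b; rewrite mcoeff0.
have [bd|bd] := ltnP (mdeg b) d; first by rewrite -[RHS](g0 (BMultinom bd)).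
by apply: memN_msupp_eq0; apply: msize_mdeg_ge; apply: leq_trans gd bd.
Qed.

(** The family is free for all [t] outside the zeros of a determinant. *)
Lemma free_family_specialize (I : finType) (V : I -> {poly E}) d t0 :
  (forall i, size (V i) <= d)%N -> free_over iota (fun i => (V i).[iota t0]) ->
  exists2 D : {poly rat}, D != 0 & (size D <= (#|I| * d).+1)%N /\
    forall t, ~~ root D t -> free_over iota (fun i => (V i).[iota t]).
Proof.
move=> Vd free_t0; have [h [b [free_b bP]]] := finite_basis (fun il : I * 'I_d => (V il.1)`_il.2).
have {bP} /choice[c cP] := bP.
pose C i j : {poly rat} := \poly_(l < d) (if insub l is Some l' then c (i, l') j else 0).
have VE i t : (V i).[iota t] = \sum_j iota (C i j).[t] * b j.
  rewrite (horner_coef_wide _ (Vd i)).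
  under eq_bigr => l _ do rewrite (cP (i, l)) mulr_suml.
  rewrite exchange_big; apply: eq_bigr => j _ /=.
  rewrite (@horner_coef_wide _ d) ?size_poly // rmorph_sum mulr_suml; apply: eq_bigr => l _.
  by rewrite /= coef_poly ltn_ord valK rmorphM rmorphXn mulrAC.
pose CP := \matrix_(i < #|I|, j < h) C (enum_val i) j.
pose Ct t := map_mx (horner_eval t) CP.
have free_mx t : free_over iota (fun i => (V i).[iota t]) <-> row_free (Ct t).
  split=> [free_t|free_C].
    rewrite -kermx_eq0; apply/rowV0P => u /sub_kermxP uC.
    have u0 := free_t (fun i => u 0 (enum_rank i)) _.
    apply/rowP => i; rewrite mxE -[i]enum_valK; apply: u0.
    under eq_bigr => k _ do rewrite VE mulr_sumr.
    rewrite exchange_big big1 //= => j _; under eq_bigr => k _ do rewrite mulrA -rmorphM.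
    rewrite -mulr_suml -rmorph_sum; have := congr1 (fun w : 'rV_h => w 0 j) uC.
    rewrite !mxE (reindex (@enum_rank I)) /=; last exact/onW_bij/enum_rank_bij.
    move=> uCj; rewrite (eq_bigr _ _ : _ = \sum_i u 0 (enum_rank i) * Ct t (enum_rank i) j).
      by rewrite uCj rmorph0 mul0r.
    by move=> k _; rewrite !mxE enum_rankK.
  move=> a a0 i; pose u := \row_(k < #|I|) a (enum_val k).
  have uC : u *m Ct t = 0.
    apply/rowP => j; rewrite !mxE.
    apply: (free_b (fun j => \sum_k u 0 k * Ct t k j)).
    rewrite -[RHS]a0; under [RHS]eq_bigr => k _ do rewrite VE mulr_sumr.
    rewrite exchange_big; apply: eq_bigr => j' _ /=; rewrite rmorph_sum mulr_suml.
    rewrite (reindex (@enum_rank I)) /=; last exact/onW_bij/enum_rank_bij.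
    by apply: eq_bigr => k _; rewrite !mxE enum_rankK rmorphM mulrA.
  have := row_free_inj free_C; move/(_ 1%N u 0); rewrite uC mul0mx => /(_ erefl).
  by move/rowP/(_ (enum_rank i)); rewrite !mxE enum_rankK.
have Ct0 : row_free (Ct t0) by apply/free_mx.
(* A right inverse at [t0] replaces the choice of a nonzero maximal minor: the determinant is 1 at
   [t0], and wherever it is nonzero the matrix has full row rank. *)
pose M := CP *m map_mx polyC (pinvmx (Ct t0)).
have detM t : (\det M).[t] = \det (Ct t *m pinvmx (Ct t0)).
  rewrite -[LHS]/(horner_eval t _) -det_map_mx map_mxM /= -/(Ct t); congr (\det (_ *m _)).
  by rewrite -map_mx_comp; apply/matrixP => i j; rewrite !mxE /= /horner_eval hornerC.
exists (\det M).
  by apply/eqP => /(congr1 (horner_eval t0)); rewrite /horner_eval detM mulmxVp // det1 horner0 => /eqP; rewrite oner_eq0.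
split.
  apply: leq_trans (size_sum _ _ _) _; apply/bigmax_leqP => s _.
  have -> (e : bool) (p : {poly rat}) : size ((-1) ^+ e * p) = size p.
    by rewrite mulr_sign; case: e; rewrite ?size_polyN.
  apply: leq_trans (size_prod_leq _ _) _; apply: leq_trans (leq_subr _ _) _.
  rewrite ltnS -[X in (_ <= X * _)%N]card_ord -sum_nat_const; apply: leq_sum => i _.
  rewrite mxE; apply: leq_trans (size_sum _ _ _) _; apply/bigmax_leqP => j _.
  rewrite !mxE mulrC mul_polyC; apply: leq_trans (size_scale_leq _ _) _.
  exact: size_poly.
move=> t; rewrite rootE detM => det_t; apply/free_mx.
have : Ct t *m pinvmx (Ct t0) \in unitmx by rewrite unitmxE unitfE.
rewrite -row_free_unit -!row_leq_rank => /leq_trans; apply.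
exact: mxrankM_maxl.
Qed.

(** Two values are kept because algebraic independence may still fail at one of them;
    [alg_indep_exchange] then secures the other. *)
Lemma two_nonroots (D : {poly rat}) N : D != 0 -> (size D <= N.+1)%N ->
  exists t1 t2 : nat, [/\ t1 != t2, (t1 <= N.+1)%N, (t2 <= N.+1)%N,
    ~~ root D t1%:R & ~~ root D t2%:R].
Proof.
move=> D0 sD; pose ts := seq.iota 0 N.+2; pose bad := [seq t <- ts | root D t%:R].
pose good := [seq t <- ts | ~~ root D (t : nat)%:R].
have bad_le : (size bad <= N)%N.
  rewrite -ltnS (leq_trans _ sD) // -(size_map (fun t => t%:R : rat)).
  apply: max_poly_roots => //.
    by apply/allP => _ /mapP[t + ->]; rewrite mem_filter => /andP[].
  rewrite map_inj_uniq ?filter_uniq ?iota_uniq // => i j /eqP.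
  by rewrite eqr_nat => /eqP.
have : (1 < size good)%N.
  have sz : (size bad + size good = N.+2)%N.
    by rewrite /bad /good !size_filter (count_predC (fun t => root D t%:R)) size_iota.
  by lia.
have good_uniq : uniq good by rewrite filter_uniq ?iota_uniq.
have good_mem t : t \in good -> (t <= N.+1)%N /\ ~~ root D t%:R.
  by rewrite mem_filter mem_iota add0n ltnS => /andP[].
case: good good_uniq good_mem => [|t1 [|t2 s]] //= /andP[t12 _] mem _.
have [le1 r1] := mem t1 (mem_head _ _).
have [|le2 r2] := mem t2; first by rewrite !inE eqxx orbT.
by exists t1, t2; split=> //; apply: contraNneq t12 => ->; rewrite inE eqxx.
Qed.

(** Dependence at both [t1] and [t2] would make [u + t1 z] and [u + t2 z] algebraic over the other
    coordinates, hence [z] and [u], hence [u + t0 z], against independence at [t0]. *)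
Lemma alg_indep_exchange m (y : 'I_m -> E) i (u z : E) t0 t1 t2 : t1 != t2 ->
  alg_indep iota (fun j => if j == i then u + iota t0 * z else y j) ->
  ~ alg_indep iota (fun j => if j == i then u + iota t1 * z else y j) ->
  alg_indep iota (fun j => if j == i then u + iota t2 * z else y j).
Proof.
case: m y i => [|m] y i; first by case: i.
move=> t12; pose o := y \o lift i; pose w b j := if j == i then b else y j.
(* The mutually inverse permutations [s] and [s'] move coordinate [i] to the last place, where
   [algebraic_relation] applies. *)
pose s (j : 'I_m.+1) := if unlift ord_max j is Some j' then lift i j' else i.
pose s' (j : 'I_m.+1) := if unlift i j is Some j' then lift ord_max j' else ord_max.
have sK : cancel s s'.
  move=> j; rewrite /s /s'; case: (unliftP ord_max j) => [j' ->|->].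
    by rewrite liftK.
  by rewrite unlift_none.
have s'K : cancel s' s.
  move=> j; rewrite /s /s'; case: (unliftP i j) => [j' ->|->].
    by rewrite liftK.
  by rewrite unlift_none.
have ind_ycat b : alg_indep iota (w b) <-> alg_indep iota (ycat o b).
  have wE j : w b j = ycat o b (s' j).
    rewrite /w /s' /ycat; case: (unliftP i j) => [j' ->|->].
      by rewrite eq_sym (negPf (neq_lift _ _)) liftK.
    by rewrite eqxx unlift_none.
  split=> [ind|ind]; last first.
    move=> g; rewrite (mmap_eq _ _ wE); apply: (alg_indep_inj (can_inj s'K) ind).
  move=> g; have yE j : ycat o b j = w b (s j) by rewrite wE sK.
  by rewrite (mmap_eq _ _ yE); apply: (alg_indep_inj (can_inj sK) ind).
rewrite -![alg_indep iota (fun=> _)]/(alg_indep iota (w _)) !ind_ycat => ind0 dep1.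
have ind_o : alg_indep iota o.
  move=> g; have oE j : o j = ycat o (u + iota t0 * z) (widen_ord (leqnSn m) j).
    by rewrite ycat_widen.
  rewrite (mmap_eq _ _ oE); apply: (alg_indep_inj _ ind0) => j1 j2.
  by move/(congr1 val) => /= /val_inj.
have [phi phiE] := fraction_lift ind_o.
have phi_iota c : phi (FracField.tofrac c%:MP) = iota c by rewrite phiE /= mmapC.
have alg_const c : algebraicOver phi (iota c).
  by rewrite -phi_iota; apply: algebraic_id.
have alg_rel := algebraic_relation phiE.
apply: contrapT => /alg_rel a2; move/alg_rel: dep1 => a1.
have t12' : iota (t1 - t2) != 0 by rewrite fmorph_eq0 subr_eq0.
have az : algebraicOver phi z.
  have -> : z = ((u + iota t1 * z) - (u + iota t2 * z)) / iota (t1 - t2).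
    by rewrite rmorphB in t12' *; field.
  by apply: algebraic_div => //; apply: algebraic_sub.
have au : algebraicOver phi u.
  rewrite -[u](addrK (iota t1 * z)); apply: algebraic_sub => //.
  exact: algebraic_mul.
by apply: (proj1 (alg_rel _) _ ind0); apply: algebraic_add => //; apply: algebraic_mul.
Qed.

Variables (n : nat) (x : 'I_n -> E) (m d : nat).

Definition proj (L : 'I_m.+1 * 'I_n -> rat) i := \sum_j iota (L (i, j)) * x j.

Definition good_projection L :=
  alg_indep iota (proj L \o widen_ord (leqnSn m)) /\
  forall g : {mpoly rat[m.+1]}, (msize g <= d)%N -> ev (proj L) g = 0 -> g = 0.

Definition upd (L : 'I_m.+1 * 'I_n -> rat) ij t kl := if kl == ij then t else L kl.

Lemma proj_upd L i0 j0 t i :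
  proj (upd L (i0, j0) t) i =
  if i == i0 then (proj L i0 - iota (L (i0, j0)) * x j0) + iota t * x j0 else proj L i.
Proof.
rewrite /proj /upd; case: eqP => [->|ii]; last first.
  apply: eq_bigr => j _; case: eqP => // - [ii' _].
  by rewrite ii' in ii.
rewrite (bigD1 j0) //= eqxx [in RHS](bigD1 j0) //= [iota (L _) * _ + _]addrC addrK addrC; congr (_ + _).
apply: eq_bigr => j jj0; case: eqP => // - [jj].
by rewrite jj eqxx in jj0.
Qed.

Lemma upd_id L ij : upd L ij (L ij) = L.
Proof. by apply/funext => kl; rewrite /upd; case: eqP => // ->. Qed.

(** The determinant of [free_family_specialize] has at most [N] roots, [N] being the number of
    monomials times [d]; two nonroots are found among [0, ..., N + 1]. *)
Definition height_bound := (#|{: 'X_{1..m.+1 < d}}| * d).+1.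

(** Only one coefficient [t] moves, so the absence of relations of degree [< d] holds off the zeros
    of a polynomial in [t], and algebraic independence fails for at most one value. *)
Lemma good_projection_step L ij : good_projection L ->
  exists2 t, (t <= height_bound)%N & good_projection (upd L ij t%:R).
Proof.
case: ij => i0 j0 [ind norel]; pose z := x j0; pose u := proj L i0 - iota (L (i0, j0)) * z.
pose lin i : {poly E} := if i == i0 then u%:P + z *: 'X else (proj L i)%:P.
have linE i t : (lin i).[iota t] = proj (upd L (i0, j0) t) i.
  rewrite proj_upd /lin; case: eqP => _; last by rewrite hornerC.
  by rewrite hornerD hornerC hornerZ hornerX [z * _]mulrC.
pose V (b : 'X_{1..m.+1 < d}) : {poly E} := mmap1 lin b.
have VE b t : (V b).[iota t] = mmap1 (proj (upd L (i0, j0) t)) b.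
  by rewrite horner_prod; apply: eq_bigr => i _; rewrite horner_exp linE.
have sV b : (size (V b) <= d)%N.
  apply: leq_trans (bmdeg b); rewrite mdegE.
  have lin2 i : (size (lin i) <= 2)%N.
    rewrite /lin; case: eqP => _; last by rewrite (leq_trans (size_polyC_leq1 _)).
    apply: leq_trans (size_polyD _ _) _; rewrite geq_max (leq_trans (size_polyC_leq1 _)) //=.
    by rewrite (leq_trans (size_scale_leq _ _)) // size_polyX.
  apply: (big_ind2 (fun (p : {poly E}) k => size p <= k.+1)%N) => [|p k q l pk ql|i _].
  - by rewrite size_poly1.
  - by apply: leq_trans (size_polyMleq _ _) _; lia.
  apply: leq_trans (size_poly_exp_leq _ _) _; rewrite ltnS.
  rewrite -[X in (_ <= X)%N]mul1n leq_mul2r; apply/orP; right.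
  by case: (size _) (lin2 i) => [|[|[|]]].
have V_id (b : 'X_{1..m.+1 < d}) : (V b).[iota (L (i0, j0))] = mmap1 (proj L) b.
  by rewrite VE upd_id.
have [|D D0 [sD Dfree]] := free_family_specialize (t0 := L (i0, j0)) sV.
  have := proj1 (no_relation_free _ _) norel.
  by congr free_over; apply/funext => b; rewrite V_id.
have [t1 [t2 [t12 le1 le2 r1 r2]]] := two_nonroots D0 sD.
have norel_t (t : nat) : ~~ root D t%:R -> forall g : {mpoly rat[m.+1]}, (msize g <= d)%N ->
    ev (proj (upd L (i0, j0) t%:R)) g = 0 -> g = 0.
  move=> rt; apply/no_relation_free; have := Dfree _ rt.
  by congr free_over; apply/funext => b; rewrite VE.
have indE t : proj (upd L (i0, j0) t) \o widen_ord (leqnSn m) =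
    fun j => if widen_ord (leqnSn m) j == i0 then u + iota t * z
             else proj L (widen_ord (leqnSn m) j).
  by apply/funext => j; rewrite /= proj_upd.
have [ind1|dep1] := pselect (alg_indep iota (proj (upd L (i0, j0) t1%:R) \o widen_ord (leqnSn m))).
  by exists t1 => //; split=> //; apply: norel_t.
exists t2 => //; split; last exact: norel_t.
(* The last form does not enter the independence condition, so the exchange argument concerns the
   other rows only. *)
rewrite indE; rewrite indE in dep1; case: (ord_max_or_widen i0) => [i0E|[i1 i0E]].
  case: dep1 => g; have yE (j : 'I_m) : (if widen_ord (leqnSn m) j == i0 then u + iota t1%:R * z
             else proj L (widen_ord (leqnSn m) j)) = (proj L \o widen_ord (leqnSn m)) j.
    by rewrite i0E -val_eqE /= ltn_eqF.
  by rewrite (mmap_eq _ _ yE); apply: ind.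
have eqE (j : 'I_m) : (widen_ord (leqnSn m) j == i0) = (j == i1) by rewrite i0E -!val_eqE.
have congrE t : (fun j => if widen_ord (leqnSn m) j == i0 then u + iota t * z
      else proj L (widen_ord (leqnSn m) j)) =
    (fun j => if j == i1 then u + iota t * z else proj L (widen_ord (leqnSn m) j)).
  by apply/funext => j; rewrite eqE.
rewrite congrE; rewrite congrE in dep1.
have := @alg_indep_exchange m (fun j => proj L (widen_ord (leqnSn m) j)) i1 u z (L (i0, j0)) t1%:R t2%:R.
apply=> //.
  by rewrite eqr_nat.
by rewrite -congrE -indE upd_id.
Qed.

Lemma good_projection_small L : good_projection L ->
  exists2 N : 'I_m.+1 * 'I_n -> nat, forall ij, (N ij <= height_bound)%N &
    good_projection (fun ij => (N ij)%:R).
Proof.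
move=> gL; suff fin (s : seq ('I_m.+1 * 'I_n)) : exists2 L', good_projection L' &
    forall ij, ij \in s -> exists2 t, (t <= height_bound)%N & L' ij = t%:R.
  have [L' gL' /= small] := fin (enum {: 'I_m.+1 * 'I_n}).
  have /choice[N NP] ij : exists t, (t <= height_bound)%N /\ L' ij = t%:R.
    by have [|t] := small ij; [rewrite mem_enum|exists t].
  exists N => [ij|]; first by case: (NP ij).
  by have -> : (fun ij => (N ij)%:R) = L' by apply/funext => ij; rewrite (NP ij).2.
elim: s => [|ij s [L' gL' small]]; first by exists L.
have [t tb gt] := good_projection_step ij gL'.
exists (upd L' ij t%:R) => // kl; rewrite /upd inE; case: eqP => [_ _|_ /small//].
by exists t.
Qed.

End SmallProjection.

(** * Irreducible varieties *)

Section IdealTools.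

Variables (R : comNzRingType) (X : {pred R}).
Hypothesis X_ideal : idealr_closed X.

Lemma ideal_lin a u v : u \in X -> v \in X -> a * u + v \in X.
Proof. by case: X_ideal => _ _ H; apply: H. Qed.

Lemma idealD u v : u \in X -> v \in X -> u + v \in X.
Proof. by move=> uX vX; rewrite -[u]mul1r; apply: ideal_lin. Qed.

Lemma idealM a u : u \in X -> a * u \in X.
Proof. by move=> uX; rewrite -[a * u]addr0; apply: ideal_lin => //; case: X_ideal. Qed.

Lemma ideal0 : 0 \in X.
Proof. by case: X_ideal. Qed.

Variable f : R.

Let J h := exists u, h - u * f \in X.

Let JD a b : J a -> J b -> J (a + b).
Proof.
move=> [u uX] [v vX]; exists (u + v).
by rewrite mulrDl opprD addrACA; apply: idealD.
Qed.

Let JM a b : J b -> J (a * b).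
Proof. by move=> [u uX]; exists (a * u); rewrite -mulrA -mulrBr; apply: idealM. Qed.

(** The radical of the ideal generated by [X] and [f]. *)
Definition radical_with : {pred R} := fun h => `[< exists a, J (h ^+ a) >].

Lemma radical_withP h : reflect (exists a u, h ^+ a - u * f \in X) (h \in radical_with).
Proof. exact: asboolP. Qed.

Lemma radical_with_sub h : h \in X -> h \in radical_with.
Proof. by move=> hX; apply/radical_withP; exists 1, 0; rewrite expr1 mul0r subr0. Qed.

Lemma radical_with_self : f \in radical_with.
Proof. by apply/radical_withP; exists 1, 1; rewrite expr1 mul1r subrr ideal0. Qed.

Lemma radical_with_ideal : 1 \notin radical_with -> idealr_closed radical_with.
Proof.
split=> //; first by apply: radical_with_sub; apply: ideal0.
move=> c u v /asboolP[a Ja] /asboolP[b Jb]; apply/asboolP; exists (a + b)%N.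
rewrite exprDn; apply: (big_ind J) => [||i _]; first by exists 0; rewrite mul0r subr0 ideal0.
  exact: JD.
rewrite -mulr_natl; apply: JM.
have [bi|ib] := leqP b i.
  by rewrite -(subnK bi) exprD mulrA; apply: JM.
have ai : (a <= a + b - i)%N by lia.
by rewrite mulrC -(subnK ai) exprD mulrA [(c * u) ^+ a]exprMn mulrA; apply: JM.
Qed.

End IdealTools.

(** If [f * g] lies in the ideal, [X] is the union of its intersections with the zero sets of [f]
    and of [g]. *)
Lemma irreducible_prime_ideal n (X : {pred {mpoly rat[n]}}) :
  irreducible_variety X -> prime_idealr_closed X.
Proof.
move=> [[X_ideal X_rad] X_irr] f g fgX; apply/orP.
have [fX|fX] := boolP (f \in X); [by left|right].
apply: contraT => gX.
(* Varieties are given by proper ideals, so 1 has to be excluded from both radicals: otherwise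
   [1 - u * p] would lie in [X], and with [p * q] also [q]. *)
have one_notin (p q : {mpoly rat[n]}) : p * q \in X -> q \notin X -> 1 \notin radical_with X p.
  move=> pqX /negP qX; apply/negP => /radical_withP[a [u]]; rewrite expr1n => uX; apply: qX.
  have -> : q = q * (1 - u * p) + u * (p * q) by ring.
  by apply: (idealD X_ideal); apply: (idealM X_ideal).
have rad_var (p q : {mpoly rat[n]}) : p * q \in X -> q \notin X -> variety (radical_with X p).
  move=> pqX qX; split; first exact: (radical_with_ideal X_ideal (one_notin _ _ pqX qX)).
  move=> h k /radical_withP[a [u uX]]; apply/radical_withP; exists (k * a)%N, u.
  by rewrite exprM.
have gfX : g * f \in X by rewrite mulrC.
have is_un : is_union X (radical_with X f) (radical_with X g).
  move=> h; apply/idP/andP => [hX|[/radical_withP[a [u uX]] /radical_withP[b [v vX]]]].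
    by split; apply: radical_with_sub.
  apply: (X_rad h (a + b)%N); rewrite exprD.
  have -> : h ^+ a * h ^+ b = h ^+ b * (h ^+ a - u * f) + ((u * f) * (h ^+ b - v * g) + u * v * (f * g)) by ring.
  by apply: (idealD X_ideal); [|apply: (idealD X_ideal)]; apply: (idealM X_ideal).
case: (X_irr _ _ (rad_var _ _ fgX gX) (rad_var _ _ gfX fX) is_un) => XE.
  by have := radical_with_self X_ideal f; rewrite XE (negPf fX).
by have := radical_with_self X_ideal g; rewrite XE (negPf gX).
Qed.

Section Homogenization.

Variable n : nat.

Lemma msize_dehomogenize (F : {mpoly rat[n.+1]}) : (msize (dehomogenize F) <= msize F)%N.
Proof.
apply: msize_comp_linear => i; rewrite tnth_mktuple.
by case: unlift => [j|]; rewrite ?msizeX ?mdeg1 ?msize1.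
Qed.

Lemma homogenize (g : {mpoly rat[n]}) k : (msize g <= k.+1)%N ->
  exists F : dhomog n.+1 rat k, dehomogenize F = g.
Proof.
move=> gk; pose hom (m : 'X_{1..n}) :=
  [multinom (if unlift ord0 i is Some j then m j else k - mdeg m)%N | i < n.+1].
have hom_deg m : (mdeg m <= k)%N -> mdeg (hom m) = k.
  move=> mk; rewrite mdegE big_ord_recl mnmE unlift_none.
  under eq_bigr => i _ do rewrite mnmE liftK.
  by rewrite -mdegE subnK.
pose F := \sum_(m <- msupp g) g@_m *: 'X_[hom m].
have F_hom : F \is k.-homog.
  rewrite /F big_seq; apply: rpred_sum => m mg; apply: rpredZ; rewrite dhomogX; apply/eqP/hom_deg.
  by rewrite -ltnS; apply: leq_trans (msize_mdeg_lt mg) gk.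
exists (DHomog F_hom); rewrite /dehomogenize /= raddf_sum [RHS]mpolyE.
apply: eq_bigr => m _; rewrite /= comp_mpolyZ comp_mpolyX; congr (_ *: _).
rewrite big_ord_recl tnth_mktuple unlift_none expr1n mul1r mpolyXE_id.
by apply: eq_bigr => i _; rewrite tnth_mktuple liftK mnmE liftK.
Qed.

End Homogenization.

Definition lin_forms m n (L : 'I_m * 'I_n -> nat) : m.-tuple {mpoly rat[n]} :=
  [tuple \sum_j (L (i, j))%:R *: 'X_j | i < m].

(** The projection of [generic_projection] only shows that good projections exist: since [d <= r],
    it has no relation of degree [< d]. Small integers come from specialization, and a relation of
    degree at most [d] exists for every projection whose first [m] forms are independent. *)
Theorem projection_exists n (X : {pred {mpoly rat[n]}}) d :
  irreducible_variety X -> has_degree X d -> (0 < d)%N ->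
  exists m, (m <= n)%N /\ exists L : 'I_m.+1 * 'I_n -> nat,
    [/\ forall ij, (L ij <= height_bound m d)%N,
        forall g : {mpoly rat[m.+1]}, g != 0 -> (msize g <= d)%N -> g \mPo lin_forms L \notin X &
        exists f : {mpoly rat[m.+1]},
          [/\ f != 0, (msize f <= d.+1)%N & f \mPo lin_forms L \in X]].
Proof.
move=> X_irr [P [k0 hilbert] degreeP] d_gt0.
have X_prime := irreducible_prime_ideal X_irr.
have X_ideal : idealr_closed X by case: X_irr => [[]].
have [E [f fP]] := prime_ideal_field X_ideal X_prime.
pose iota : {rmorphism rat -> E} := f \o @mpolyC n rat.
pose x i := f 'X_i.
have fE g : f g = mmap iota x g.
  apply: (@mpoly_rmorph_ext _ _ _ f (mmap iota x)) => [c|i].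
    by rewrite /= mmapC.
  by rewrite /= mmapXU.
have fX g : (mmap iota x g == 0) = (g \in X) by rewrite -fE fP.
(* Forms of degree [k] dehomogenize onto all polynomials of degree at most [k], so a basis of a
   complement of the ideal part gives a basis of their values at the generic point. *)
have hilb k : (k0 <= k)%N -> exists h (b : 'I_h -> E),
  [/\ P.[k%:R] = h%:R, free_over iota b, forall i, poly_values iota x k (b i) &
      forall v, poly_values iota x k v -> exists c : 'I_h -> rat, v = \sum_i iota (c i) * b i].
  move=> /hilbert[U UP PE]; exists (\dim (U^C)), (fun i => f (dehomogenize (vbasis (U^C))`_i)).
  have f_sum h (c : 'I_h -> rat) (e : 'I_h -> dhomog n.+1 rat k) :
      f (dehomogenize (\sum_i c i *: e i)%R) = \sum_i iota (c i) * f (dehomogenize (e i)).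
    pose g (F : dhomog n.+1 rat k) := f (dehomogenize F).
    have gD (p q : dhomog n.+1 rat k) : g (p + q) = g p + g q.
      by rewrite /g /dehomogenize comp_mpolyD rmorphD.
    have g0 : g 0 = 0 by rewrite /g /dehomogenize comp_mpoly0 rmorph0.
    rewrite -/(g _) (big_morph g gD g0); apply: eq_bigr => i _.
    by rewrite /g /dehomogenize /= comp_mpolyZ -mul_mpolyC rmorphM.
  split.
  - by rewrite PE dimv_compl.
  - move=> c; rewrite -f_sum => /eqP; rewrite fP -UP => cU i.
    have cUC : \sum_i c i *: (vbasis (U^C))`_i \in (U^C)%VS.
      by apply: memv_suml => j _; apply: memvZ; apply: vbasis_mem; rewrite mem_nth ?size_tuple.
    have : \sum_i c i *: (vbasis (U^C))`_i \in (U :&: U^C)%VS by rewrite memv_cap cU.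
    rewrite capv_compl memv0 => /eqP c0.
    by have /freeP free_b := basis_free (vbasisP (U^C)); apply: free_b c0 i.
  - move=> i; exists (dehomogenize (vbasis (U^C))`_i); last by rewrite fE.
    apply: leq_trans (msize_dehomogenize _) _.
    have F_hom := dhomog_is_dhomog (vbasis (U^C))`_i.
    by rewrite msizeE; apply/bigmax_leqP_seq => t tF _; rewrite ltnS (dhomog_mf F_hom tF).
  - move=> v [g gk ->]; have [F FE] := homogenize gk.
    have : F \in (U + U^C)%VS by rewrite addv_complf memvf.
    case/memv_addP => F1 F1U [F2 F2U FE2].
    have /coord_vbasis F2E := F2U.
    exists (fun i => coord (vbasis (U^C)) i F2); rewrite -f_sum -F2E -fE -FE FE2.
    rewrite /dehomogenize /= comp_mpolyD rmorphD.
    by move: F1U; rewrite UP -fP => /eqP ->; rewrite add0r.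
have [m [r [mn [y [a [ind y_lin a_lin norel span]]]]]] := generic_projection iota x.
have [_ dr] := degree_projection hilb degreeP d_gt0 ind y_lin span.
have /choice[L0 L0P] (i : 'I_m.+1) : exists l : 'I_n -> rat, ycat y a i = \sum_j iota (l j) * x j.
  by rewrite /ycat; case: unlift.
have projE i : proj iota x (fun ij => L0 ij.1 ij.2) i = ycat y a i by rewrite L0P.
have good : good_projection iota x d (fun ij : 'I_m.+1 * 'I_n => L0 ij.1 ij.2).
  split.
    move=> g; have yE i : (proj iota x (fun ij => L0 ij.1 ij.2) \o widen_ord (leqnSn m)) i = y i.
      by rewrite /= projE ycat_widen.
    by rewrite (mmap_eq _ _ yE); apply: ind.
  move=> g gd; rewrite (mmap_eq _ _ projE); apply: norel.
  exact: leq_trans gd dr.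
have [L L_small [L_ind L_norel]] := good_projection_small good.
exists m; split=> //; exists L; split=> //.
  move=> g g0 gd; rewrite -fX; apply: contra g0 => /eqP gX; apply/eqP.
  apply: L_norel gd _; rewrite mmap_comp in gX; rewrite -[RHS]gX; apply: mmap_eq => i.
  rewrite tnth_mktuple raddf_sum; apply: eq_bigr => j _ /=.
  by rewrite mmapZ mmapXU.
pose Lq (ij : 'I_m.+1 * 'I_n) : rat := (L ij)%:R.
have lin i : lin_comb iota x (proj iota x Lq i) by exists (fun j => Lq (i, j)).
have [sP _] := degree_projection hilb degreeP d_gt0 ind y_lin span.
have [g [g0 gd ga]] := hilbert_relation hilb degreeP d_gt0 L_ind
  (fun i => lin (widen_ord (leqnSn m) i)) (lin ord_max) sP.
exists g; split=> //; rewrite -fX mmap_comp; apply/eqP; rewrite -[RHS]ga.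
apply: mmap_eq => i; rewrite tnth_mktuple raddf_sum /=.
have -> : ycat (proj iota x Lq \o widen_ord (leqnSn m)) (proj iota x Lq ord_max) i = proj iota x Lq i.
  by case: (ord_max_or_widen i) => [->|[j ->]]; rewrite ?ycat_max ?ycat_widen.
by apply: eq_bigr => j _; rewrite mmapZ mmapXU.
Qed.

(** * Pigeonhole principle *)

Lemma pigeonhole (T J : finType) (N : J -> nat) (phi : J -> T -> nat) :
  (forall j t, phi j t < N j)%N -> (\prod_j N j < #|T|)%N ->
  exists t1 t2, t1 != t2 /\ forall j, phi j t1 = phi j t2.
Proof.
move=> phiN ltT; pose f t : {dffun forall j, 'I_(N j)} := [ffun j => Ordinal (phiN j t)].
have /injectivePn[t1 [t2 t12 f12]] : ~~ injectiveb f.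
  apply/injectiveP => f_inj; move: ltT; rewrite ltnNge -(card_codom f_inj).
  rewrite (leq_trans (max_card _)) // card_dep_ffun foldrE big_map -big_enum /=.
  by apply: eq_leq; apply: eq_bigr => j _; rewrite card_ord.
exists t1, t2; split=> // j.
by have := congr1 (fun g : {dffun forall j, 'I_(N j)} => val (g j)) f12; rewrite !ffunE.
Qed.

(** Siegel's lemma, for vanishing on the box [|y_i| <= b] modulo conditions that
    force divisibility by [q]. *)
Lemma siegel k d (b A q : nat) (T : ('I_k -> int) -> Prop) (J : finType) (N : J -> nat)
    (phi : J -> {mpoly int[k]} -> nat) :
  (forall y, T y -> forall i, `|y i| <= b)%N -> (0 < b)%N ->
  (forall j g, phi j g < N j)%N ->
  (forall g1 g2 : {mpoly int[k]}, (forall j, phi j g1 = phi j g2) ->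
     forall y, T y -> (q %| (g1 - g2).@[y])%Z) ->
  (\prod_j N j < A.+1 ^ #|{: 'X_{1..k < d}}|)%N ->
  (#|{: 'X_{1..k < d}}| * A * b ^ d.-1 < q)%N ->
  exists2 g : {mpoly int[k]}, g != 0 & (msize g <= d)%N /\ forall y, T y -> g.@[y] = 0.
Proof.
move=> Tb b0 phiN phi_q ltN ltq; pose I : finType := 'X_{1..k < d}.
pose pol (c : {ffun I -> 'I_A.+1}) : {mpoly int[k]} := \sum_(m : I) (c m : nat)%:Z *: 'X_[m].
have [|c1 [c2 [c12 eq_phi]]] := pigeonhole (T := {ffun I -> 'I_A.+1})
    (phi := fun j c => phi j (pol c)) (fun j c => phiN j (pol c)).
  by rewrite card_ffun card_ord.
pose g := pol c1 - pol c2.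
have gE : g = \sum_(m : I) ((c1 m : nat)%:Z - (c2 m : nat)%:Z) *: 'X_[m].
  by rewrite /g /pol -sumrB; apply: eq_bigr => m _; rewrite scalerBl.
have g_coef (m : I) : g@_m = (c1 m : nat)%:Z - (c2 m : nat)%:Z.
  rewrite gE raddf_sum (bigD1 m) //= mcoeffZ mcoeffX eqxx mulr1 big1 ?addr0 // => i.
  by rewrite mcoeffZ mcoeffX -val_eqE /= => /negPf ->; rewrite mulr0.
exists g.
  apply: contraNneq c12 => g0; apply/eqP/ffunP => m; apply/val_inj; apply/eqP.
  have := g_coef m; rewrite g0 mcoeff0 => /esym/eqP.
  by rewrite subr_eq0 eqz_nat.
split.
  by rewrite gE; apply: msize_sum_leq => m _; rewrite (leq_trans (msizeZ_le _ _)) // msizeX bmdeg.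
move=> y Ty; have qg := phi_q _ _ eq_phi y Ty; rewrite -/g in qg.
have gy : (`|g.@[y]| <= (#|I| * A * b ^ d.-1)%:Z)%R.
  rewrite gE raddf_sum; apply: le_trans (ler_norm_sum _ _ _) _.
  have -> : (#|I| * A * b ^ d.-1)%:Z = \sum_(m : I) (A * b ^ d.-1)%:Z.
    by rewrite sumr_const -mulnA PoszM -mulr_natl natz.
  apply: ler_sum => m _ /=.
  rewrite mevalZ normrM PoszM; apply: ler_pM => //.
    move: (ltn_ord (c1 m)) (ltn_ord (c2 m)).
    by move: (nat_of_ord (c1 m)) (nat_of_ord (c2 m)) => u v; rewrite ler_norml; lia.
  rewrite mevalX normr_prod; apply: (@le_trans _ _ (\prod_(i < k) b%:Z ^+ m i)).
    apply: ler_prod => i _; rewrite normr_ge0 /= normrX lerXn2r ?nnegrE //.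
    by rewrite -abszE lez_nat; apply: Tb.
  rewrite -expr_sum -mdegE; have -> : b%:Z ^+ mdeg m = (b ^ mdeg m)%:Z by rewrite -!natz natrX.
  rewrite lez_nat leq_pexp2l //.
  by have := bmdeg m; lia.
have : (`|g.@[y]| < q)%N by rewrite -ltz_nat abszE; apply: le_lt_trans gy _; rewrite ltz_nat.
move: qg; rewrite dvdzE /= => q_dvd lt_q; apply/eqP; rewrite -absz_eq0.
by apply: contraTT q_dvd => g0; rewrite gtnNdvd // lt0n.
Qed.

(** * Orders of vanishing *)

Section Vanishing.

Variables (R : idomainType) (k : nat).
Implicit Types (P : 'I_k -> R) (g w : {mpoly R[k]}).

Definition shift P g : {mpoly R[k]} := g \mPo [tuple 'X_i + (P i)%:MP | i < k].

Lemma shiftK P g : shift (fun i => - P i) (shift P g) = g.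
Proof.
pose F : {rmorphism {mpoly R[k]} -> {mpoly R[k]}} :=
  comp_mpoly [tuple 'X_i + (- P i)%:MP | i < k] \o comp_mpoly [tuple 'X_i + (P i)%:MP | i < k].
pose G : {rmorphism {mpoly R[k]} -> {mpoly R[k]}} := idfun.
apply: (@mpoly_rmorph_ext _ _ _ F G) => [c|i]; rewrite /F /G /=.
  by rewrite !comp_mpolyC.
rewrite comp_mpolyXU -tnth_nth tnth_mktuple comp_mpolyD comp_mpolyXU -tnth_nth tnth_mktuple.
by rewrite comp_mpolyC mpolyCN subrK.
Qed.

Lemma shiftKV P g : shift P (shift (fun i => - P i) g) = g.
Proof.
rewrite -[RHS](shiftK (fun i => - P i)); congr comp_mpoly.
by apply: eq_from_tnth => i; rewrite !tnth_mktuple opprK.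
Qed.

Lemma shift_eval P g (y : 'I_k -> R) : (shift P g).@[y] = g.@[fun i => y i + P i].
Proof.
rewrite comp_mpoly_meval; apply: meval_eq => i.
by rewrite tnth_mktuple mevalD mevalXU mevalC.
Qed.

Lemma shift_coef0 P g : (shift P g)@_0%MM = g.@[P].
Proof.
pose F : {rmorphism {mpoly R[k]} -> R} :=
  mcoeff 0%MM \o comp_mpoly [tuple 'X_i + (P i)%:MP | i < k].
pose G : {rmorphism {mpoly R[k]} -> R} := meval P.
apply: (@mpoly_rmorph_ext _ _ _ F G) => [c|i]; rewrite /F /G /=.
  by rewrite comp_mpolyC mevalC mcoeffC eqxx mulr1.
rewrite comp_mpolyXU -tnth_nth tnth_mktuple mcoeffD mcoeffX mcoeffC eqxx mulr1 mevalXU.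
by rewrite mnm1_eq0 add0r.
Qed.

Lemma msize_shift P g : (msize (shift P g) <= msize g)%N.
Proof.
apply: msize_comp_linear => i; rewrite tnth_mktuple.
apply: leq_trans (msizeD_le _ _) _; rewrite geq_max msizeX mdeg1 /=.
by rewrite msizeC; case: (_ != 0).
Qed.

(** Membership in the [j]-th power of the maximal ideal of [P], read off the Taylor coefficients at
    [P]. *)
Definition vanishes j P g := forall m, (mdeg m < j)%N -> (shift P g)@_m = 0.

Lemma vanishesD j P g1 g2 : vanishes j P g1 -> vanishes j P g2 -> vanishes j P (g1 + g2).
Proof. by move=> v1 v2 m mj; rewrite /shift comp_mpolyD mcoeffD v1 ?v2 ?addr0. Qed.

Lemma vanishes0 j P : vanishes j P 0.
Proof. by move=> m _; rewrite /shift comp_mpoly0 mcoeff0. Qed.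

Lemma vanishesM a b P g1 g2 : vanishes a P g1 -> vanishes b P g2 -> vanishes (a + b) P (g1 * g2).
Proof.
move=> v1 v2 m mab; rewrite /shift rmorphM -/(shift P g1) -/(shift P g2).
apply: memN_msupp_eq0; apply/negP => /msuppM_le/allpairsP[[m1 m2] /= [m1s m2s mE]].
have a1 : (a <= mdeg m1)%N.
  by rewrite leqNgt; apply: contraTN m1s => /v1; rewrite mcoeff_msupp => ->; rewrite eqxx.
have b2 : (b <= mdeg m2)%N.
  by rewrite leqNgt; apply: contraTN m2s => /v2; rewrite mcoeff_msupp => ->; rewrite eqxx.
by move: mab; rewrite mE mdegD ltnNge leq_add.
Qed.

Lemma vanishes_mull j P g1 g2 : vanishes j P g2 -> vanishes j P (g1 * g2).
Proof. by move=> v2; rewrite -[j]add0n; apply: vanishesM => // m; rewrite ltn0. Qed.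

Lemma vanishesN j P g : vanishes j P g -> vanishes j P (- g).
Proof. by rewrite -mulN1r; apply: vanishes_mull. Qed.

Lemma vanishesX j P g : vanishes 1 P g -> vanishes j P (g ^+ j).
Proof.
move=> v1; elim: j => [|j IH]; first by move=> m; rewrite ltn0.
by rewrite exprS -add1n; apply: vanishesM.
Qed.

Lemma vanishes_root P g : g.@[P] = 0 -> vanishes 1 P g.
Proof.
by move=> gP m; rewrite ltnS leqn0 mdeg_eq0 => /eqP ->; rewrite shift_coef0.
Qed.

Lemma vanishes_sum j P (I : Type) (r : seq I) (Q : pred I) (F : I -> {mpoly R[k]}) :
  (forall i, Q i -> vanishes j P (F i)) -> vanishes j P (\sum_(i <- r | Q i) F i).
Proof.
move=> FQ; apply: (big_ind (vanishes j P)); [exact: vanishes0|exact: vanishesD|exact: FQ].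
Qed.

Lemma jet_truncate j P g : exists2 g', (msize g' <= j)%N & vanishes j P (g - g').
Proof.
pose w := shift P g; pose t := \sum_(m : 'X_{1..k < j}) w@_m *: 'X_[m].
exists (shift (fun i => - P i) t).
  apply: leq_trans (msize_shift _ _) _; apply: msize_sum_leq => m _.
  by rewrite (leq_trans (msizeZ_le _ _)) // msizeX bmdeg.
move=> m mj; rewrite /shift comp_mpolyB -/(shift P g) -/(shift P _) shiftKV mcoeffB -/w.
rewrite [t@_m]raddf_sum (bigD1 (BMultinom mj)) //= mcoeffZ mcoeffX eqxx mulr1 big1 ?addr0 ?subrr // => i.
by rewrite mcoeffZ mcoeffX -val_eqE /= => /negPf ->; rewrite mulr0.
Qed.

End Vanishing.

(** * Hermite interpolation over a finite field *)

Section Hermite.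

Variables (F : finFieldType) (k : nat) (f : {mpoly F[k]}) (e j : nat).
Hypothesis f0 : f != 0.
Hypothesis fe : msize f = e.+1.
Hypotheses (k0 : (0 < k)%N) (j0 : (0 < j)%N).

Definition local_ideal (P : 'I_k -> F) g :=
  exists u v, [/\ g = f * u + v & vanishes j P v].

Lemma local_ideal_lin P a u v : local_ideal P u -> local_ideal P v -> local_ideal P (a *: u + v).
Proof.
move=> [u1 [v1 [-> V1]]] [u2 [v2 [-> V2]]].
exists (a *: u1 + u2), (a *: v1 + v2); split.
  by rewrite scalerDr addrACA mulrDr scalerAr.
by apply: vanishesD => //; rewrite -mul_mpolyC; apply: vanishes_mull.
Qed.

(** Since nonzero elements have [(#|F| - 1)]-th power 1, this is 1 at [P] and 0 at all other points;
    its degree is the cost of interpolation per order of vanishing. *)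
Definition indicator (P : 'I_k -> F) : {mpoly F[k]} :=
  \prod_i (1 - ('X_i - (P i)%:MP) ^+ #|F|.-1).

Lemma card_F_gt1 : (1 < #|F|)%N. Proof. exact: finNzRing_gt1. Qed.

Lemma indicator_eval P Q : (indicator P).@[Q] = \prod_i (1 - (Q i - P i) ^+ #|F|.-1).
Proof.
rewrite rmorph_prod; apply: eq_bigr => i _.
by rewrite /= rmorphB rmorph1 rmorphXn rmorphB /= mevalXU mevalC.
Qed.

Lemma indicator_self P : (indicator P).@[P] = 1.
Proof.
rewrite indicator_eval big1 // => i _; rewrite subrr expr0n.
by have := card_F_gt1; case: #|F| => [|[|c]] //= _; rewrite subr0.
Qed.

Lemma indicator_other P Q i : P i != Q i -> (indicator P).@[Q] = 0.
Proof.
move=> PQ; rewrite indicator_eval (bigD1 i) //=.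
have d0 : Q i - P i != 0 by rewrite subr_eq0 eq_sym.
suff -> : (Q i - P i) ^+ #|F|.-1 = 1 by rewrite subrr mul0r.
apply: (mulfI d0); rewrite -exprS prednK ?expf_card ?mulr1 //.
exact: ltnW card_F_gt1.
Qed.

Lemma msize_indicator P : (msize (indicator P) <= (k * #|F|.-1).+1)%N.
Proof.
rewrite -[X in (_ <= (X * _).+1)%N]card_ord -sum_nat_const; apply: msize_prod_leq => i.
apply: leq_trans (msizeD_le _ _) _; rewrite msize1 msizeN geq_max ltnS /=.
rewrite -[X in (_ <= X.+1)%N]muln1; apply: msizeX_leq.
apply: leq_trans (msizeD_le _ _) _; rewrite msizeN geq_max msizeX mdeg1 /=.
by rewrite msizeC; case: (_ != 0).
Qed.

(** Hermite interpolation: the jets of order [< j] at distinct points are independent. *)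
Theorem high_points_bound (H : finType) (pt : H -> 'I_k -> F) h D :
  injective pt ->
  (forall P, exists b : 'I_h -> {mpoly F[k]}, free_mod (local_ideal (pt P)) b) ->
  (e <= D)%N -> (k * #|F| * j <= D)%N ->
  (#|H| * h + 'C(k + (D - e), k) <= 'C(k + D, k))%N.
Proof.
move=> pt_inj high eD jD.
(* Truncation to degree [< j] is harmless: the discarded tails lie in the local ideal. *)
have /choice[b bP] (P : H) : exists b : 'I_h -> {mpoly F[k]},
    (forall i, msize (b i) <= j)%N /\ free_mod (local_ideal (pt P)) b.
  have [b free_b] := high P.
  have /choice[t tP] i : exists t, (msize t <= j)%N /\ vanishes j (pt P) (b i - t).
    by have [t ? ?] := jet_truncate j (pt P) (b i); exists t.
  exists t; split=> [i|c cZ]; first by case: (tP i).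
  apply: free_b; have -> : \sum_i c i *: b i = 1 *: (\sum_i c i *: t i) + \sum_i c i *: (b i - t i).
    by rewrite scale1r -big_split; apply: eq_bigr => i _ /=; rewrite -scalerDr addrC subrK.
  apply: local_ideal_lin => //; exists 0, (\sum_i c i *: (b i - t i)); split.
    by rewrite mulr0 add0r.
  by apply: vanishes_sum => i _; rewrite -mul_mpolyC; apply: vanishes_mull; case: (tP i).
pose U P := indicator (pt P) ^+ j.
(* Jets at the points of [H], cut off elsewhere by powers of the indicators, and the multiples of
   [f] turn out independent among polynomials of degree at most [D]. *)
pose I : finType := ((H * 'I_h) + 'X_{1..k < (D - e).+1})%type.
pose J : finType := 'X_{1..k < D.+1}.
pose w (i : I) : {mpoly F[k]} := match i with
  | inl Pi => U Pi.1 * b Pi.1 Pi.2 | inr m => f * 'X_[m] end.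
have w_size i : (msize (w i) <= D.+1)%N.
  case: i => [[P i]|m] /=.
    have [b_size _] := bP P.
    have bj : (msize (b P i) <= j.-1.+1)%N by rewrite prednK.
    have Uj := msizeX_leq j (msize_indicator (pt P)).
    (* With [q = #|F|] the degrees add up to [j * k * (q - 1) + (j - 1)], at most [k * q * j]
       because [k > 0]. *)
    apply: leq_trans (msizeM_leq Uj bj) _; rewrite ltnS.
    apply: leq_trans jD; have := card_F_gt1; move: k0 j0; clear.
    by case: k j #|F| => [|k'] [|j'] [|q] //= _ _ _; nia.
  have mD : (msize ('X_[m] : {mpoly F[k]}) <= (D - e).+1)%N by rewrite msizeX bmdeg.
  have fe' : (msize f <= e.+1)%N by rewrite fe.
  by apply: leq_trans (msizeM_leq fe' mD) _; rewrite subnKC.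
have -> : (#|H| * h + 'C(k + (D - e), k) = #|I|)%N.
  by rewrite card_sum card_prod card_ord card_bmnm.
rewrite -card_bmnm leqNgt; apply/negP => /(exists_left_kernel (fun (i : I) (m : J) => (w i)@_m)).
move=> [c [i0 ci0] cP].
have sum0 : \sum_i c i *: w i = 0.
  apply/mpolyP => m; rewrite mcoeff0; have [mD|mD] := ltnP (mdeg m) D.+1.
    rewrite raddf_sum -[RHS](cP (BMultinom mD)); apply: eq_bigr => i _.
    by rewrite /= mcoeffZ.
  apply: memN_msupp_eq0; apply: msize_mdeg_ge; apply: leq_trans mD.
  by apply: msize_sum_leq => i _; rewrite (leq_trans (msizeZ_le _ _)).
pose v := \sum_(m : 'X_{1..k < (D - e).+1}) c (inr m) *: ('X_[m] : {mpoly F[k]}).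
pose s P := \sum_i c (inl (P, i)) *: b P i.
have split0 : \sum_P U P * s P + f * v = 0.
  rewrite -[RHS]sum0 big_sumType /=; congr (_ + _).
    transitivity (\sum_(Pi : H * 'I_h) c (inl (Pi.1, Pi.2)) *: (U Pi.1 * b Pi.1 Pi.2)); last first.
      by apply: eq_bigr => -[P i] _.
    rewrite -(pair_bigA _ (fun P i => c (inl (P, i)) *: (U P * b P i))) /=.
    by apply: eq_bigr => P _; rewrite mulr_sumr; apply: eq_bigr => i _; rewrite scalerAr.
  by rewrite mulr_sumr; apply: eq_bigr => m _; rewrite scalerAr.
have cH P i : c (inl (P, i)) = 0.
  have [_ free_b] := bP P; apply: (free_b (fun i => c (inl (P, i)))); rewrite -/(s P).
  (* A truncated geometric series: it inverts [U P] modulo the [j]-th power of the maximal ideal, as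
     [1 - U P] vanishes at [P]. *)
  pose T := \sum_(i < j) (1 - U P) ^+ i.
  have UT : U P * T = 1 - (1 - U P) ^+ j.
    have := subrX1 (1 - U P) j; rewrite -/T => subE.
    by rewrite -[1 - _]opprB subE -mulNr opprB opprB addrC subrK.
  have UE : U P * s P = - (f * v) - \sum_(Q | Q != P) U Q * s Q.
    move: split0; rewrite (bigD1 P) //= => S0.
    by apply/eqP; rewrite -subr_eq0 -[X in _ == X]S0; apply/eqP; ring.
  exists (- (T * v)), ((1 - U P) ^+ j * s P - T * \sum_(Q | Q != P) U Q * s Q); split.
    transitivity (T * (U P * s P) + (1 - U P) ^+ j * s P).
      by rewrite mulrA [T * _]mulrC -mulrDl UT subrK mul1r.
    by rewrite UE; move: ((1 - U P) ^+ j * s P) => z; ring.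
  apply: vanishesD.
    rewrite mulrC; apply/vanishes_mull/vanishesX/vanishes_root.
    by rewrite /U rmorphB rmorph1 rmorphXn /= indicator_self expr1n subrr.
  apply/vanishesN/vanishes_mull/vanishes_sum => Q QP.
  rewrite mulrC; apply/vanishes_mull/vanishesX/vanishes_root.
  have [i' i'P] : exists i', pt Q i' != pt P i'.
    apply/existsP; apply: contraNT QP => /existsPn same; apply/eqP/pt_inj/funext => t.
    by apply/eqP/negPn/same.
  exact: indicator_other i'P.
have v0 : v = 0.
  have s0 P : s P = 0 by rewrite /s big1 // => i _; rewrite cH scale0r.
  move: split0; rewrite big1 ?add0r => [/eqP|P _]; last by rewrite s0 mulr0.
  by rewrite mulf_eq0 (negPf f0) => /eqP.
case: i0 ci0 => [[P i]|m]; first by rewrite cH eqxx.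
have := congr1 (mcoeff m) v0; rewrite mcoeff0 raddf_sum (bigD1 m) //= mcoeffZ mcoeffX eqxx mulr1.
rewrite big1 ?addr0 => [->|i]; first by rewrite eqxx.
by rewrite mcoeffZ mcoeffX -val_eqE /= => /negPf ->; rewrite mulr0.
Qed.

End Hermite.

(** * Congruences modulo prime powers *)

(** In the Taylor expansion at [P] every remaining monomial has at least [j] factors divisible by
    [p]. *)
Lemma vanishes_dvd (p : int) k j (P y : 'I_k -> int) (v : {mpoly int[k]}) :
  vanishes j P v -> (forall i, (p %| y i - P i)%Z) -> (p ^+ j %| v.@[y])%Z.
Proof.
move=> vP yP; have -> : v.@[y] = (shift P v).@[fun i => y i - P i].
  by rewrite shift_eval; apply: meval_eq => i; rewrite subrK.
rewrite mevalE big_seq; elim/big_ind: _ => [|u w|m mv]; first exact: dvdz0.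
  exact: rpredD.
have jm : (j <= mdeg m)%N.
  by rewrite leqNgt; apply: contraTN mv => /vP; rewrite mcoeff_msupp => ->; rewrite eqxx.
apply: dvdz_mull; apply: dvdz_trans (dvdz_exp2l p jm) _; rewrite mdegE.
elim/big_ind2: _ => [|a u b w|i _]; first by rewrite expr0.
  by rewrite exprD => ? ?; apply: dvdz_mul.
exact: dvdz_exp2r.
Qed.

Lemma mpoly_dvd (p : int) k (g : {mpoly int[k]}) :
  (forall m, (p %| g@_m)%Z) -> exists2 h, g = p *: h & (p != 0 -> msize h = msize g).
Proof.
move=> pg; exists (\sum_(m <- msupp g) (g@_m %/ p)%Z *: 'X_[m]).
  rewrite {1}[g]mpolyE scaler_sumr; apply: eq_bigr => m _.
  by rewrite scalerA mulrC divzK.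
move=> p0; rewrite -[RHS](_ : msize (p *: \sum_(m <- msupp g) (g@_m %/ p)%Z *: 'X_[m]) = _).
  by rewrite msizeZ.
congr mmeasure; rewrite [RHS]mpolyE scaler_sumr; apply: eq_bigr => m _.
by rewrite scalerA mulrC divzK.
Qed.

Section ModP.

Variable p : nat.
Hypothesis p_pr : prime p.

Lemma intr_Fp_eq0 (z : int) : (z%:~R == 0 :> 'F_p) = (p %| z)%Z.
Proof.
have dvdE n : (n%:R == 0 :> 'F_p) = (p %| n)%N by rewrite (dvdn_pcharf (pchar_Fp p_pr)).
by rewrite dvdzE /=; case: z => n; rewrite ?NegzE ?mulrNz ?oppr_eq0 -pmulrn dvdE ?abszN.
Qed.

Lemma intr_Fp_surj (z : 'F_p) : ((z : nat)%:Z)%:~R = z.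
Proof. by rewrite -pmulrn natr_Zp. Qed.

Variable k : nat.

Notation red := (map_mpoly (intr : int -> 'F_p)).

Definition lift_poly (g : {mpoly 'F_p[k]}) : {mpoly int[k]} :=
  \sum_(m <- msupp g) (g@_m : nat)%:Z *: 'X_[m].

Lemma lift_coef g m : (lift_poly g)@_m = (g@_m : nat)%:Z.
Proof.
rewrite raddf_sum; have [mg|mg] := boolP (m \in msupp g).
  rewrite (bigD1_seq m) ?msupp_uniq //= mcoeffZ mcoeffX eqxx mulr1 big1 ?addr0 // => i im.
  by rewrite mcoeffZ mcoeffX (negPf im) mulr0.
rewrite (memN_msupp_eq0 mg) big_seq big1 // => i ig /=.
rewrite mcoeffZ mcoeffX; case: eqP => [im|_]; last by rewrite mulr0.
by rewrite -im ig in mg.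
Qed.

Lemma red_lift g : red (lift_poly g) = g.
Proof. by apply/mpolyP => m; rewrite mcoeff_map_mpoly lift_coef; apply: intr_Fp_surj. Qed.

Lemma red_shift (P : 'I_k -> int) g :
  red (shift P g) = shift (fun i => (P i)%:~R) (red g).
Proof.
pose F : {rmorphism {mpoly int[k]} -> {mpoly 'F_p[k]}} :=
  map_mpoly (intr : int -> 'F_p) \o comp_mpoly [tuple 'X_i + (P i)%:MP | i < k].
pose G : {rmorphism {mpoly int[k]} -> {mpoly 'F_p[k]}} :=
  comp_mpoly [tuple 'X_i + ((P i)%:~R)%:MP | i < k] \o map_mpoly (intr : int -> 'F_p).
apply: (@mpoly_rmorph_ext _ _ _ F G) => [c|i]; rewrite /F /G /=.
  by rewrite comp_mpolyC !map_mpolyC comp_mpolyC.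
rewrite comp_mpolyXU -tnth_nth tnth_mktuple rmorphD /= map_mpolyC !map_mpolyX.
by rewrite comp_mpolyXU -tnth_nth tnth_mktuple.
Qed.

(** Coefficients are lifted after moving [P] to the origin, so that vanishing Taylor coefficients
    lift to 0. *)
Lemma lift_vanishes j (P : 'I_k -> int) (v : {mpoly 'F_p[k]}) :
  vanishes j (fun i => (P i)%:~R) v -> exists2 w, red w = v & vanishes j P w.
Proof.
move=> vP; pose s := shift (fun i => (P i)%:~R) v.
exists (shift (fun i => - P i) (lift_poly s)).
  rewrite red_shift red_lift.
  have -> : (fun i => (- P i)%:~R) = (fun i => - (P i)%:~R) :> ('I_k -> 'F_p).
    by apply/funext => i; rewrite mulrNz.
  exact: shiftK.
by move=> m mj; rewrite shiftKV lift_coef /s vP.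
Qed.

Section LocalSpan.

Variables (f : {mpoly int[k]}) (j h : nat) (P : 'I_k -> int) (e : 'I_h -> {mpoly 'F_p[k]}).
Hypothesis span : forall g : {mpoly 'F_p[k]}, exists c : 'I_h -> 'F_p,
  local_ideal (red f) j (fun i => (P i)%:~R) (g - \sum_i c i *: e i).

Let on_class (y : 'I_k -> int) := (forall i, (p %| y i - P i)%Z) /\ f.@[y] = 0.

Let span_step (g : {mpoly int[k]}) : exists (c : 'I_h -> int) g', forall y, on_class y ->
  (p%:Z ^+ j %| (g - \sum_i c i *: lift_poly (e i) - p%:Z *: g').@[y])%Z.
Proof.
have [c [u [v [gE vP]]]] := span (red g).
have [w wv wP] := lift_vanishes vP.
pose C i := (c i : nat)%:Z; pose r := g - \sum_i C i *: lift_poly (e i) - (f * lift_poly u + w).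
have [|g' g'E _] := @mpoly_dvd p%:Z k r.
  move=> m; rewrite -intr_Fp_eq0 -mcoeff_map_mpoly.
  suff -> : red r = 0 by rewrite mcoeff0.
  have redC : red (\sum_i C i *: lift_poly (e i)) = \sum_i c i *: e i.
    rewrite (raddf_sum (map_mpoly (intr : int -> 'F_p))) /=; apply: eq_bigr => i _.
    by rewrite map_mpolyZ red_lift; congr (_ *: _); apply: intr_Fp_surj.
  by rewrite /r !rmorphB rmorphD rmorphM /= red_lift wv -gE redC subrr.
exists C, g' => y [yP fy]; rewrite -g'E.
have -> : g - \sum_i C i *: lift_poly (e i) - r = f * lift_poly u + w by rewrite /r; ring.
rewrite rmorphD rmorphM /= fy mul0r add0r.
exact: vanishes_dvd wP yP.
Qed.

(* Nakayama's lemma, by successive approximation modulo powers of [p]. *)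
Lemma local_span (g : {mpoly int[k]}) : exists c : 'I_h -> int, forall y, on_class y ->
  (p%:Z ^+ j %| (g - \sum_i c i *: lift_poly (e i)).@[y])%Z.
Proof.
suff approx t : exists (c : 'I_h -> int) g', forall y, on_class y ->
    (p%:Z ^+ j %| (g - \sum_i c i *: lift_poly (e i) - p%:Z ^+ t *: g').@[y])%Z.
  have [c [g' gP]] := approx j; exists c => y /gP; rewrite rmorphB /= mevalZ => yP.
  by rewrite -[X in (_ %| X)%Z](subrK (p%:Z ^+ j * g'.@[y])) rpredD // dvdz_mulr.
elim: t => [|t [c [g1 IH]]].
  exists (fun=> 0), g => y _; rewrite expr0 scale1r addrAC subrr big1 ?subr0 ?meval0 ?dvdz0 // => i _.
  by rewrite scale0r.
have [c' [g2 gP]] := span_step g1.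
exists (fun i => c i + p%:Z ^+ t * c' i), g2 => y yC.
have := rpredD (IH y yC) (dvdz_mull (p%:Z ^+ t) (gP y yC)).
rewrite -mevalZ -mevalD; congr (_ %| _.@[_])%Z.
rewrite !scalerBr scalerA -exprSr scaler_sumr.
have -> : \sum_i (c i + p%:Z ^+ t * c' i) *: lift_poly (e i) =
    \sum_i c i *: lift_poly (e i) + \sum_i p%:Z ^+ t *: (c' i *: lift_poly (e i)).
  by rewrite -big_split; apply: eq_bigr => i _ /=; rewrite scalerDl scalerA.
by ring.
Qed.

End LocalSpan.

(** Siegel's lemma with [A = p ^ j] and [q = p ^ (2 * j)]. With [s] monomials, the [h] coefficients
    modulo [q] take at most [p ^ (2 * j * h) <= p ^ (j * s)] values, fewer than there are
    polynomials, while values are at most [s * p ^ j * b ^ d.-1 < q]. Half of the order [2 * j] pays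
    for the coefficients, half for the box. *)
Lemma low_class (f : {mpoly int[k]}) d b j h (P : 'I_k -> int) (e : 'I_h -> {mpoly 'F_p[k]}) :
  (forall g : {mpoly 'F_p[k]}, exists c : 'I_h -> 'F_p,
     local_ideal (red f) (2 * j) (fun i => (P i)%:~R) (g - \sum_i c i *: e i)) ->
  (2 * h <= #|{: 'X_{1..k < d}}|)%N -> (0 < #|{: 'X_{1..k < d}}|)%N -> (0 < b)%N ->
  (#|{: 'X_{1..k < d}}| * b ^ d.-1 < p ^ j)%N ->
  exists2 g : {mpoly int[k]}, g != 0 & (msize g <= d)%N /\
    forall y, (forall i, `|y i| <= b)%N -> f.@[y] = 0 -> (forall i, (p %| y i - P i)%Z) ->
    g.@[y] = 0.
Proof.
move=> span hs s0 b0 lt_pj; set s := #|_| in hs s0 lt_pj *.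
have /choice[c cP] := local_span span.
pose T y := [/\ forall i, (`|y i| <= b)%N, f.@[y] = 0 & forall i, (p %| y i - P i)%Z].
pose q := (p ^ (2 * j))%N; have p0 := prime_gt0 p_pr.
have qE : q%:Z = p%:Z ^+ (2 * j) by rewrite -!natz natrX.
pose phi (i : 'I_h) g := `|(c g i %% q%:Z)%Z|%N.
have qZ0 : q%:Z != 0 by rewrite eqz_nat -lt0n expn_gt0 p0.
have [||||||g g0 [gd gT]] := @siegel k d b (p ^ j) q T 'I_h (fun=> q) phi.
- by move=> y [].
- by [].
- by move=> i g; rewrite -ltz_nat gez0_abs ?modz_ge0 // ltz_pmod // ltz_nat expn_gt0 p0.
- move=> g1 g2 eq_phi y [_ fy yP].
  have yC : (forall i, (p %| y i - P i)%Z) /\ f.@[y] = 0 by [].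
  have c12 i : (q %| c g1 i - c g2 i)%Z.
    rewrite -eqz_mod_dvd; apply/eqP; have := congr1 Posz (eq_phi i).
    by rewrite /phi !gez0_abs ?modz_ge0.
  have -> : (g1 - g2).@[y] = (g1 - \sum_i c g1 i *: lift_poly (e i)).@[y]
      - (g2 - \sum_i c g2 i *: lift_poly (e i)).@[y]
      + \sum_i (c g1 i - c g2 i) * (lift_poly (e i)).@[y].
    have -> : \sum_i (c g1 i - c g2 i) * (lift_poly (e i)).@[y] =
        (\sum_i c g1 i *: lift_poly (e i)).@[y] - (\sum_i c g2 i *: lift_poly (e i)).@[y].
      rewrite !(raddf_sum (meval y)) -sumrB; apply: eq_bigr => i _ /=.
      by rewrite !mevalZ mulrBl.
    by rewrite !mevalB; ring.
  rewrite qE; apply: rpredD; first by apply: rpredB; apply: cP.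
  by apply: rpred_sum => i _; apply: dvdz_mulr; rewrite -qE.
- rewrite prod_nat_const card_ord -/s /q -expnM -mulnA [(j * h)%N]mulnC mulnA mulnC expnM.
  by apply: leq_ltn_trans (leq_pexp2l _ hs) _; rewrite ?expn_gt0 ?p0 // ltn_exp2r.
- by rewrite -/s /q mul2n -addnn expnD mulnAC mulnC [(s * _)%N]mulnC ltn_pmul2l ?expn_gt0 ?p0 // mulnC.
by exists g => //; split=> // y yb fy yP; apply: gT.
Qed.

End ModP.

Lemma prod_primes_dvd (ps : seq nat) j (z : int) :
  uniq ps -> (forall p, p \in ps -> prime p) -> (forall p, p \in ps -> (p%:Z ^+ j %| z)%Z) ->
  ((\prod_(p <- ps) p ^ j)%N %| z)%Z.
Proof.
have expE p : p%:Z ^+ j = (p ^ j)%N%:Z by rewrite -!natz natrX.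
elim: ps => [|p ps IH] /=; first by rewrite big_nil dvd1z.
case/andP=> pps ups pr dv; rewrite big_cons dvdzE /= Gauss_dvd; last first.
  rewrite coprimeXl // coprime_sym big_seq; elim/big_ind: _ => [|a b ca cb|q qps].
  - exact: coprime1n.
  - by rewrite coprimeMl ca.
  apply: coprimeXl; rewrite prime_coprime ?pr ?inE ?qps ?orbT // dvdn_prime2 ?pr ?inE ?eqxx ?qps ?orbT //.
  by apply: contraNneq pps => <-.
have := dv p (mem_head _ _); rewrite expE dvdzE => -> /=.
have := IH ups _ _; rewrite dvdzE; apply=> q qps.
  by apply: pr; rewrite inE qps orbT.
by apply: dv; rewrite inE qps orbT.
Qed.

Lemma absz_modz_eq (q : nat) (x y : int) :
  (0 < q)%N -> `|(x %% q)%Z|%N = `|(y %% q)%Z|%N -> (q %| x - y)%Z.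
Proof.
move=> q0 /(congr1 Posz); have qZ : q%:Z != 0 by rewrite eqz_nat -lt0n.
by rewrite !gez0_abs ?modz_ge0 // => /eqP; rewrite eqz_mod_dvd.
Qed.

Lemma prodn_exp (I : Type) (r : seq I) (F : I -> nat) n :
  ((\prod_(i <- r) F i) ^ n = \prod_(i <- r) F i ^ n)%N.
Proof. exact: (big_morph (fun x => x ^ n)%N (fun a b => expnMn a b n) (exp1n n)). Qed.

(** The balance is that of [low_class], with [p ^ j] replaced by its product over [ps]: all Taylor
    coefficients of order [< 2 * j] at [M] points per prime are controlled, and divisibilities by
    powers of distinct primes multiply. *)
Lemma high_class k d b j M (ps : seq nat) (pt : nat -> 'I_M -> 'I_k -> int) :
  uniq ps -> (forall p, p \in ps -> prime p) ->
  (2 * (M * #|{: 'X_{1..k < 2 * j}}|) <= #|{: 'X_{1..k < d}}|)%N -> (0 < #|{: 'X_{1..k < d}}|)%N ->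
  (0 < b)%N ->
  (#|{: 'X_{1..k < d}}| * b ^ d.-1 < \prod_(p <- ps) p ^ j)%N ->
  exists2 g : {mpoly int[k]}, g != 0 & (msize g <= d)%N /\
    forall y, (forall i, `|y i| <= b)%N ->
      (forall p, p \in ps -> exists t, forall i, (p %| y i - pt p t i)%Z) -> g.@[y] = 0.
Proof.
move=> ups pr hs s0 b0; set s := #|{: 'X_{1..k < d}}| in hs s0 *; set A := (\prod_(_ <- _) _)%N => lt_A.
pose T y := (forall i, (`|y i| <= b)%N) /\
  (forall p, p \in ps -> exists t, forall i, (p %| y i - pt p t i)%Z).
pose J : finType := ('I_(size ps) * ('I_M * 'X_{1..k < 2 * j}))%type.
pose pr_ (i : 'I_(size ps)) := nth 0%N ps i.
have pr_ps i : pr_ i \in ps by rewrite mem_nth.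
have pr_gt0 i : (0 < pr_ i)%N by apply/prime_gt0/pr.
pose N (c : J) := (pr_ c.1 ^ (2 * j))%N.
pose phi (c : J) (g : {mpoly int[k]}) :=
  `|((shift (pt (pr_ c.1) c.2.1) g)@_c.2.2 %% (N c)%:Z)%Z|%N.
have N0 c : (0 < N c)%N by rewrite expn_gt0 pr_gt0.
have A0 : (0 < A)%N by apply: leq_ltn_trans lt_A.
have [||||||g g0 [gd gT]] := @siegel k d b A (A ^ 2) T J N phi.
- by move=> y [].
- by [].
- move=> c g; rewrite -ltz_nat gez0_abs ?modz_ge0 ?ltz_pmod ?ltz_nat //.
  by rewrite eqz_nat -lt0n.
- move=> g1 g2 eq_phi y [_ yP].
  have coef_dvd i t (m : 'X_{1..k < 2 * j}) :
      ((pr_ i ^ (2 * j))%N %| (shift (pt (pr_ i) t) (g1 - g2))@_m)%Z.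
    have := absz_modz_eq (N0 (i, (t, m))) (eq_phi (i, (t, m))).
    by rewrite -mcoeffB -comp_mpolyB.
  have -> : (A ^ 2 = \prod_(p <- ps) p ^ (2 * j))%N.
    rewrite /A prodn_exp; apply: eq_bigr => p _.
    by rewrite -expnM mulnC.
  apply: prod_primes_dvd => // p pps; have [t yt] := yP p pps.
  have ip : (index p ps < size ps)%N by rewrite index_mem.
  have pE : pr_ (Ordinal ip) = p by rewrite /pr_ /= nth_index.
  have qE : p%:Z ^+ (2 * j) = (p ^ (2 * j))%N%:Z by rewrite -!natz natrX.
  have -> : (g1 - g2).@[y] = (shift (pt p t) (g1 - g2)).@[fun i => y i - pt p t i].
    by rewrite shift_eval; apply: meval_eq => i; rewrite subrK.
  rewrite mevalE; apply: rpred_sum => m _.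
  have [mj|mj] := ltnP (mdeg m) (2 * j); first by
    apply: dvdz_mulr; have := coef_dvd (Ordinal ip) t (BMultinom mj); rewrite pE -qE.
  apply: dvdz_mull; apply: dvdz_trans (dvdz_exp2l p%:Z mj) _; rewrite mdegE.
  elim/big_ind2: _ => [|a u b' w|i _]; first by rewrite expr0.
    by rewrite exprD => ? ?; apply: dvdz_mul.
  by apply: dvdz_exp2r; apply: yt.
- rewrite -(pair_bigA _ (fun i (c : 'I_M * 'X_{1..k < 2 * j}) => N (i, c))) /=.
  rewrite /N /=; under eq_bigr => i _ do
    rewrite prod_nat_const card_prod card_ord -expnM mulnC mulnA expnM mulnC.
  apply: leq_ltn_trans (_ : A ^ s < _)%N; last by rewrite ltn_exp2r.
  apply: leq_trans (leq_pexp2l A0 hs).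
  rewrite /A (big_nth 0%N) big_mkord prodn_exp.
  by apply: eq_leq; apply: eq_bigr => i _; rewrite -!expnM; congr (_ ^ _)%N; ring.
- by rewrite -/s expnS expn1 mulnAC mulnC [(s * _)%N]mulnC ltn_pmul2l // mulnC.
by exists g => //; split=> // y yb yP; apply: gT.
Qed.

(** * Covering the integer points of an affine hypersurface *)

Lemma ffact_leq n k : (n ^_ k <= n ^ k)%N.
Proof.
rewrite ffact_prod -[X in (_ ^ X)%N]card_ord -prod_nat_const.
by apply: leq_prod => i _; apply: leq_subr.
Qed.

Lemma bin_leq_exp n k : ('C(n, k) <= n ^ k)%N.
Proof.
by apply: leq_trans (ffact_leq n k); rewrite -bin_ffact leq_pmulr ?fact_gt0.
Qed.

(** The difference of the two binomials is the Hilbert function of a hypersurface of degree [d] in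
    [k.+1] variables; the exponent [k] in place of [k.+1] is the source of the saving. *)
Lemma bin_shift_leq m d k : ('C(m + d, k.+1) <= 'C(m, k.+1) + d * (m + d) ^ k)%N.
Proof.
elim: d => [|d IH]; first by rewrite addn0 mul0n addn0.
rewrite addnS binS; apply: leq_trans (leq_add IH (bin_leq_exp _ _)) _.
rewrite -addnA -mulSnr leq_add2l leq_mul2l /=; case: k {IH} => // k.
by rewrite leq_exp2r.
Qed.

Lemma expn_leq_bin n k : (n ^ k <= 'C(n + k.-1, k) * k`!)%N.
Proof.
case: k => [|k]; first by rewrite bin0 fact0.
rewrite bin_ffact ffact_prod -[X in (n ^ X)%N]card_ord -prod_nat_const.
by apply: leq_prod => i _; have := ltn_ord i; lia.
Qed.

Lemma leq_card_bmnm k d : (0 < d)%N -> (d ^ k <= #|{: 'X_{1..k < d}}| * k`!)%N.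
Proof.
case: d => // d _; rewrite card_bmnm; apply: leq_trans (expn_leq_bin _ _) _.
rewrite leq_mul2r; apply/orP; right; case: k => [|k]; first by rewrite !bin0.
by apply: leq_bin2l; rewrite /= addSn addnC.
Qed.

Lemma card_bmnm_leq k d : (#|{: 'X_{1..k < d}}| * k`! <= (d + k.-1) ^ k)%N.
Proof.
case: d => [|d]; first by rewrite (_ : #|_| = 0%N) //; apply/eqP/pred0P => -[[]].
rewrite card_bmnm bin_ffact; case: k => [|k]; first by rewrite ffactn0.
by apply: leq_trans (ffact_leq _ _) _; rewrite leq_exp2r //=; lia.
Qed.

Lemma msize_map_mpoly_leq k (A B : nzRingType) (phi : {rmorphism A -> B}) (g : {mpoly A[k]}) :
  (msize (map_mpoly phi g) <= msize g)%N.
Proof.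
rewrite [X in (X <= _)%N]msizeE; apply/bigmax_leqP_seq => m mg _; apply: msize_mdeg_lt.
by move: mg; rewrite !mcoeff_msupp mcoeff_map_mpoly; apply: contraNneq => ->; rewrite raddf0.
Qed.

Section Residues.

Variables (k : nat) (f : {mpoly int[k]}) (d b : nat).

Definition box_zero (y : 'I_k -> int) := (forall i, (`|y i| <= b)%N) /\ f.@[y] = 0.

(** Defined by the polynomial wanted rather than by a dimension: for [f] nonzero modulo [p] and
    large enough [j], a class without such a polynomial has more than [s / 2] independent local
    conditions, as the proof of [high_residues_bound] shows. *)
Definition low_residue p (P : 'I_k -> int) :=
  exists2 g : {mpoly int[k]}, g != 0 & (msize g <= d)%N /\
    forall y, box_zero y -> (forall i, (p %| y i - P i)%Z) -> g.@[y] = 0.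

Notation s := #|{: 'X_{1..k < d}}|.

Lemma high_residues_bound p j (H : finType) (pt : H -> 'I_k -> 'F_p) D :
  prime p -> map_mpoly (intr : int -> 'F_p) f != 0 -> (msize f <= d.+1)%N ->
  (0 < k)%N -> (0 < j)%N -> (0 < b)%N -> (0 < s)%N -> (s * b ^ d.-1 < p ^ j)%N ->
  (d <= D)%N -> (k * p * (2 * j) <= D)%N ->
  injective pt -> (forall x, ~ low_residue p (fun i => (pt x i : nat)%:Z)) ->
  (#|H| * s./2.+1 + 'C(k + (D - d), k) <= 'C(k + D, k))%N.
Proof.
move=> p_pr f0 fd k0 j0 b0 s0 sb dD jD pt_inj high.
pose fp := map_mpoly (intr : int -> 'F_p) f.
have fpE : msize fp = (msize fp).-1.+1 by rewrite prednK // lt0n msize_poly_eq0.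
have fpd : ((msize fp).-1 <= d)%N.
  by rewrite -ltnS -fpE; apply: leq_trans fd; apply: msize_map_mpoly_leq.
have j2 : (0 < 2 * j)%N by rewrite muln_gt0.
(* [f] may lose degree modulo [p], which only strengthens the bound. *)
apply: leq_trans (_ : #|H| * s./2.+1 + 'C(k + (D - (msize fp).-1), k) <= _)%N.
  by rewrite leq_add2l leq_bin2l // leq_add2l leq_sub2l.
apply: (high_points_bound f0 fpE k0 j2 pt_inj) => [x||].
- have [[h hs [e [_ _ span]]]|[e [_ free]]] := greedy_basis (fun=> True)
    (@local_ideal_lin _ k fp (2 * j) (pt x)) s./2; last by exists e.
  have ptE : pt x = fun i => ((pt x i : nat)%:Z)%:~R.
    by apply/funext => i; rewrite intr_Fp_surj.
  case: (high x); have [||g g0 [gd gP]] := low_class p_pr _ _ s0 b0 sb (f := f) (h := h)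
    (P := fun i => (pt x i : nat)%:Z) (e := e).
  + by move=> g; rewrite -ptE; apply: span.
  + by have := odd_double_half s; lia.
  by exists g => //; split=> // y [yb fy] yP; apply: gP.
- exact: leq_trans fpd dD.
by rewrite card_Fp.
Qed.

End Residues.

Lemma dvdz_sub_Fp p (y : int) : prime p ->
  (p %| y - ((y%:~R : 'F_p) : nat)%:Z)%Z.
Proof. by move=> p_pr; rewrite -intr_Fp_eq0 // intrB intr_Fp_surj subrr. Qed.

(** Each low class of each prime up to [Q] has its own polynomial, obtained with order [jl]; the
    points that are high at all these primes share one more, obtained with order [jh]. [M] bounds
    the number of high classes at each prime. *)
Lemma covering_of_bounds k (f : {mpoly int[k]}) d b jl jh Q M :
  (0 < k)%N -> (0 < jl)%N -> (0 < b)%N -> (0 < d)%N -> (msize f <= d.+1)%N ->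
  (forall p, prime p -> map_mpoly (intr : int -> 'F_p) f != 0) ->
  (#|{: 'X_{1..k < d}}| * b ^ d.-1 < 2 ^ jl)%N ->
  (d <= k * Q * (2 * jl))%N -> (0 < M)%N ->
  (d * (k + k * Q * (2 * jl)) ^ k.-1 <= M * #|{: 'X_{1..k < d}}|./2.+1)%N ->
  (2 * (M * #|{: 'X_{1..k < 2 * jh}}|) <= #|{: 'X_{1..k < d}}|)%N ->
  (#|{: 'X_{1..k < d}}| * b ^ d.-1 < 2 ^ (jh * size (primes_upto Q)))%N ->
  exists gs : seq {mpoly int[k]},
    [/\ (size gs <= (Q.+1 ^ k.+1).+1)%N, forall g, g \in gs -> g != 0 /\ (msize g <= d)%N &
        forall y, box_zero f b y -> exists2 g, g \in gs & g.@[y] = 0].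
Proof.
move=> k0 jl0 b0 d0 fd f0 low_jl dD M0 le_M high_M high_jh.
have s0 : (0 < #|{: 'X_{1..k < d}}|)%N.
  by case: d d0 {fd low_jl dD le_M high_M high_jh} => // d _; rewrite card_bmnm bin_gt0 leq_addr.
pose Res := {ffun 'I_k -> 'I_Q.+1}.
pose lift (P : Res) := fun i => (P i : nat)%:Z.
have /choice[G GP] : forall c : nat * Res, exists g : {mpoly int[k]},
    (g != 0 /\ (msize g <= d)%N) /\ (low_residue f d b c.1 (lift c.2) ->
      forall y, box_zero f b y -> (forall i, (c.1 %| y i - lift c.2 i)%Z) -> g.@[y] = 0).
  move=> c; have [[g g0 [gd gP]]|no] := pselect (low_residue f d b c.1 (lift c.2)).
    by exists g.
  (* A filler for the pairs that are not low. *)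
  by exists 1; rewrite oner_eq0 msize1.
pose high p : pred {ffun 'I_k -> 'F_p} :=
  fun P => `[< ~ low_residue f d b p (fun i => (P i : nat)%:Z) >].
have card_high p : prime p -> (p <= Q)%N -> (#|high p| <= M)%N.
  move=> p_pr pQ; set D := (k * Q * (2 * jl))%N in dD le_M.
  have := @high_residues_bound k f d b p jl {P | high p P} (fun x i => val x i) D p_pr (f0 p p_pr)
    fd k0 jl0 b0 s0.
  rewrite card_sig => hb.
  have {hb} hb : (#|high p| * #|{: 'X_{1..k < d}}|./2.+1 + 'C(k + (D - d), k) <= 'C(k + D, k))%N.
    apply: hb => //.
    - by apply: leq_trans low_jl _; rewrite leq_exp2r // prime_gt1.
    - by rewrite /D leq_mul2r leq_mul2l pQ !orbT.
    - by move=> u v uv; apply/val_inj/ffunP => i; have := congr1 (fun g => g i) uv.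
    by case=> P /= /asboolP.
  have := bin_shift_leq (k + (D - d)) d k.-1; rewrite prednK // -addnA subnK // => hb'.
  have : (#|high p| * #|{: 'X_{1..k < d}}|./2.+1 <= M * #|{: 'X_{1..k < d}}|./2.+1)%N.
    by apply: leq_trans le_M; lia.
  by rewrite leq_pmul2r.
(* Lists of fewer than [M] high classes are padded with the class of 0, which only adds
   conditions. *)
pose pt p (t : 'I_M) : 'I_k -> int := fun i => (nth [ffun=> 0] (enum (high p)) t i : nat)%:Z.
have ups : uniq (primes_upto Q) by rewrite filter_uniq ?iota_uniq.
have pr_ps p : p \in primes_upto Q -> prime p by rewrite mem_filter => /andP[].
have psQ p : p \in primes_upto Q -> (p <= Q)%N by rewrite mem_filter mem_iota => /and3P[].
have big_prod : (#|{: 'X_{1..k < d}}| * b ^ d.-1 < \prod_(p <- primes_upto Q) p ^ jh)%N.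
  apply: leq_trans high_jh _; rewrite expnM -[size _]count_predT -iter_muln_1 -big_const_seq.
  rewrite !big_seq; apply: leq_prod => p /pr_ps /prime_gt1 p1.
  by case: (jh) => // j'; rewrite leq_exp2r.
have [g g0 [gd gP]] := high_class pt ups pr_ps high_M s0 b0 big_prod.
exists (g :: [seq G (p, P) | p <- primes_upto Q, P <- enum {: Res}]); split.
- rewrite /= ltnS size_allpairs -cardE card_ffun !card_ord expnS leq_mul2r.
  apply/orP; right; rewrite size_filter; apply: leq_trans (count_size _ _) _.
  by rewrite size_iota.
- move=> h; rewrite inE => /predU1P[-> //|/allpairsP[[p P] [_ _ ->]]].
  by have [] := GP (p, P).
move=> y yf.
have [all_high|] := pselect (forall p, p \in primes_upto Q ->
    ~ low_residue f d b p (fun i => (((y i)%:~R : 'F_p) : nat)%:Z)).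
  exists g; first by rewrite mem_head.
  apply: gP => [|p pps]; first by case: yf.
  pose P : {ffun 'I_k -> 'F_p} := [ffun i => (y i)%:~R].
  have PE : (fun i => (P i : nat)%:Z) = (fun i => (((y i)%:~R : 'F_p) : nat)%:Z).
    by apply/funext => i; rewrite ffunE.
  have Ph : P \in enum (high p).
    by rewrite mem_enum; apply/asboolP; rewrite PE; apply: all_high.
  have tM : (index P (enum (high p)) < M)%N.
    by apply: leq_trans (card_high p (pr_ps p pps) (psQ p pps)); rewrite cardE index_mem.
  exists (Ordinal tM) => i; rewrite /pt /= nth_index // ffunE.
  exact: dvdz_sub_Fp (pr_ps p pps).
move=> /existsNP[p] /not_implyP[pps] /contrapT low.
have p_pr := pr_ps p pps.
have resQ i : ((((y i)%:~R : 'F_p) : nat) < Q.+1)%N.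
  apply: leq_trans (ltn_ord _) _; rewrite Fp_cast //.
  exact: leq_trans (psQ p pps) _.
pose P : Res := [ffun i => Ordinal (resQ i)].
have PE : lift P = (fun i => (((y i)%:~R : 'F_p) : nat)%:Z).
  by apply/funext => i; rewrite /lift ffunE.
exists (G (p, P)); first by rewrite inE; apply/orP; right; apply: allpairs_f => //; rewrite mem_enum.
have [_ /=] := GP (p, P); rewrite PE; apply=> // i.
exact: dvdz_sub_Fp.
Qed.

Lemma bin_leq_2exp n k : ('C(n, k) <= 2 ^ n)%N.
Proof.
elim: n k => [|n IH] [|k]; rewrite ?bin0 ?expn_gt0 //.
by rewrite binS expnS mul2n -addnn leq_add.
Qed.

Lemma card_box_bound k d b L :
  (0 < L)%N -> (k <= d)%N -> (0 < d)%N -> (b <= 2 ^ L)%N ->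
  (#|{: 'X_{1..k < d}}| * b ^ d.-1 < 2 ^ (3 * L * d))%N.
Proof.
move=> L0; case: d => // d kd _ bL; rewrite card_bmnm /=.
apply: (@leq_ltn_trans (2 ^ (k + d + L * d))).
  rewrite expnD; apply: leq_mul; first exact: bin_leq_2exp.
  by rewrite expnM; case: d {kd} => // d; rewrite leq_exp2r.
by rewrite ltn_exp2l //; nia.
Qed.

Lemma leq_double_half s : (s <= 2 * s./2.+1)%N.
Proof. by have := odd_double_half s; lia. Qed.

(** The order [jh] is about [d / W], where [W ^ k] must dominate [M], of order [(Q L) ^ (k - 1)].
    Taking [Q = Y ^ k] makes the root of [Q ^ (k - 1)] the integer [Y ^ (k - 1)], and the remaining
    factor [Y] of [Q] outweighs the logarithm in Chebyshev's bound. *)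
Theorem covering k : (0 < k)%N -> exists C a, forall L d b (f : {mpoly int[k]}),
  (0 < L)%N -> (C * L ^ a <= d)%N -> (0 < b)%N -> (b <= 2 ^ L)%N -> (msize f <= d.+1)%N ->
  (forall p, prime p -> map_mpoly (intr : int -> 'F_p) f != 0) ->
  exists gs : seq {mpoly int[k]},
    [/\ (size gs <= C * L ^ a)%N, forall g, g \in gs -> g != 0 /\ (msize g <= d)%N &
        forall y, box_zero f b y -> exists2 g, g \in gs & g.@[y] = 0].
Proof.
move=> k0; have kf : (0 < k`!)%N by rewrite fact_gt0.

(* [C1] collects the constants of [M] and of the monomial counts; [c0] is such that Chebyshev's
   bound yields [6 * C1 * L ^ 2 * Y ^ k.-1] primes. *)
have [C1 C1E] : exists x, x = (4 * k`! * (7 * k) * k.+1)%N by eexists.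
have [c0 c0E] : exists x, x = (24 * k * C1)%N by eexists.
have C1_gt0 : (0 < C1)%N by rewrite C1E !muln_gt0 kf k0.
have c0_gt0 : (0 < c0)%N by rewrite c0E !muln_gt0 C1_gt0 k0.
(* The three summands serve the number of polynomials, the inequality [W <= d] and the inequality
   [k <= d]. *)
exists (2 ^ k.+2 * (2 * c0) ^ (2 * k * k.+1) + C1 * (2 * c0) ^ (2 * k) + k)%N.
exists (4 * k * k.+1 + 1)%N => L d b f L0 Cd b0 bL fd f0.
pose z := up_log 2 (c0 * L ^ 2); pose T := (2 ^ z)%N; pose S := (2 * c0 * L ^ 2)%N.
have cL0 : (1 < c0 * L ^ 2)%N.
  apply: (@leq_trans c0); last by rewrite leq_pmulr // expn_gt0 L0.
  by rewrite c0E -mulnA (@leq_trans (24 * 1)) // leq_mul2l muln_gt0 k0.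
have z0 : (0 < z)%N by rewrite up_log_gt0.
have T_ge : (c0 * L ^ 2 <= T)%N by apply: up_logP.
have T_le : (T <= S)%N.
  have := up_log_gtn (isT : (1 < 2)%N) cL0; rewrite -/z /T /S -{2}(prednK z0) -mulnA => ?.
  by rewrite expnS leq_pmul2l // ltnW.
have T0 : (0 < T)%N by rewrite expn_gt0.
have zT : (z <= T)%N by apply/ltnW/ltn_expl.
(* One factor [T] pays for the logarithm [z], the other for [c0 * L ^ 2]. *)
pose Y := (T ^ 2)%N; pose Q := (Y ^ k)%N.
have Y0 : (0 < Y)%N by rewrite expn_gt0 T0.
have Q0 : (0 < Q)%N by rewrite expn_gt0 Y0.
pose W := (C1 * L * Y ^ k.-1)%N.
have W0 : (0 < W)%N by rewrite /W !muln_gt0 C1_gt0 L0 expn_gt0 Y0.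
have QE : (Q = Y * Y ^ k.-1)%N by rewrite -expnS prednK.
have Q_le : (Q <= S ^ (2 * k))%N.
  by rewrite /Q /Y -expnM leq_exp2r // muln_gt0.
have S_le e : (S ^ e = (2 * c0) ^ e * L ^ (2 * e))%N by rewrite /S expnMn -expnM.
have L_le u v : (u <= v)%N -> (L ^ u <= L ^ v)%N by apply: leq_pexp2l.
have kd : (k <= d)%N.
  apply: leq_trans Cd; apply: leq_trans (leq_addl _ _) _.
  by apply: leq_pmulr; rewrite expn_gt0 L0.
have d0 : (0 < d)%N by apply: leq_trans kd.
have Wd : (W <= d)%N.
  apply: leq_trans Cd; apply: (@leq_trans (C1 * (2 * c0) ^ (2 * k) * L ^ (4 * k * k.+1 + 1))); last first.
    by rewrite leq_mul2r; apply/orP; right; lia.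
  apply: (@leq_trans (C1 * L * S ^ (2 * k))).
    rewrite leq_mul2l; apply/orP; right; apply: leq_trans Q_le.
    by rewrite QE leq_pmull.
  rewrite S_le -!mulnA leq_pmul2l // mulnCA leq_mul2l -expnS; apply/orP; right.
  by apply: L_le; nia.
(* Since [W <= d] the quotient is at least 1, and rounding down costs at most a factor 2. The other
   order is the exponent of [card_box_bound]. *)
pose jh := (d %/ W)%N; pose jl := (3 * L * d)%N.
have jh0 : (0 < jh)%N by rewrite divn_gt0.
have jhW : (jh * W <= d)%N by apply: leq_trunc_div.
have d_jh : (d <= 2 * jh * W)%N.
  apply: leq_trans (ltnW (ltn_ceil d W0)) _; rewrite -/jh leq_mul2r; apply/orP; right.
  by rewrite mul2n -addnn -addn1 leq_add2l.
(* The 7 comes from [k + 6 * k * Q * L * d <= 7 * k * Q * L * d], the leading 2 from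
   [s <= 2 * s./2.+1]. *)
pose M := (2 * k`! * (7 * k * Q * L) ^ k.-1)%N.
have card_lt := card_box_bound L0 kd d0 bL.
have s_ge : (d ^ k <= #|{: 'X_{1..k < d}}| * k`!)%N by apply: leq_card_bmnm.
have := @covering_of_bounds k f d b jl jh Q M k0 _ b0 d0 fd f0 card_lt.
case=> //.
- by rewrite /jl !muln_gt0 L0.
- rewrite /jl; have kQL : (0 < k * Q * L)%N by rewrite !muln_gt0 k0 Q0.
  have -> : (k * Q * (2 * (3 * L * d)) = k * Q * L * 6 * d)%N by ring.
  by rewrite leq_pmull // muln_gt0 kQL.
- by rewrite /M !muln_gt0 kf expn_gt0 !muln_gt0 k0 Q0 L0.
- have le7 : (k + k * Q * (2 * jl) <= 7 * k * Q * L * d)%N.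
    have : (k <= k * Q * L * d)%N by rewrite -!mulnA leq_pmulr // !muln_gt0 Q0 L0.
    by rewrite /jl; lia.
  apply: (@leq_trans (d ^ k * (7 * k * Q * L) ^ k.-1)).
    have -> : (d ^ k = d * d ^ k.-1)%N by rewrite -expnS prednK.
    rewrite -[leqRHS]mulnA leq_mul2l -expnMn; apply/orP; right.
    by rewrite [(d * _)%N]mulnC; case: k.-1 => // e; rewrite leq_exp2r.
  rewrite /M [(_ * (_ ^ _) * _)%N]mulnAC leq_mul2r; apply/orP; right.
  by apply: leq_trans s_ge _; rewrite mulnAC leq_mul2r leq_double_half orbT.
- rewrite -(leq_pmul2r kf); apply: leq_trans s_ge.
  apply: (@leq_trans ((jh * W) ^ k)); last by rewrite leq_exp2r.
  have N_le : (#|{: 'X_{1..k < 2 * jh}}| * k`! <= (k.+1 * jh) ^ k)%N.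
    apply: leq_trans (card_bmnm_leq _ _) _; rewrite leq_exp2r //.
    have -> : (k.+1 * jh = 2 * jh + k.-1 * jh)%N by rewrite -mulnDl add2n prednK.
    by rewrite leq_add2l leq_pmulr.
  rewrite -mulnA -[X in (2 * X)%N]mulnA; apply: (@leq_trans (2 * (M * (k.+1 * jh) ^ k))).
    by rewrite leq_mul2l; apply/orP; right; apply: leq_mul.
  have -> : (2 * (M * (k.+1 * jh) ^ k) = (4 * k`!) * (7 * k) ^ k.-1 * L ^ k.-1 * k.+1 ^ k * (jh ^ k * Q ^ k.-1))%N.
    by rewrite /M !expnMn; ring.
  have -> : ((jh * W) ^ k = (C1 * L) ^ k * (jh ^ k * Q ^ k.-1))%N.
    by rewrite /W /Q -expnM [(k * _)%N]mulnC expnM !expnMn; ring.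
  rewrite leq_mul2r; apply/orP; right.
  rewrite C1E !expnMn.
  apply: leq_trans (_ : (4 * k`!) ^ k * (7 * k) ^ k * L ^ k * k.+1 ^ k <= _)%N; last first.
    by rewrite -!expnMn; apply: eq_leq; congr (_ ^ _)%N; ring.
  rewrite leq_mul2r; apply/orP; right; apply: leq_mul; last by apply: L_le; apply: leq_pred.
  apply: leq_mul; last by rewrite -expnMn leq_pexp2l ?leq_pred // muln_gt0 k0.
  by rewrite -{1}(expn1 (4 * k`!)) leq_pexp2l // muln_gt0.
- apply: leq_trans card_lt _; rewrite leq_exp2l //.
  have /chebyshev_lower : (0 < 2 * z * k)%N by rewrite !muln_gt0 z0 k0.
  have -> : (2 ^ (2 * z * k) = Q)%N by rewrite /Q /Y /T -!expnM; congr (_ ^ _)%N; ring.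
  set n := size _ => cheb.
  have n_ge : (6 * C1 * L ^ 2 * Y ^ k.-1 <= n)%N.
    have kT : (0 < 4 * k * T)%N by rewrite !muln_gt0 k0 T0.
    rewrite -(leq_pmul2l kT); apply: (@leq_trans Q).
      rewrite QE {2}/Y expnS expn1 mulnA leq_mul2r; apply/orP; right.
      apply: (@leq_trans (T * (c0 * L ^ 2))); last by rewrite leq_mul2l T_ge orbT.
      by apply: eq_leq; rewrite c0E; ring.
    apply: leq_trans cheb _; rewrite leq_mul2r; apply/orP; right.
    have -> : (2 * (2 * z * k) = 4 * k * z)%N by ring.
    by rewrite leq_mul2l zT orbT.
  apply: (@leq_trans (3 * L * (2 * jh * W))); first by rewrite leq_mul2l d_jh orbT.
  apply: (@leq_trans (jh * (6 * C1 * L ^ 2 * Y ^ k.-1))); last by rewrite leq_mul2l n_ge orbT.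
  by apply: eq_leq; rewrite /W; ring.
move=> gs [gs_le gs_d gs_cover]; exists gs; split=> //.
apply: leq_trans gs_le _; apply: (@leq_trans (2 * (2 * Q) ^ k.+1)).
  rewrite mul2n -addnn -addn1; apply: leq_add; last by rewrite expn_gt0 muln_gt0 Q0.
  by rewrite leq_exp2r // mul2n -addnn -addn1 leq_add2l.
apply: (@leq_trans (2 ^ k.+2 * (2 * c0) ^ (2 * k * k.+1) * L ^ (4 * k * k.+1 + 1))); last first.
  by rewrite leq_mul2r; apply/orP; right; rewrite -addnA leq_addr.
rewrite expnMn mulnA -expnS -mulnA leq_mul2l; apply/orP; right.
apply: (@leq_trans ((S ^ (2 * k)) ^ k.+1)); first by rewrite leq_exp2r.
rewrite -expnM S_le leq_mul2l; apply/orP; right; apply: L_le.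
by rewrite !mulnA addn1 leqnSn.
Qed.

(** * Primitive integer forms of rational polynomials *)

Lemma mpoly_clear_denominators k (f : {mpoly rat[k]}) :
  exists2 D : int, D != 0 & exists g : {mpoly int[k]}, map_mpoly intr g = D%:~R *: f.
Proof.
elim/mpolyind: f => [|c m f _ _ [D D0 [g gE]]].
  by exists 1 => //; exists 0; rewrite raddf0 scaler0.
exists (denq c * D); first by rewrite mulf_neq0 // denq_neq0.
exists ((numq c * D) *: 'X_[m] + denq c *: g).
rewrite raddfD /= !map_mpolyZ map_mpolyX gE scalerDr !scalerA !intrM.
by congr (_ *: _ + _); rewrite -{3}(divq_num_den c) mulrACA mulrC; field; rewrite intr_eq0 denq_neq0.
Qed.

(** While some prime kills [g], it is divided out, and the absolute value of one fixed nonzero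
    coefficient strictly decreases. *)
Lemma primitive_part k (g : {mpoly int[k]}) : g != 0 ->
  exists2 t : int, t != 0 & exists2 h, g = t *: h &
    forall p, prime p -> map_mpoly (intr : int -> 'F_p) h != 0.
Proof.
rewrite -mleadc_eq0; move: (mlead g) => m.
have [N] := ubnP (absz (g@_m)); elim: N g => // N IH g gN gm.
have [prim|/existsNP[p /not_implyP[p_pr /negP/negPn/eqP gp0]]] :=
  pselect (forall p, prime p -> map_mpoly (intr : int -> 'F_p) g != 0).
  by exists 1 => //; exists g; rewrite ?scale1r.
have [|h gE _] := @mpoly_dvd p%:Z k g.
  by move=> m'; rewrite -intr_Fp_eq0 // -mcoeff_map_mpoly gp0 mcoeff0.
have p0 : p%:Z != 0 by rewrite eqz_nat -lt0n prime_gt0.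
have gmE : g@_m = p%:Z * h@_m by rewrite gE mcoeffZ.
have hm : h@_m != 0 by apply: contraNneq gm => hm; rewrite gmE hm mulr0.
have [|t t0 [h' hE h'P]] := IH h _ hm.
  rewrite -ltnS; apply: leq_trans gN; rewrite gmE abszM /= ltnS.
  by rewrite -[X in (X < _)%N]mul1n ltn_pmul2r ?absz_gt0 // prime_gt1.
exists (p%:Z * t); first by rewrite mulf_neq0.
by exists h' => //; rewrite -scalerA -hE.
Qed.

Lemma primitive_integer_form k (f : {mpoly rat[k]}) : f != 0 ->
  exists (g : {mpoly int[k]}) (c : rat),
    [/\ c != 0, map_mpoly intr g = c *: f, msize g = msize f &
        forall p, prime p -> map_mpoly (intr : int -> 'F_p) g != 0].
Proof.
move=> f0; have [D D0 [g gE]] := mpoly_clear_denominators f.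
have DQ : D%:~R != 0 :> rat by rewrite intr_eq0.
have g0 : g != 0.
  by apply: contraNneq f0 => g0; move/eqP: gE; rewrite g0 raddf0 eq_sym scaler_eq0 (negPf DQ).
have [t t0 [h hE hP]] := primitive_part g0.
have tQ : t%:~R != 0 :> rat by rewrite intr_eq0.
have hQ : map_mpoly intr h = (t%:~R^-1 * D%:~R) *: f.
  by rewrite -scalerA -gE hE map_mpolyZ scalerA mulVf // scale1r.
exists h, (t%:~R^-1 * D%:~R); split=> //; first by rewrite mulf_neq0 // invr_eq0.
rewrite -(msizeZ f (_ : t%:~R^-1 * D%:~R != 0)) ?mulf_neq0 ?invr_eq0 // -hQ.
by rewrite /mmeasure (perm_big _ (msupp_map_mpoly h (@intr_inj _))).
Qed.

Lemma meval_map_intr k (g : {mpoly int[k]}) (y : 'I_k -> int) :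
  (map_mpoly intr g).@[fun i => (y i)%:~R] = (g.@[y])%:~R :> rat.
Proof.
pose F : {rmorphism {mpoly int[k]} -> rat} :=
  meval (fun i => (y i)%:~R : rat) \o map_mpoly (intr : int -> rat).
pose G : {rmorphism {mpoly int[k]} -> rat} := (intr : int -> rat) \o meval y.
apply: (@mpoly_rmorph_ext _ _ _ F G) => [c|i]; rewrite /F /G /=.
  by rewrite map_mpolyC !mevalC.
by rewrite map_mpolyX !mevalXU.
Qed.

Lemma lin_forms_eval m n (L : 'I_m * 'I_n -> nat) (x : 'I_n -> int) i :
  (tnth (lin_forms L) i).@[fun j => (x j)%:~R] = (\sum_j (L (i, j))%:Z * x j)%:~R.
Proof.
rewrite tnth_mktuple raddf_sum /= rmorph_sum /=; apply: eq_bigr => j _.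
by rewrite mevalZ mevalXU intrM.
Qed.

(** * Covering the integer points of an affine variety *)

Lemma covering_variety n : exists C a, (n <= C)%N /\
  forall (X : {pred {mpoly rat[n]}}) d L H B,
    irreducible_variety X -> has_degree X d -> (0 < d)%N ->
    (0 < L)%N -> (C * L ^ a <= d)%N ->
    (forall m, (m <= n)%N -> (height_bound m d <= H)%N) -> (n * (H * B) <= 2 ^ L)%N ->
    exists hs : seq {mpoly rat[n]},
      [/\ (size hs <= C * L ^ a)%N,
          forall h, h \in hs ->
            [/\ hypersurface h, (hypersurface_degree h <= d - 1)%N & ~ in_hypersurface X h] &
          forall x : 'I_n -> int, point_on X x -> (forall i, (`|x i| <= B)%N) ->
            exists2 h, h \in hs & point_on_hypersurface h x].
Proof.
have /choice[C /choice[a Ca]] : forall m, exists C a, _ := fun m => @covering m.+1 isT.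
(* The number of coordinates of the projection depends on [X], so the constants for all [m <= n] are
   added up; the summand [n] later yields [n <= d]. *)
exists (n + \sum_(m < n.+1) C m)%N, (\sum_(m < n.+1) a m)%N; split; first exact: leq_addr.
move=> X d L H B X_irr X_deg d0 L0 Cd hH boxL.
have [m [mn [Lf [L_le no_small [f [f0 fd fX]]]]]] := projection_exists X_irr X_deg d0.
have Cm : (C m * L ^ a m <= (n + \sum_(m < n.+1) C m) * L ^ (\sum_(m < n.+1) a m))%N.
  have mn' : (m < n.+1)%N by [].
  have sum_ge (F : nat -> nat) : (F m <= \sum_(m < n.+1) F m)%N.
    by rewrite (bigD1 (Ordinal mn')) //= leq_addr.
  apply: leq_mul; first by apply: leq_trans (sum_ge C) (leq_addl _ _).
  exact: leq_pexp2l.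
have [g [c [c0 gE gf g_prim]]] := primitive_integer_form f0.
have pow0 : (0 < 2 ^ L)%N by rewrite expn_gt0.
have gd : (msize g <= d.+1)%N by rewrite gf.
have [gs [gs_size gs_d gs_cover]] := Ca m L d (2 ^ L)%N g L0 (leq_trans Cm Cd) pow0 (leqnn _) gd g_prim.
pose push (u : {mpoly int[m.+1]}) : {mpoly rat[n]} := map_mpoly intr u \mPo lin_forms Lf.
have push_small u : u \in gs -> push u \notin X /\ (msize (push u) <= d)%N.
  case/gs_d => u0 ud; have ud' : (msize (map_mpoly (intr : int -> rat) u) <= d)%N.
    exact: leq_trans (msize_map_mpoly_leq _ _) ud.
  split; last first.
    apply: leq_trans (msize_comp_linear _ _) ud' => i; rewrite tnth_mktuple.
    apply: msize_sum_leq => j _; apply: leq_trans (msizeZ_le _ _) _.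
    by rewrite msizeX mdeg1.
  apply: no_small ud'; apply: contraNneq u0 => u0; apply/eqP/mpolyP => t.
  by have /mpolyP/(_ t) := u0; rewrite mcoeff_map_mpoly !mcoeff0 => /eqP; rewrite intr_eq0 => /eqP.
have push_eval u x : (push u).@[fun j => (x j)%:~R] =
    (u.@[fun i => \sum_j (Lf (i, j))%:Z * x j])%:~R.
  by rewrite comp_mpoly_meval -meval_map_intr; apply: meval_eq => i; rewrite lin_forms_eval.
exists [seq h <- map push gs | (1 < msize h)%N]; split.
- rewrite size_filter; apply: leq_trans (count_size _ _) _; rewrite size_map.
  exact: leq_trans gs_size Cm.
- move=> h; rewrite mem_filter => /andP[h1 /mapP[u ugs hE]]; have [uX ud] := push_small u ugs.
  split=> //; rewrite ?hE; last by apply/negP.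
  by rewrite /hypersurface_degree -subn1 leq_sub2r.
move=> x xX xB; pose y i := \sum_j (Lf (i, j))%:Z * x j.
have y_zero : box_zero g (2 ^ L)%N y.
  split=> [i|].
    apply: leq_trans boxL; rewrite -lez_nat abszE /y.
    apply: le_trans (ler_norm_sum _ _ _) _.
    apply: (@le_trans _ _ (\sum_(j < n) (H * B)%N%:Z)).
      apply: ler_sum => j _; rewrite normrM PoszM; apply: ler_pM => //.
        by rewrite ger0_norm // lez_nat (leq_trans (L_le _)) // hH.
      by rewrite -abszE lez_nat.
    by rewrite sumr_const card_ord -mulr_natl natz PoszM.
  have := xX _ fX; rewrite comp_mpoly_meval (meval_eq _ (fun i => lin_forms_eval Lf x i)) => fy.
  apply/eqP; rewrite -(intr_eq0 rat) -meval_map_intr gE mevalZ fy mulr0.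
  by [].
have [u ugs uy] := gs_cover y y_zero; have [uX ud] := push_small u ugs.
have hx : (push u).@[fun j => (x j)%:~R] = 0 by rewrite push_eval uy.
exists (push u) => //; rewrite mem_filter map_f // andbT ltnNge.
apply: contra uX => /msize1_polyC hC; move: hx; rewrite hC mevalC => ->.
by rewrite mpolyC0; case: X_irr => [[[]]].
Qed.

(** * Choice of the parameters in terms of [B] *)

Lemma height_bound_leq n m d : (0 < d)%N -> (m <= n)%N ->
  (height_bound m d <= ((2 * d) + n) ^ n.+2)%N.
Proof.
move=> d0 mn; rewrite /height_bound.
have card_le : (#|{: 'X_{1..m.+1 < d}}| <= (d + n) ^ n.+1)%N.
  apply: leq_trans (leq_pmulr _ (fact_gt0 m.+1)) _; apply: leq_trans (card_bmnm_leq _ _) _ => /=.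
  apply: (@leq_trans ((d + n) ^ m.+1)); first by rewrite leq_exp2r // leq_add2l.
  by rewrite leq_pexp2l // addn_gt0 d0.
rewrite expnSr; apply: (@leq_trans ((2 * d + n) ^ n.+1 * d.+1)); last first.
  by rewrite leq_mul2l; apply/orP; right; lia.
have le1 : ((d + n) ^ n.+1 <= (2 * d + n) ^ n.+1)%N by rewrite leq_exp2r //; lia.
have : (0 < (2 * d + n) ^ n.+1)%N by rewrite expn_gt0; lia.
move=> pos; rewrite mulnS -[leqLHS]add1n; apply: leq_add => //.
by rewrite leq_mul2r (leq_trans card_le le1) orbT.
Qed.

Lemma expR_half_le2 (R : realType) : expR (2^-1) <= 2 :> R.
Proof.
have := @expR_ge1Dx R (- 2^-1); rewrite expRN => h.
have e0 := expR_gt0 (2^-1 : R); rewrite -[leLHS]invrK invf_ple ?posrE ?invr_gt0 //.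
by apply: le_trans h; lra.
Qed.

(* The affine projections of the box of side [B] have size at most [2 ^ L] as soon as
   [L] is of order [(ln B) ^ 2]; with [L] of order [ln B] the constants would depend on [E]. *)
Lemma projected_box_bound (R : realType) n d L B0 (E B : R) :
  0 < E -> 1 <= ln B -> 2 < B -> (n <= d)%N -> d%:R < B `^ E -> B0%:R <= B ->
  2 * (n.+3%:R * (2 + E) + 2) <= ln B -> ln B ^+ 2 < L.+1%:R ->
  (n * ((2 * d + n) ^ n.+2 * B0) <= 2 ^ L)%N.
Proof.
move=> E0 l1 B2 nd dB B0B lT lL; set l := ln B in l1 lT lL *.
have B0' : 0 < B by lra.
have BE : B = expR l by rewrite lnK.
have d_le : (3 * d)%:R <= expR (2 + E * l).
  have e2 : 3 <= expR 2 :> R by apply: le_trans (expR_ge1Dx 2); lra.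
  rewrite natrM expRD; apply: ler_pM; rewrite ?ler0n //.
  by rewrite mulrC expRM -BE ltW.
rewrite -(ler_nat R); apply: (@le_trans _ _ (((3 * d) ^ n.+3 * B0)%N%:R)).
  rewrite ler_nat mulnA leq_mul2r; apply/orP; right; rewrite [leqRHS]expnS.
  by apply: leq_mul; rewrite ?leq_exp2r //; lia.
apply: (@le_trans _ _ (expR (n.+3%:R * (2 + E * l) + l))).
  rewrite natrM expRD natrX expRM_natl -BE; apply: ler_pM; rewrite ?exprn_ge0 ?ler0n //.
  by rewrite lerXn2r ?nnegrE ?expR_ge0.
apply: (@le_trans _ _ (expR (L%:R * 2^-1))).
  rewrite ler_expR; have n0 : 0 <= n.+3%:R :> R by rewrite ler0n.
  have nl : n.+3%:R <= n.+3%:R * l by rewrite ler_peMr.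
  have : 2 * (n.+3%:R * (2 + E) + 2) * l <= l ^+ 2 by rewrite expr2 ler_wpM2r //; lra.
  have : L.+1%:R = L%:R + 1 :> R by rewrite -natr1.
  move: lL; rewrite expr2 => lL LE ll.
  have : n.+3%:R * (2 + E * l) <= n.+3%:R * (2 + E) * l by rewrite -mulrA ler_wpM2l //; nra.
  by rewrite mulrDl; lra.
rewrite expRM_natl natrX lerXn2r ?nnegrE ?expR_ge0 //.
exact: expR_half_le2.
Qed.

Theorem proposition2p4 (R : realType) (n : nat) :
  exists N c kappa : nat -> R,
    (forall m : nat, (1 <= m < n)%N -> 0 < N m) /\
    forall E : R, 0 < E ->
    exists C0 : R,
    forall m : nat, (1 <= m < n)%N ->
    forall (X : {pred {mpoly rat[n]}}) (d : nat) (B : R),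
      irreducible_variety X -> has_dimension X m ->
      has_degree X d -> (0 < d)%N ->
      2 < B ->
      C0 <= ln B `^ N m -> ln B `^ N m < d%:R -> d%:R < B `^ E ->
      exists hs : seq {mpoly rat[n]},
        (size hs)%:R <= c m * ln B `^ kappa m /\
        (forall h, h \in hs ->
           [/\ hypersurface h, (hypersurface_degree h <= d - 1)%N &
               ~ in_hypersurface X h]) /\
        (forall x : 'I_n -> int,
           point_on X x -> (forall i, `|(x i)%:~R : R| <= B) ->
           exists2 h, h \in hs & point_on_hypersurface h x).
Proof.
have [C [a [nC cover]]] := covering_variety n.
(* [L ^ a] is at most [ln B ^+ (2 * a)]; the two further powers of [ln B] absorb [C]. *)
pose N := (2 * a + 2)%N.
exists (fun=> N%:R), (fun=> C%:R), (fun=> (2 * a)%N%:R); split.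
  by move=> m _; rewrite ltr0n /N addn2.
(* [T] exceeds every threshold involving [C] or [E]. With [C0 = T ^+ N] the hypothesis on [C0]
   amounts to [T <= ln B], so that [E] enters [C0] alone. *)
move=> E E0; pose T : R := 2 + C%:R + 2 * (n.+3%:R * (2 + E) + 2).
have C_ge0 : 0 <= C%:R :> R by rewrite ler0n.
have T_E : 0 <= n.+3%:R * (2 + E) by rewrite mulr_ge0 ?ler0n //; lra.
have T0 : 0 <= T by rewrite /T; lra.
exists (T ^+ N) => m _ X d B X_irr _ X_deg d0 B2.
have l0 : 0 < ln B by apply: ln_gt0; lra.
rewrite !powR_mulrn ?(ltW l0) // => lT ld dB; set l := ln B in l0 lT ld *.
have N0 : (0 < N)%N by rewrite /N addn2.
have {}lT : T <= l by move: lT; rewrite ler_pXn2r ?nnegrE ?(ltW l0).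
have l2 : 2 + C%:R <= l by move: lT; rewrite /T; lra.
have sq0 : 0 <= l ^+ 2 by rewrite exprn_ge0 ?(ltW l0).
pose L := Num.trunc (l ^+ 2).
have /andP[L_le L_lt] := truncn_itv sq0; rewrite -/L in L_le L_lt.
have L0 : (0 < L)%N by rewrite truncn_gt0 expr_ge1 //; lra.
have LaR : (L ^ a)%N%:R <= l ^+ (2 * a) :> R.
  by rewrite natrX exprM lerXn2r ?nnegrE.
have Cd : (C * L ^ a <= d)%N.
  rewrite -(ler_nat R); apply: le_trans (ltW ld); rewrite /N exprD natrM mulrC.
  by apply: ler_pM => //; rewrite ?ler0n // expr2; nra.
have nd : (n <= d)%N.
  by apply: leq_trans Cd; apply: leq_trans nC _; rewrite leq_pmulr // expn_gt0 L0.
pose B0 := Num.trunc B; have /andP[B0_le B0_lt] : B0%:R <= B < B0.+1%:R by apply: truncn_itv; lra.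
have box : (n * ((2 * d + n) ^ n.+2 * B0) <= 2 ^ L)%N.
  by apply: projected_box_bound E0 _ B2 nd dB B0_le _ L_lt; rewrite -/l; move: lT; rewrite /T; lra.
have [hs [hs_size hs_deg hs_cover]] :=
  cover X d L _ B0 X_irr X_deg d0 L0 Cd (fun m mn => height_bound_leq d0 mn) box.
exists hs; split; last split=> // x xX xB.
  apply: le_trans (_ : (C * L ^ a)%N%:R <= _); first by rewrite ler_nat.
  by rewrite natrM ler_wpM2l.
apply: hs_cover => // i; rewrite truncn_ge_nat; last by lra.
by apply: le_trans (xB i); rewrite -intr_norm -abszE -pmulrn.
Qed.
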